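(* Let $M=(M^{2m+1};\varphi,\xi,\eta,g)\in\mathcal A_5$ (i.e. $M$ is a nearly $\alpha$-contact metric manifold) and let $f:M\to N$ be a $(\pm)$-holomorphic map. (1) If $N\in\mathcal A_1\cup\mathcal A_4\cup\mathcal B_1\cup\mathcal C_1$, then $f$ is harmonic if $M$ is semi-symplectic (that is, $\sum_{i=1}^mS^M(\varphi e_i,e_i)=0$). (2) If $N\in\mathcal A_1\cup\mathcal A_4\cup\mathcal A_6\cup\mathcal A_7\cup\mathcal C_2$ and $f$ is horizontally weakly conformal, then $f$ is a harmonic morphism if $M$ is semi-symplectic.
   Context: Manifolds and maps are smooth; $\nabla$ denotes Levi-Civita connections. An almost contact metric manifold $M=(M^{2m+1};\varphi,\xi,\eta,g)$ is a $(2m+1)$-dimensional Riemannian manifold with a $(1,1)$-tensor $\varphi$, a vector field $\xi$ and a 1-form $\eta$ such that $\varphi^2X=-X+\eta(X)\xi$, $\eta(\xi)=1$, $g(\varphi X,\varphi Y)=g(X,Y)-\eta(X)\eta(Y)$. Put $\Omega(X,Y)=g(X,\varphi Y)$, $P(X,Y)=(\nabla_X\varphi)Y+(\nabla_{\varphi X}\varphi)\varphi Y$, $Q(X,Y)=(\nabla_X\varphi)Y+(\nabla_Y\varphi)X$, $S^M(X,Y)=(\nabla_X\varphi)Y-(\nabla_Y\varphi)X$, $2\mathfrak h=\mathcal L_\xi\varphi$. Conventions: $2d\eta(X,Y)=X\eta(Y)-Y\eta(X)-\eta([X,Y])$; $\{e_i;\varphi e_i;\xi\}_{1\le i\le m}$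 is any local orthonormal frame; $\delta\Omega(X)=g(-\varphi(\nabla_\xi\xi)+\sum_iP(e_i,e_i),X)$. $M$ is normal if $[\varphi,\varphi]+2d\eta\otimes\xi=0$, where $[\varphi,\varphi](X,Y)=\varphi^2[X,Y]+[\varphi X,\varphi Y]-\varphi[\varphi X,Y]-\varphi[X,\varphi Y]$. Classes. $\mathcal A_1$: $\alpha$-contact metric manifolds ($d\eta=\alpha\Omega$, $\alpha\neq0$ a real constant); quasi-contact metric manifolds ($P(X,Y)=2g(X,Y)\xi-\eta(Y)\{X+\eta(X)\xi+\mathfrak hX\}$); quasi-$\mathcal K$-Sasakian manifolds ($P(X,Y)=2g(X,Y)\xi-2\eta(Y)X+\eta(Y)\nabla_{\varphi X}\xi$); strongly pseudoconvex CR-manifolds ($d\eta=\Omega$ and $(\nabla_X\varphi)Y=g(X+\mathfrak hX,Y)\xi-\eta(Y)(X+\mathfrak hX)$); $\alpha$-Sasakian manifolds ($d\eta=\alpha\Omega$, $\alpha\neq0$ constant, and normal). $\mathcal A_4$: quasi-Sasakian manifolds (normal, $d\Omega=0$, and $\eta\wedge(d\eta)^r\neq0$, $(d\eta)^{r+1}=0$ for some $1\le r\le m-1$). $\mathcal A_5$: nearly $\alpha$-contact metric manifolds ($2\alpha\Omega(X,Y)=d\eta(X,Y)+d\eta(\varphi X,\varphi Y)$, $\alpha\ne0$ a real constant). $\mathcal A_6$: nearly $\alpha$-Sasakian manifolds ($Q(X,Y)=\alpha\{2g(X,Y)\xi-\eta(Y)X-\eta(X)Y\}$, $\alpha\ne0$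 constant). $\mathcal A_7$: semi-Sasakian manifolds (normal and $\delta\Omega=2m\eta$). $\mathcal B_1$: cosymplectic ($d\eta=0$, $d\Omega=0$, normal), almost cosymplectic ($d\eta=0$, $d\Omega=0$), nearly cosymplectic ($(\nabla_X\varphi)X=0$), nearly-$\mathcal K$-cosymplectic ($(\nabla_X\varphi)X=0$ and $(\nabla_X\varphi)\xi=0$), quasi-$\mathcal K$-cosymplectic ($P(X,Y)=\eta(Y)\nabla_{\varphi X}\xi$) manifolds. $\mathcal C_1$: almost Hermitian manifolds $(H;J,G)$ that are Kähler ($\nabla J=0$), nearly Kähler ($(\nabla_XJ)X=0$), almost Kähler ($d\Phi=0$, $\Phi(X,Y)=G(X,JY)$) or quasi-Kähler ($S^H(JX,X)=0$, where $S^H(X,Y)=(\nabla_XJ)Y-(\nabla_YJ)X$). $\mathcal C_2$: semi-Kähler manifolds: almost Hermitian with $\sum_iS^H(Je_i,e_i)=0$ for local orthonormal frames $\{e_i;Je_i\}$. An almost contact metric target is written $N=(N^{2n+1};\phi,\gamma,\sigma,h)$, with the same notions for $(\phi,\gamma,\sigma,h,n)$. $f$ is $(\pm)$-holomorphic if $f_*\varphi=\pm\psi f_*$ (one fixed sign), with $\psi=\phi$, resp. $\psi=J$ for an almost Hermitian target. $f$ is harmonic if its tension field vanishes. $f$ is horizontally weakly conformal if for some function $\mu\ge0$, $h(f_*X,f_*Y)=\mu(p)^2g(X,Y)$ ($h$ the target metric) for all $p$ and $X,Y\in\mathcal H_p=(\ker f_{*p})^\perp$, and $f_{*p}:\mathcal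 H_p\to T_{f(p)}N$ is surjective where $\mu(p)>0$. A harmonic morphism is a harmonic horizontally weakly conformal map. *)

(* Defs.v *)
From HB Require Import structures.
From mathcomp Require Import all_boot all_order all_algebra all_fingroup.
From mathcomp Require Import all_classical all_reals all_analysis.
Import Order.TTheory GRing.Theory Num.Theory.
Import numFieldNormedType.Exports.

Set Implicit Arguments.
Unset Strict Implicit.
Unset Printing Implicit Defensive.

Local Open Scope classical_set_scope.
Local Open Scope ring_scope.

Fixpoint Ck (R : realType) (V W : normedModType R) (U : set V) (k : nat)
    (f : V -> W) : Prop :=
  match k with
  | 0 => forall x, U x -> {for x, continuous f}
  | k'.+1 => (forall x, U x -> differentiable f x) /\
             (forall v : V, Ck U k' (fun x => 'D_v f x))
  end.

Definition smooth_on (R : realType) (V W : normedModType R) (U : set V)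
    (f : V -> W) : Prop := forall k, Ck U k f.

Section Manifolds.
Variable R : realType.

(* A chart is a homeomorphism between an open set of T and an open set of R^d;
   [cinv] is only meaningful on the image. *)
Record chart (T : topologicalType) (d : nat) := Chart {
  cdom : set T;
  cmap : T -> 'rV[R]_d;
  cinv : 'rV[R]_d -> T;
  cdom_open : open cdom;
  cimg_open : open (cmap @` cdom);
  cmapK : forall p, cdom p -> cinv (cmap p) = p;
  cmap_continuous : forall p, cdom p -> {for p, continuous cmap};
  cinv_continuous : forall x, (cmap @` cdom) x -> {for x, continuous cinv}
}.

Definition cimg T d (c : chart T d) : set 'rV[R]_d := cmap c @` cdom c.

Definition overlap T d (c c' : chart T d) : set 'rV[R]_d :=
  cmap c @` (cdom c `&` cdom c').

Definition transition T d (c c' : chart T d) : 'rV[R]_d -> 'rV[R]_d :=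
  cmap c' \o cinv c.

Record manifold (d : nat) := Manifold {
  points :> topologicalType;
  points_hausdorff : hausdorff_space points;
  points_second_countable : @second_countable points;
  atlas : set (chart points d);
  atlas_cover : forall p : points, exists2 c, atlas c & cdom c p;
  atlas_smooth : forall c c', atlas c -> atlas c' ->
    smooth_on (overlap c c') (transition c c')
}.

(* Tensor fields are given classically, by their components in every chart c,
   as functions on the image of c, subject to the tensorial transformation law
   under change of charts.  Tangent vectors are row vectors; the Jacobian
   of a change of charts at x maps v to 'D_v (transition c c') x.  A linear form is
   a column, an endomorphism a matrix acting on the right. *)
Definition vec_law d (M : manifold d) (X : chart M d -> 'rV[R]_d -> 'rV[R]_d) :=
  forall c c', atlas c -> atlas c' -> forall x, overlap c c' x ->
    X c' (transition c c' x) = 'D_(X c x) (transition c c') x.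

Definition form_law d (M : manifold d) (a : chart M d -> 'rV[R]_d -> 'cV[R]_d) :=
  forall c c', atlas c -> atlas c' -> forall x, overlap c c' x ->
    forall v : 'rV[R]_d,
      'D_v (transition c c') x *m a c' (transition c c' x) = v *m a c x.

Definition endo_law d (M : manifold d) (A : chart M d -> 'rV[R]_d -> 'M[R]_d) :=
  forall c c', atlas c -> atlas c' -> forall x, overlap c c' x ->
    forall v : 'rV[R]_d,
      'D_v (transition c c') x *m A c' (transition c c' x) =
      'D_(v *m A c x) (transition c c') x.

Definition bilin_law d (M : manifold d) (g : chart M d -> 'rV[R]_d -> 'M[R]_d) :=
  forall c c', atlas c -> atlas c' -> forall x, overlap c c' x ->
    forall v w : 'rV[R]_d,
      'D_v (transition c c') x *m g c' (transition c c' x)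
        *m ('D_w (transition c c') x)^T = v *m g c x *m w^T.

Definition smooth_components d (M : manifold d) (W : normedModType R)
    (a : chart M d -> 'rV[R]_d -> W) :=
  forall c, atlas c -> smooth_on (cimg c) (a c).

Definition bilin d (g : 'M[R]_d) (v w : 'rV[R]_d) : R := (v *m g *m w^T) 0 0.

Record riemannian (d : nat) := Riemannian {
  rman :> manifold d;
  metric : chart rman d -> 'rV[R]_d -> 'M[R]_d;
  metric_smooth : smooth_components metric;
  metric_law : bilin_law metric;
  metric_sym : forall c x, atlas c -> cimg c x ->
    forall v w, bilin (metric c x) v w = bilin (metric c x) w v;
  metric_pos : forall c x, atlas c -> cimg c x ->
    forall v, v != 0 -> 0 < bilin (metric c x) v v
}.

(* A Riemannian manifold with a (1,1)-tensor field: the common part of almost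
   contact metric and almost Hermitian manifolds. *)
Record riem_endo (d : nat) := RiemEndo {
  eman :> riemannian d;
  endo : chart eman d -> 'rV[R]_d -> 'M[R]_d;
  endo_smooth : smooth_components endo;
  endo_transf : endo_law endo
}.

Record almost_contact (m : nat) := AlmostContact {
  acman :> riem_endo m.*2.+1;
  xi : chart acman m.*2.+1 -> 'rV[R]_(m.*2.+1) -> 'rV[R]_(m.*2.+1);
  eta : chart acman m.*2.+1 -> 'rV[R]_(m.*2.+1) -> 'cV[R]_(m.*2.+1);
  xi_smooth : smooth_components xi;
  xi_law : vec_law xi;
  eta_smooth : smooth_components eta;
  eta_law : form_law eta;
  phi_sqr : forall c x, atlas c -> cimg c x -> forall v : 'rV[R]_(m.*2.+1),
    v *m endo c x *m endo c x = - v + (v *m eta c x) 0 0 *: xi c x;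
  eta_xi : forall c x, atlas c -> cimg c x -> (xi c x *m eta c x) 0 0 = 1;
  phi_metric : forall c x, atlas c -> cimg c x -> forall v w : 'rV[R]_(m.*2.+1),
    bilin (metric c x) (v *m endo c x) (w *m endo c x) =
    bilin (metric c x) v w - (v *m eta c x) 0 0 * (w *m eta c x) 0 0
}.

Record almost_hermitian (n : nat) := AlmostHermitian {
  ahman :> riem_endo n.*2;
  J_sqr : forall (c : chart ahman n.*2) x, atlas c -> cimg c x -> forall v : 'rV[R]_(n.*2),
    v *m endo c x *m endo c x = - v;
  J_metric : forall (c : chart ahman n.*2) x, atlas c -> cimg c x -> forall v w : 'rV[R]_(n.*2),
    bilin (metric c x) (v *m endo c x) (w *m endo c x) = bilin (metric c x) v w
}.

End Manifolds.

(* Calculus in a chart: vector fields on the image of a chart are maps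
   'rV_d -> 'rV_d, and (cst v) is the field with constant components v. *)
Section VectorFields.
Variables (R : realType) (d : nat).
Local Notation V := 'rV[R]_d.

Definition lie (X Y : V -> V) (x : V) : V := 'D_(X x) Y x - 'D_(Y x) X x.

(* The normalizations of [ext_d1], [ext_d2] and [wedge] are those for which
   2 d a(X,Y) = X a(Y) - Y a(X) - a([X,Y]). *)
Definition ext_d1 (a : (V -> V) -> V -> R) (X Y : V -> V) (x : V) : R :=
  2^-1 * ('D_(X x) (a Y) x - 'D_(Y x) (a X) x - a (lie X Y) x).

Definition ext_d2 (w : (V -> V) -> (V -> V) -> V -> R) (X Y Z : V -> V) (x : V)
    : R :=
  3^-1 * ('D_(X x) (w Y Z) x + 'D_(Y x) (w Z X) x + 'D_(Z x) (w X Y) x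
          - w (lie X Y) Z x - w (lie Y Z) X x - w (lie Z X) Y x).

Definition mform (k : nat) := ('I_k -> V) -> R.

Definition wedge k l (a : mform k) (b : mform l) : mform (k + l) := fun v =>
  ((k + l)`!%:R)^-1 * \sum_(s : 'S_(k + l)) (-1) ^+ s
    * a (fun i => v (s (lshift l i))) * b (fun j => v (s (rshift k j))).

Fixpoint wedge_pow (w : mform 2) (r : nat) : mform r.*2 :=
  match r with
  | 0 => fun _ => 1
  | r'.+1 => wedge w (@wedge_pow w r')
  end.

End VectorFields.

Arguments wedge_pow {R d} w r v.

Section RiemannianGeometry.
Variables (R : realType) (d : nat) (M : riemannian R d) (c : chart R M d).
Local Notation V := 'rV[R]_d.

Definition gdot (X Y : V -> V) (x : V) : R := bilin (metric c x) (X x) (Y x).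

(* Levi-Civita connection: Koszul's formula on fields with constant components
   gives g(Gamma(v,w), e_k), and the index is raised with g^-1. *)
Definition christoffel (x v w : V) : V :=
  (\row_k (2^-1 * ('D_v (gdot (cst w) (cst (delta_mx 0 k))) x
                   + 'D_w (gdot (cst v) (cst (delta_mx 0 k))) x
                   - 'D_(delta_mx 0 k) (gdot (cst v) (cst w)) x)))
  *m invmx (metric c x).

Definition nabla (X Y : V -> V) (x : V) : V :=
  'D_(X x) Y x + christoffel x (X x) (Y x).

End RiemannianGeometry.

Section EndomorphismFields.
Variables (R : realType) (d : nat) (M : riem_endo R d) (c : chart R M d).
Local Notation V := 'rV[R]_d.

Definition phi (X : V -> V) (x : V) : V := X x *m endo c x.

(* (nabla_X phi) Y *)
Definition nabla_phi (X Y : V -> V) (x : V) : V :=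
  nabla c X (phi Y) x - phi (nabla c X Y) x.

Definition Omega (X Y : V -> V) : V -> R := gdot c X (phi Y).

Definition tP (X Y : V -> V) (x : V) : V :=
  nabla_phi X Y x + nabla_phi (phi X) (phi Y) x.

Definition tQ (X Y : V -> V) (x : V) : V := nabla_phi X Y x + nabla_phi Y X x.

Definition tS (X Y : V -> V) (x : V) : V := nabla_phi X Y x - nabla_phi Y X x.

Definition nijenhuis (X Y : V -> V) (x : V) : V :=
  phi (phi (lie X Y)) x + lie (phi X) (phi Y) x
  - phi (lie (phi X) Y) x - phi (lie X (phi Y)) x.

End EndomorphismFields.

Section ContactTensors.
Variables (R : realType) (m : nat) (M : almost_contact R m).
Variable c : chart R M m.*2.+1.
Local Notation V := 'rV[R]_(m.*2.+1).

Definition eta_ (X : V -> V) (x : V) : R := (X x *m eta c x) 0 0.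

Definition d_eta : (V -> V) -> (V -> V) -> V -> R := ext_d1 eta_.

Definition d_Omega : (V -> V) -> (V -> V) -> (V -> V) -> V -> R :=
  ext_d2 (@Omega R _ M c).

(* 2 h = L_xi phi *)
Definition tH (X : V -> V) (x : V) : V :=
  2^-1 *: (lie (xi c) (phi c X) x - phi c (lie (xi c) X) x).

Definition eta_form (x : V) : mform R m.*2.+1 1 := fun v => eta_ (cst (v 0)) x.

Definition d_eta_form (x : V) : mform R m.*2.+1 2 :=
  fun v => d_eta (cst (v 0)) (cst (v 1)) x.

(* {e_i; phi e_i; xi} is an orthonormal basis of the tangent space at x *)
Definition adapted_basis (x : V) (e : 'I_m -> V) : Prop :=
  let g := bilin (metric c x) in
  let fe i := e i *m endo c x in
  [/\ forall i j, g (e i) (e j) = (i == j)%:R /\ g (fe i) (fe j) = (i == j)%:R,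
      forall i j, g (e i) (fe j) = 0,
      forall i, g (e i) (xi c x) = 0 /\ g (fe i) (xi c x) = 0
    & g (xi c x) (xi c x) = 1].

(* sum_i P(e_i, e_i) at x; P and S being tensorial, the sums below do not depend
   on the way the e_i are extended to a local frame around x. *)
Definition trace_P (x : V) (e : 'I_m -> V) : V :=
  \sum_i tP c (cst (e i)) (cst (e i)) x.

Definition trace_S (x : V) (e : 'I_m -> V) : V :=
  \sum_i tS c (phi c (cst (e i))) (cst (e i)) x.

Definition delta_Omega (e : 'I_m -> V) (X : V -> V) (x : V) : R :=
  bilin (metric c x) (- phi c (nabla c (xi c) (xi c)) x + trace_P x e) (X x).

End ContactTensors.

Arguments eta_form {R m M} c x v.
Arguments d_eta_form {R m M} c x v.

Section HermitianFrames.
Variables (R : realType) (n : nat) (H : almost_hermitian R n).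
Variable c : chart R H n.*2.
Local Notation V := 'rV[R]_(n.*2).

Definition hermitian_basis (x : V) (e : 'I_n -> V) : Prop :=
  let g := bilin (metric c x) in
  let Je i := e i *m endo c x in
  (forall i j, g (e i) (e j) = (i == j)%:R /\ g (Je i) (Je j) = (i == j)%:R) /\
  (forall i j, g (e i) (Je j) = 0).

Definition herm_trace_S (x : V) (e : 'I_n -> V) : V :=
  \sum_i tS c (phi c (cst (e i))) (cst (e i)) x.

End HermitianFrames.

(* E holds at every point of every chart, for all smooth vector fields on it *)
Definition for_fields1 (R : realType) d (M : manifold R d)
    (E : chart R M d -> ('rV[R]_d -> 'rV[R]_d) -> 'rV[R]_d -> Prop) : Prop :=
  forall c, atlas c -> forall X : 'rV[R]_d -> 'rV[R]_d, smooth_on (cimg c) X ->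
    forall x, cimg c x -> E c X x.

Definition for_fields2 (R : realType) d (M : manifold R d)
    (E : chart R M d -> ('rV[R]_d -> 'rV[R]_d) -> ('rV[R]_d -> 'rV[R]_d) ->
         'rV[R]_d -> Prop) : Prop :=
  for_fields1 (fun c X x => forall Y, smooth_on (cimg c) Y -> E c X Y x).

Definition for_fields3 (R : realType) d (M : manifold R d)
    (E : chart R M d -> ('rV[R]_d -> 'rV[R]_d) -> ('rV[R]_d -> 'rV[R]_d) ->
         ('rV[R]_d -> 'rV[R]_d) -> 'rV[R]_d -> Prop) : Prop :=
  for_fields2 (fun c X Y x => forall Z, smooth_on (cimg c) Z -> E c X Y Z x).

Section ContactClasses.
Variables (R : realType) (m : nat) (M : almost_contact R m).

Definition is_normal : Prop := for_fields2 (M := M) (fun c X Y x =>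
  nijenhuis c X Y x + (2 * d_eta c X Y x) *: xi c x = 0).

Definition d_eta_eq (alpha : R) : Prop := for_fields2 (M := M) (fun c X Y x =>
  d_eta c X Y x = alpha * Omega c X Y x).

Definition eta_closed : Prop := for_fields2 (M := M) (fun c X Y x =>
  d_eta c X Y x = 0).

Definition Omega_closed : Prop := for_fields3 (M := M) (fun c X Y Z x =>
  d_Omega c X Y Z x = 0).

Definition alpha_contact : Prop := exists2 alpha : R, alpha != 0 & d_eta_eq alpha.

Definition quasi_contact : Prop := for_fields2 (M := M) (fun c X Y x =>
  tP c X Y x = (2 * gdot c X Y x) *: xi c x
    - eta_ c Y x *: (X x + eta_ c X x *: xi c x + tH c X x)).

Definition quasi_K_sasakian : Prop := for_fields2 (M := M) (fun c X Y x =>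
  tP c X Y x = (2 * gdot c X Y x) *: xi c x - (2 * eta_ c Y x) *: X x
    + eta_ c Y x *: nabla c (phi c X) (xi c) x).

Definition strongly_pseudoconvex_CR : Prop := d_eta_eq 1 /\
  for_fields2 (M := M) (fun c X Y x =>
    nabla_phi c X Y x = gdot c (fun y => X y + tH c X y) Y x *: xi c x
      - eta_ c Y x *: (X x + tH c X x)).

Definition alpha_sasakian : Prop :=
  (exists2 alpha : R, alpha != 0 & d_eta_eq alpha) /\ is_normal.

Definition class_A1 : Prop :=
  [\/ alpha_contact, quasi_contact, quasi_K_sasakian |
      strongly_pseudoconvex_CR \/ alpha_sasakian].

(* quasi-Sasakian: eta /\ (d eta)^r vanishes at no point, (d eta)^(r+1) = 0 *)
Definition class_A4 : Prop := [/\ is_normal, Omega_closed &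
  exists2 r : nat, (1 <= r <= m.-1)%N &
    forall c : chart R M m.*2.+1, atlas c -> forall x, cimg c x ->
      (exists v, wedge (eta_form c x) (wedge_pow (d_eta_form c x) r) v != 0) /\
      (forall v, wedge_pow (d_eta_form c x) r.+1 v = 0)].

(* nearly alpha-contact metric *)
Definition class_A5 : Prop := exists2 alpha : R, alpha != 0 &
  for_fields2 (M := M) (fun c X Y x =>
    2 * alpha * Omega c X Y x =
    d_eta c X Y x + d_eta c (phi c X) (phi c Y) x).

(* nearly alpha-Sasakian *)
Definition class_A6 : Prop := exists2 alpha : R, alpha != 0 &
  for_fields2 (M := M) (fun c X Y x =>
    tQ c X Y x = alpha *: ((2 * gdot c X Y x) *: xi c x
      - eta_ c Y x *: X x - eta_ c X x *: Y x)).

(* semi-Sasakian *)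
Definition class_A7 : Prop := is_normal /\
  for_fields1 (M := M) (fun c X x => forall e, adapted_basis c x e ->
    delta_Omega c e X x = 2 * m%:R * eta_ c X x).

Definition cosymplectic : Prop := [/\ eta_closed, Omega_closed & is_normal].

Definition almost_cosymplectic : Prop := eta_closed /\ Omega_closed.

Definition nearly_cosymplectic : Prop := for_fields1 (M := M) (fun c X x =>
  nabla_phi c X X x = 0).

Definition nearly_K_cosymplectic : Prop := for_fields1 (M := M) (fun c X x =>
  nabla_phi c X X x = 0 /\ nabla_phi c X (xi c) x = 0).

Definition quasi_K_cosymplectic : Prop := for_fields2 (M := M) (fun c X Y x =>
  tP c X Y x = eta_ c Y x *: nabla c (phi c X) (xi c) x).

Definition class_B1 : Prop :=
  [\/ cosymplectic, almost_cosymplectic, nearly_cosymplectic |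
      nearly_K_cosymplectic \/ quasi_K_cosymplectic].

Definition semi_symplectic : Prop :=
  forall c : chart R M m.*2.+1, atlas c -> forall x, cimg c x ->
    forall e, adapted_basis c x e -> trace_S c x e = 0.

End ContactClasses.

Section HermitianClasses.
Variables (R : realType) (n : nat) (H : almost_hermitian R n).

Definition kahler : Prop := for_fields2 (M := H) (fun c X Y x =>
  nabla_phi c X Y x = 0).

Definition nearly_kahler : Prop := for_fields1 (M := H) (fun c X x =>
  nabla_phi c X X x = 0).

Definition almost_kahler : Prop := for_fields3 (M := H) (fun c X Y Z x =>
  ext_d2 (@Omega R _ H c) X Y Z x = 0).

Definition quasi_kahler : Prop := for_fields1 (M := H) (fun c X x =>
  tS c (phi c X) X x = 0).

Definition class_C1 : Prop :=
  [\/ kahler, nearly_kahler, almost_kahler | quasi_kahler].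

(* semi-Kaehler *)
Definition class_C2 : Prop :=
  forall c : chart R H n.*2, atlas c -> forall x, cimg c x ->
    forall e, hermitian_basis c x e -> herm_trace_S c x e = 0.

End HermitianClasses.

Section Maps.
Variables (R : realType) (a b : nat).

Definition local_rep (M : manifold R a) (N : manifold R b) (f : M -> N)
    (c : chart R M a) (c' : chart R N b) : 'rV[R]_a -> 'rV[R]_b :=
  cmap c' \o f \o cinv c.

Definition smooth_map (M : manifold R a) (N : manifold R b) (f : M -> N) : Prop :=
  continuous f /\
  forall c c', atlas c -> atlas c' ->
    smooth_on (cmap c @` (cdom c `&` f @^-1` cdom c')) (local_rep f c c').

(* E holds at every point p, for all charts c at p and c' at f p; the last
   argument of E is the coordinate vector of p. *)
Definition at_points (M : manifold R a) (N : manifold R b) (f : M -> N)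
    (E : M -> chart R M a -> chart R N b -> 'rV[R]_a -> Prop) : Prop :=
  forall p c c', atlas c -> atlas c' -> cdom c p -> cdom c' (f p) ->
    E p c c' (cmap c p).

(* f_* phi = psi f_* if s = false, f_* phi = - psi f_* if s = true *)
Definition pm_holomorphic (M : riem_endo R a) (N : riem_endo R b) (f : M -> N)
    : Prop :=
  exists s : bool, at_points f (fun p c c' x =>
    let F := local_rep f c c' in
    forall v : 'rV[R]_a,
      'D_(v *m endo c x) F x = (-1) ^+ s *: ('D_v F x *m endo c' (F x))).

Section Tension.
Variables (M : riemannian R a) (N : riemannian R b) (f : M -> N).

(* (nabla df)(v,w) = nabla^f_v (f_* w) - f_* (nabla_v w), nabla^f being the
   connection induced on the pullback bundle f^* TN *)
Definition second_fundamental_form (c : chart R M a) (c' : chart R N b)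
    (x v w : 'rV[R]_a) : 'rV[R]_b :=
  let F := local_rep f c c' in
  'D_v (fun y => 'D_w F y) x + christoffel c' (F x) ('D_v F x) ('D_w F x)
  - 'D_(nabla c (cst v) (cst w) x) F x.

Definition tension (c : chart R M a) (c' : chart R N b) (x : 'rV[R]_a)
    : 'rV[R]_b :=
  \sum_(i < a) \sum_(j < a) invmx (metric c x) i j *:
    second_fundamental_form c c' x (delta_mx 0 i) (delta_mx 0 j).

Definition harmonic_map : Prop := at_points f (fun p c c' x => tension c c' x = 0).

Definition horizontal (c : chart R M a) (c' : chart R N b) (x v : 'rV[R]_a)
    : Prop :=
  forall w : 'rV[R]_a, 'D_w (local_rep f c c') x = 0 -> bilin (metric c x) v w = 0.

Definition horizontally_weakly_conformal : Prop :=
  exists mu : M -> R, (forall p, 0 <= mu p) /\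
    at_points f (fun p c c' x =>
      let F := local_rep f c c' in
      (forall v w, horizontal c c' x v -> horizontal c c' x w ->
         bilin (metric c' (F x)) ('D_v F x) ('D_w F x) =
         mu p ^+ 2 * bilin (metric c x) v w) /\
      (0 < mu p -> forall u : 'rV[R]_b,
         exists2 v, horizontal c c' x v & 'D_v F x = u)).

Definition harmonic_morphism : Prop := harmonic_map /\ horizontally_weakly_conformal.

End Tension.
End Maps.

Arguments smooth_map {R a b M N} f.
Arguments pm_holomorphic {R a b M N} f.
Arguments harmonic_map {R a b M N} f.
Arguments horizontally_weakly_conformal {R a b M N} f.
Arguments harmonic_morphism {R a b M N} f.

(* Main.v *)
(* Differentiating f_* phi = s psi f_* (s = 1 or -1) shows that, for v orthogonal
   to xi, the second fundamental form B of f satisfies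
     B(v, v) + B(phi v, phi v) = S^N(psi f_* v, f_* v) - f_* S^M(phi v, v).
   If M is semi-symplectic, the tension field is therefore the sum of B(xi,
     xi) and
   of the S^N(psi f_* e_i, f_* e_i).

   B(xi, xi) vanishes: the class A5 forces nabla_xi xi = 0,
     and for a contact target
   f_* xi = k gamma and f^* sigma = k eta,
     whence dk = xi(k) eta when d sigma(gamma, .)
   = 0; then 0 = d(dk) evaluated on (e, phi e) is xi(k) d eta(e, phi e), and
   d eta(e, phi e) = - alpha is nonzero on M.

   In every class except A7 and C2, S^N(psi w,
     w) = 0 for each w orthogonal to gamma:
   either d Omega = 0, or one pairs the defining identity at (w,
     gamma) with psi w.
   For A7, near a point where f_* is nonzero f is a submersion,
     and it transports
   d eta(v, phi v) = - alpha |v|^2 to k d sigma = const . Omega along f, so that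
   d Omega = 0 there too.  For C2, the sum over i is a multiple of the trace
     that
   defines semi-Kaehler manifolds. *)

Require Import Defs.
From HB Require Import structures.
From mathcomp Require Import all_boot all_order all_algebra all_fingroup.
From mathcomp Require Import all_classical all_reals all_analysis.
From mathcomp Require Import ring lra.
(* Again, since mathcomp shadows [eta] and [metric_sym]. *)
Require Import Defs.
Import Order.TTheory GRing.Theory Num.Theory.
Import numFieldNormedType.Exports.

Set Implicit Arguments.
Unset Strict Implicit.
Unset Printing Implicit Defensive.

Local Open Scope classical_set_scope.
Local Open Scope ring_scope.

(** * Differential calculus in normed modules *)

(** Tensoriality keeps almost everything at a single point. The defining identities are tested
    mainly on fields with constant components in one chart, whose brackets vanish, and become
    identities between [cov_endo] and [cov_vec], which depend on vectors at that point. No local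
    orthonormal frame is built either: the tension is the contraction of the bilinear map B with the
    inverse metric, and one adapted basis at the point splits the inverse metric into rank one
    terms.

    A5 constrains only the phi-invariant part of d eta. It therefore yields d eta(xi, .) and d
    eta(v, phi v), and nothing about d eta(v, w) in general. The first value makes xi geodesic; the
    second is what the argument on dk has to live on.

    Neighbourhoods matter in three places: structural identities such as phi^2 = -1 + eta (x) xi or
    holomorphy are differentiated, dk = 0 is obtained from the symmetry of second derivatives of k,
    and in the A7 case the relation between d sigma and Omega is known only along f, so that it is
    differentiated on M and its derivatives on N are recovered by lifting vectors. *)

Section Calculus.
Variables (R : realType) (V : normedModType R).
Implicit Types (U : set V) (x v : V).

Lemma derive_eq_on (W : normedModType R) U (f g : V -> W) x v : open U -> U x ->
  (forall y, U y -> f y = g y) -> 'D_v f x = 'D_v g x.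
Proof.
move=> Uo Ux fg; apply: near_eq_derive.
by have := open_nbhs_nbhs (conj Uo Ux); apply: filterS => y /fg.
Qed.

(** The first order expansion at [x] sees only the germ of the function, so the one of [f] serves
    for [g]; [diff_unique] then identifies the two differentials. *)
Lemma differentiable_eq_on (W : normedModType R) U (f g : V -> W) x :
  open U -> U x -> (forall y, U y -> f y = g y) ->
  differentiable f x -> differentiable g x.
Proof.
move=> Uo Ux fg df; apply/diff_locallyP.
have [dc /eqaddoP dE] := (diff_locallyP _ _).1 df.
have fgx : f x = g x by exact: fg.
have near_fg : \forall h \near (0 : V), f (h + x) = g (h + x).
  have : \forall y \near x, U y by exact: open_nbhs_nbhs (conj Uo Ux).
  rewrite (near_shift 0 x) subr0.
  by apply: filterS => h /fg.
have key : g \o shift x = cst (g x) + 'd f x +o_ 0 id.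
  apply/eqaddoP => e e0; have := dE e e0; apply: filterS2 near_fg => h /= E.
  by rewrite !fctE /= E fgx.
have -> : 'd g x = 'd f x :> (V -> W) by exact: diff_unique dc key.
by split.
Qed.

Lemma differentiable_mxP m n (f : V -> 'M[R]_(m, n)) x :
  differentiable f x <-> forall i j, differentiable (fun y => f y i j) x.
Proof.
split=> [df i j|df].
  exact: (differentiable_comp df (differentiable_coord (f x) i j)).
have -> : f = \sum_(i < m) \sum_(j < n) (fun y => f y i j *: delta_mx i j).
  apply/funext => y; rewrite fct_sumE [LHS]matrix_sum_delta.
  by apply: eq_bigr => i _; rewrite fct_sumE.
by apply: differentiable_sum => i; apply: differentiable_sum => j;
  exact: differentiableZl.
Qed.

Lemma derive_entry m n (f : V -> 'M[R]_(m, n)) x v i j : differentiable f x ->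
  ('D_v f x) i j = 'D_v (fun y => f y i j) x.
Proof. by move=> df; rewrite derive_mx ?mxE//; exact: diff_derivable. Qed.

Lemma derive_comp (W Z : normedModType R) (F : V -> W) (h : W -> Z) x v :
  differentiable F x -> differentiable h (F x) ->
  'D_v (h \o F) x = 'D_('D_v F x) h (F x).
Proof.
move=> dF dh; rewrite deriveE; last exact: differentiable_comp.
by rewrite diff_comp //= [in RHS]deriveE// [in RHS]deriveE.
Qed.

Lemma derive_dirD (W : normedModType R) (f : V -> W) x u v :
  differentiable f x -> 'D_(u + v) f x = 'D_u f x + 'D_v f x.
Proof. by move=> df; rewrite !deriveE// linearD. Qed.

Lemma derive_dirN (W : normedModType R) (f : V -> W) x u :
  differentiable f x -> 'D_(- u) f x = - 'D_u f x.
Proof. by move=> df; rewrite !deriveE// linearN. Qed.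

Lemma derive_dirZ (W : normedModType R) (f : V -> W) x (a : R) u :
  differentiable f x -> 'D_(a *: u) f x = a *: 'D_u f x.
Proof. by move=> df; rewrite !deriveE// linearZ. Qed.

Lemma derive_fun_sum n (W : normedModType R) (h : 'I_n -> V -> W) x v :
  (forall i, differentiable (h i) x) ->
  'D_v (fun y => \sum_i h i y) x = \sum_i 'D_v (h i) x.
Proof.
move=> dh; rewrite -derive_sum//; last by move=> i; exact: diff_derivable.
by congr ('D_v _ x); apply/funext => y; rewrite fct_sumE.
Qed.

Lemma differentiable_fun_sum n (W : normedModType R) (h : 'I_n -> V -> W) x :
  (forall i, differentiable (h i) x) ->
  differentiable (fun y => \sum_i h i y) x.
Proof.
move=> dh; have -> : (fun y => \sum_i h i y) = \sum_i h i.
  by apply/funext => y; rewrite fct_sumE.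
exact: differentiable_sum.
Qed.

Section Mulmx.
Variables (m n p : nat) (f : V -> 'M[R]_(m, n)) (g : V -> 'M[R]_(n, p)) (x : V).
Hypotheses (df : differentiable f x) (dg : differentiable g x).

Lemma differentiable_mulmx : differentiable (fun y => f y *m g y) x.
Proof.
apply/differentiable_mxP => i j.
have -> : (fun y => (f y *m g y) i j) = (fun y => \sum_k f y i k * g y k j).
  by apply/funext => y; rewrite mxE.
apply: differentiable_fun_sum => k.
apply: differentiableM.
  exact: (differentiable_mxP _ _).1 df i k.
exact: (differentiable_mxP _ _).1 dg k j.
Qed.

Lemma derive_mulmx v :
  'D_v (fun y => f y *m g y) x = 'D_v f x *m g x + f x *m 'D_v g x.
Proof.
apply/matrixP => i j; rewrite derive_entry; last exact: differentiable_mulmx.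
have -> : (fun y => (f y *m g y) i j) = (fun y => \sum_k f y i k * g y k j).
  by apply/funext => y; rewrite mxE.
have dfe k : differentiable (fun y => f y i k) x by exact: (differentiable_mxP
  _ _).1 df i k.
have dge k : differentiable (fun y => g y k j) x by exact: (differentiable_mxP
  _ _).1 dg k j.
rewrite derive_fun_sum; last by move=> k; exact: differentiableM.
rewrite !mxE -big_split /=; apply: eq_bigr => k _.
rewrite deriveM; try exact: diff_derivable.
by rewrite !derive_entry//= addrC /GRing.scale/= [g x k j * _]mulrC.
Qed.

End Mulmx.

Lemma differentiable_trmx m n (f : V -> 'M[R]_(m, n)) x : differentiable f x ->
  differentiable (fun y => (f y)^T) x.
Proof.
move=> /differentiable_mxP df; apply/differentiable_mxP => i j.
by under eq_fun do rewrite mxE.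
Qed.

Lemma derive_trmx m n (f : V -> 'M[R]_(m, n)) x v : differentiable f x ->
  'D_v (fun y => (f y)^T) x = ('D_v f x)^T.
Proof.
move=> df; apply/matrixP => i j.
rewrite derive_entry; last exact: differentiable_trmx.
by rewrite mxE derive_entry//; under eq_fun do rewrite mxE.
Qed.

Lemma derive_const (W : normedModType R) (k : W) x v : 'D_v (fun=> k) x = 0.
Proof. exact: derive_cst. Qed.

Lemma differentiable_const (W : normedModType R) (k : W) x :
  differentiable (fun _ : V => k) x.
Proof. exact: differentiable_cst. Qed.

End Calculus.

(** * Symmetry of second derivatives *)

Section Schwarz.
Variables (R : realType) (V : normedModType R).

Lemma first_order (W : normedModType R) (g : V -> W) (x : V) (e : R) :
  differentiable g x -> 0 < e ->
  \forall w \near (0 : V), `|g (x + w) - g x - 'd g x w| <= e * `|w|.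
Proof.
move=> /diff_locallyP[_ /eqaddoP dg] e0; have := dg e e0.
apply: filterS => w /=; rewrite !fctE /=.
by rewrite [w + x]addrC opprD addrA.
Qed.

Lemma is_derive_line (f : V -> R) (x u z : V) (t : R) :
  differentiable f (x + (t *: u + z)) ->
  is_derive t 1 (fun s => f (x + (s *: u + z))) ('D_u f (x + (t *: u + z))).
Proof.
pose l (s : R) := x + (s *: u + z) => df.
have dl : is_diff t l ( *:%R^~ u).
  have -> : l = (fun s : R => s *: u) + cst (x + z).
    by apply/funext => s; rewrite /l !fctE addrCA.
  by apply: is_diff_eq; apply/funext => s; rewrite !fctE addr0.
have dl' : differentiable l t by exact: ex_diff.
have dfl : differentiable (f \o l) t by exact: differentiable_comp.
apply: DeriveDef; first exact: diff_derivable.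
rewrite -[LHS]/('D_1 (f \o l) t) derive_comp//; congr ('D__ f _).
by rewrite deriveE// diff_val scale1r.
Qed.

(* Mean value theorem along t |-> f (x + t u + h v) - f (x + t u), then first
   order expansion of 'D_u f at x. *)
Lemma second_difference (f : V -> R) (U : set V) (x u v : V) (e : R) :
  open U -> U x -> (forall y, U y -> differentiable f y) ->
  differentiable (fun y => 'D_u f y) x -> 0 < e ->
  \forall h \near (0 : R)^'+,
    `|f (x + h *: u + h *: v) - f (x + h *: u) - f (x + h *: v) + f x
      - h ^+ 2 * 'D_v (fun y => 'D_u f y) x| <= e * h ^+ 2.
Proof.
move=> Uo Ux df dg e0; set g := fun y => 'D_u f y.
(* The two first order errors, at [c u + h v] and at [c u], add up to at most
   [e / K * h * (2 |u| + |v|)]; the summand 1 keeps [K] positive when [u = v = 0]. The same [K]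
   bounds the size of both displacements by [h * K]. *)
pose K : R := 2 * `|u| + `|v| + 1.
have nu := normr_ge0 u; have nv := normr_ge0 v.
have K0 : 0 < K by rewrite /K; lra.
have eK : 0 < e / K by rewrite divr_gt0.
have Unear : \forall w \near (0 : V), U (x + w).
  have : \forall y \near x, U y by exact: open_nbhs_nbhs (conj Uo Ux).
  by rewrite (near_shift 0 x) subr0; apply: filterS => w; rewrite /= addrC.
have : nbhs (0 : V) (fun w => U (x + w) /\
    `|g (x + w) - g x - 'd g x w| <= e / K * `|w|).
  exact: filterI Unear (first_order dg eK).
move=> /nbhs_ballP[r /= r0 rP].
near=> h.
have h0 : 0 < h by near: h; exact: nbhs_right_gt.
have hr : h * K < r.
  by rewrite -ltr_pdivlMr//; near: h; apply: nbhs_right_lt; rewrite divr_gt0.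
have small w : `|w| < r -> U (x + w) /\
    `|g (x + w) - g x - 'd g x w| <= e / K * `|w|.
  by move=> wr; apply: rP; rewrite -ball_normE /= sub0r normrN.
have n1 t : 0 <= t <= h -> `|t *: u + h *: v| <= h * (`|u| + `|v|).
  case/andP=> t0 th; rewrite (le_trans (ler_normD _ _))// !normrZ.
  by rewrite (ger0_norm t0) (gtr0_norm h0); nra.
have n2 t : 0 <= t <= h -> `|t *: u| <= h * `|u|.
  by case/andP=> t0 th; rewrite normrZ (ger0_norm t0); nra.
have s1 t : 0 <= t <= h -> `|t *: u + h *: v| < r.
  move=> /n1 /le_lt_trans; apply; apply: le_lt_trans hr.
  by rewrite /K; nra.
have s2 t : 0 <= t <= h -> `|t *: u| < r.
  move=> /n2 /le_lt_trans; apply; apply: le_lt_trans hr.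
  by rewrite /K; nra.
pose p (t : R) : R := f (x + (t *: u + h *: v)) - f (x + t *: u).
have dp t : 0 <= t <= h ->
    is_derive t 1 p (g (x + (t *: u + h *: v)) - g (x + t *: u)).
  move=> th; have [U1 _] := small _ (s1 _ th); have [U2 _] := small _ (s2 _ th).
  apply: is_deriveB; first exact: is_derive_line (df _ U1).
  have -> : (fun s => f (x + s *: u)) = (fun s => f (x + (s *: u + 0))).
    by apply/funext => s; rewrite addr0.
  rewrite -[t *: u]addr0; apply: is_derive_line.
  by rewrite addr0; exact: df.
have [c c0h] : exists2 c, c \in `]0, h[%R & p h - p 0 =
   (g (x + (c *: u + h *: v)) - g (x + c *: u)) * (h - 0).
  apply: (@MVT R p (fun t => g (x + (t *: u + h *: v)) - g (x + t *: u))) => //.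
    by move=> t; rewrite in_itv /= => /andP[t0 th]; apply: dp; rewrite !ltW.
  apply: continuous_in_subspaceT => t; rewrite inE /= in_itv/= => th.
  by have [+ _] := dp t th; move/derivable1_diffP/differentiable_continuous.
have c0h' : 0 <= c <= h by move: c0h; rewrite in_itv /= => /andP[c0 ch];
  rewrite !ltW.
rewrite /p scale0r add0r addr0 subr0 => E.
have -> : f (x + h *: u + h *: v) - f (x + h *: u) - f (x + h *: v) + f x =
  (g (x + (c *: u + h *: v)) - g (x + c *: u)) * h by rewrite -E addrA; lra.
have [_ e1] := small _ (s1 _ c0h'); have [_ e2] := small _ (s2 _ c0h').
rewrite deriveE//.
have {e1} := le_trans e1 (ler_wpM2l (ltW eK) (n1 _ c0h')).
have {e2} := le_trans e2 (ler_wpM2l (ltW eK) (n2 _ c0h')).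
move=> e2 e1.
have E1 : 'd g x (c *: u + h *: v) = c * 'd g x u + h * 'd g x v.
  by rewrite linearD !linearZ.
have E2 : 'd g x (c *: u) = c * 'd g x u by rewrite linearZ.
rewrite E1 in e1; rewrite E2 in e2.
move: e1 e2; set gx := g x; set a := g _; set b := g _; set d := 'd g x v;
  set d' := 'd g x u.
move=> e1 e2.
have -> : (a - b) * h - h ^+ 2 * d =
  h * ((a - gx - (c * d' + h * d)) - (b - gx - c * d')) by ring.
rewrite normrM gtr0_norm//.
have le3 : `|(a - gx - (c * d' + h * d)) - (b - gx - c * d')| <= e * h.
  apply: le_trans (ler_normB _ _) _; apply: le_trans (lerD e1 e2) _.
  have -> : e / K * (h * (`|u| + `|v|)) + e / K * (h * `|u|) =
      e * h * ((2 * `|u| + `|v|) / K) by field; rewrite gt_eqF.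
  rewrite -[leRHS]mulr1; apply: ler_wpM2l; first by rewrite mulr_ge0// ltW.
  by rewrite ler_pdivrMr// mul1r /K; lra.
by rewrite expr2 mulrA mulrC; apply: ler_wpM2r; rewrite ?(ltW h0).
Unshelve. all: by end_near. Qed.

(** The second difference is symmetric in [u] and [v], and divided by [h ^+ 2] it approximates
    either mixed derivative. *)
Lemma schwarz (f : V -> R) (U : set V) (x u v : V) : open U -> U x ->
  (forall y, U y -> differentiable f y) ->
  differentiable (fun y => 'D_u f y) x -> differentiable (fun y => 'D_v f y) x
    ->
  'D_v (fun y => 'D_u f y) x = 'D_u (fun y => 'D_v f y) x.
Proof.
move=> Uo Ux df du dv; apply/eqP; rewrite -subr_eq0 -normr_le0.
apply/ler_addgt0Pl => e e0; rewrite addr0.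
have e20 : 0 < e / 2 by rewrite divr_gt0.
have NA := second_difference v Uo Ux df du e20.
have NB := second_difference u Uo Ux df dv e20.
have [h [[A B] h0]] := filter_ex (filterI (filterI NA NB) (nbhs_right_gt 0)).
move: A B; rewrite [x + h *: v + h *: u]addrAC.
set a := 'D_v _ x; set b := 'D_u _ x; set p := f (_ + _ + _).
set q := f (x + h *: u); set r := f (x + h *: v) => A B.
have h20 : 0 < h ^+ 2 by rewrite exprn_gt0.
rewrite -(ler_pM2l h20).
have -> : h ^+ 2 * `|a - b| = `|(p - r - q + f x - h ^+ 2 * b) -
    (p - q - r + f x - h ^+ 2 * a)|.
  by rewrite -[in LHS](gtr0_norm h20) -normrM; congr `|_|; ring.
apply: le_trans (ler_normB _ _) _; apply: le_trans (lerD B A) _.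
by rewrite -mulrDl -splitr mulrC.
Qed.

Lemma schwarz_mx m n (f : V -> 'M[R]_(m, n)) (U : set V) (x u v : V) :
  open U -> U x -> (forall y, U y -> differentiable f y) ->
  differentiable (fun y => 'D_u f y) x -> differentiable (fun y => 'D_v f y) x
    ->
  'D_v (fun y => 'D_u f y) x = 'D_u (fun y => 'D_v f y) x.
Proof.
move=> Uo Ux df du dv.
apply/matrixP => i j.
apply: etrans (@derive_entry R V m n (fun y => 'D_u f y) x v i j du) _.
symmetry.
apply: etrans (@derive_entry R V m n (fun y => 'D_v f y) x u i j dv) _.
symmetry.
have E w y : U y -> ('D_w f y) i j = 'D_w (fun z => f z i j) y.
  by move=> Uy; rewrite (derive_entry _ _ _ (df y Uy)).
have dE w : differentiable (fun y => 'D_w f y) x ->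
    differentiable (fun y => 'D_w (fun z => f z i j) y) x.
  move=> dw; apply: (@differentiable_eq_on _ _ _ U (fun y => ('D_w f y) i j))
    => //.
    by move=> y; exact: E.
  exact: (differentiable_mxP _ _).1 dw i j.
apply: etrans (derive_eq_on _ Uo Ux (E u)) _; symmetry.
apply: etrans (derive_eq_on _ Uo Ux (E v)) _; symmetry.
apply: schwarz Uo Ux _ (dE _ du) (dE _ dv).
move=> y Uy; exact: (differentiable_mxP _ _).1 (df y Uy) i j.
Qed.

End Schwarz.

(** * Stability of smoothness under algebraic operations and composition *)

Section Smooth.
Variables (R : realType) (V : normedModType R) (U : set V).
Hypothesis Uo : open U.

(** [Ck] iterates derivatives of total functions, whereas the product and chain rules rewrite these
    derivatives only on [U]; as [U] is open, agreement there is enough. *)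
Lemma Ck_eq (W : normedModType R) k (f g : V -> W) :
  (forall y, U y -> f y = g y) -> Ck U k f -> Ck U k g.
Proof.
elim: k f g => [|k IH] f g fg /=.
  move=> cf x Ux; have nfg : \forall y \near x, f y = g y.
    by have := open_nbhs_nbhs (conj Uo Ux); apply: filterS => y /fg.
  change (g @ x --> g x); rewrite -(fg _ Ux); apply: cvg_trans (cf x Ux).
  exact: near_eq_cvg.
move=> [df cf]; split=> [x Ux|v].
  exact: (differentiable_eq_on Uo Ux fg (df x Ux)).
by apply: IH (cf v) => y Uy; exact: (derive_eq_on v Uo Uy fg).
Qed.

Lemma smooth_eq (W : normedModType R) (f g : V -> W) :
  (forall y, U y -> f y = g y) -> smooth_on U f -> smooth_on U g.
Proof. by move=> fg sf k; exact: (Ck_eq fg (sf k)). Qed.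

Lemma smooth_differentiable (W : normedModType R) (f : V -> W) x :
  smooth_on U f -> U x -> differentiable f x.
Proof. by move=> /(_ 1)[+ _] Ux; apply. Qed.

Lemma smooth_derive (W : normedModType R) (f : V -> W) v :
  smooth_on U f -> smooth_on U (fun x => 'D_v f x).
Proof. by move=> sf k; have [_] := sf k.+1; exact. Qed.

Lemma differentiable_Ck0 (W : normedModType R) (f : V -> W) :
  (forall x, U x -> differentiable f x) -> Ck U 0 f.
Proof. by move=> df x Ux; exact: differentiable_continuous (df x Ux). Qed.

Lemma smooth_cst (W : normedModType R) (a : W) : smooth_on U (fun=> a).
Proof.
move=> k; elim: k a => [|k IH] a; first by apply: differentiable_Ck0.
split=> [//|v]; apply: Ck_eq (IH 0) => y _; by rewrite derive_const.
Qed.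

Lemma CkD (W : normedModType R) k (f g : V -> W) :
  Ck U k f -> Ck U k g -> Ck U k (fun x => f x + g x).
Proof.
elim: k f g => [|k IH] f g /=.
  by move=> cf cg x Ux; apply: cvgD; [exact: cf|exact: cg].
move=> [df cf] [dg cg]; split=> [x Ux|v].
  by apply: differentiableD; [exact: df|exact: dg].
apply: Ck_eq (IH _ _ (cf v) (cg v)) => y Uy.
by rewrite deriveD//; apply: diff_derivable; [exact: df|exact: dg].
Qed.

Lemma Ck_sum (W : normedModType R) k n (f : 'I_n -> V -> W) :
  (forall i, Ck U k (f i)) -> Ck U k (fun x => \sum_i f i x).
Proof.
elim: n f => [|n IH] f cf.
  by apply: Ck_eq (smooth_cst 0 k) => y _; rewrite big_ord0.
apply: (@Ck_eq _ _ (fun x => f ord0 x + \sum_i f (lift ord0 i) x)).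
  by move=> y _; rewrite big_ord_recl.
by apply: CkD => //; apply: IH.
Qed.

Lemma Ck_pred (W : normedModType R) k (f : V -> W) : Ck U k.+1 f -> Ck U k f.
Proof.
elim: k f => [|k IH] f [df cf]; first exact: differentiable_Ck0.
by split=> // v; apply: IH.
Qed.

Lemma CkM k (f g : V -> R) :
  Ck U k f -> Ck U k g -> Ck U k (fun x => f x * g x).
Proof.
elim: k f g => [|k IH] f g.
  by move=> cf cg x Ux; apply: cvgM; [exact: cf|exact: cg].
move=> cf cg; have cf' := Ck_pred cf; have cg' := Ck_pred cg.
case: cf cg => [df cf] [dg cg]; split=> [x Ux|v].
  exact: differentiableM (df x Ux) (dg x Ux).
apply: Ck_eq (CkD (IH _ _ cf' (cg v)) (IH _ _ cg' (cf v))) => y Uy.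
rewrite deriveM//; apply: diff_derivable; [exact: df|exact: dg].
Qed.

Lemma smooth_mxP m n (f : V -> 'M[R]_(m, n)) :
  smooth_on U f <-> forall i j, smooth_on U (fun x => f x i j).
Proof.
split=> [sf i j k|sf k].
  elim: k f sf => [|k IH] f sf.
    apply: differentiable_Ck0 => x Ux.
    exact: (differentiable_mxP _ _).1 (smooth_differentiable sf Ux) i j.
  split=> [x Ux|v].
    exact: (differentiable_mxP _ _).1 (smooth_differentiable sf Ux) i j.
  apply: Ck_eq (IH _ (smooth_derive v sf)) => y Uy.
  by rewrite derive_entry//; exact: smooth_differentiable Uy.
elim: k f sf => [|k IH] f sf.
  apply: differentiable_Ck0 => x Ux; apply/differentiable_mxP => i j.
  exact: smooth_differentiable (sf i j) Ux.
have df x : U x -> differentiable f x.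
  move=> Ux; apply/differentiable_mxP => i j.
  exact: smooth_differentiable (sf i j) Ux.
split=> [//|v]; apply: IH => i j.
apply: smooth_eq (smooth_derive v (sf i j)) => y Uy.
by rewrite derive_entry//; exact: df.
Qed.

Lemma smooth_mulmx m n p (f : V -> 'M[R]_(m, n)) (g : V -> 'M[R]_(n, p)) :
  smooth_on U f -> smooth_on U g -> smooth_on U (fun x => f x *m g x).
Proof.
move=> /smooth_mxP sf /smooth_mxP sg; apply/smooth_mxP => i j.
apply: (@smooth_eq _ (fun x => \sum_k f x i k * g x k j)).
  by move=> y _; rewrite mxE.
by move=> k; apply: Ck_sum => l; apply: CkM; [exact: sf|exact: sg].
Qed.

End Smooth.

Section SmoothComp.
Variables (R : realType) (V : normedModType R) (U : set V).
Variables (n : nat) (U' : set 'rV[R]_n) (F : V -> 'rV[R]_n).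
Hypotheses (Uo : open U) (FU : forall y, U y -> U' (F y)) (sF : smooth_on U F).

Lemma smooth_comp_scalar (h : 'rV[R]_n -> R) :
  smooth_on U' h -> smooth_on U (fun x => h (F x)).
Proof.
move=> sh k; elim: k h sh => [|k IH] h sh.
  apply: differentiable_Ck0 => x Ux; apply: differentiable_comp.
    exact: smooth_differentiable sF Ux.
  exact: smooth_differentiable sh (FU Ux).
have dF y (Uy : U y) := smooth_differentiable sF Uy.
split=> [x Ux|v].
  by apply: differentiable_comp (dF x Ux) (smooth_differentiable sh (FU Ux)).
(* The derivative of the composite has the moving direction ['D_v F y], while [Ck] speaks of fixed
   directions. Expanding along the basis leaves partial derivatives of [h], to which the induction
   hypothesis applies. *)
suff : Ck U k (fun y => \sum_i ('D_v F y) 0 i * 'D_(delta_mx 0 i) h (F y)).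
  apply: Ck_eq => // y Uy; have dh := smooth_differentiable sh (FU Uy).
  apply: etrans (esym (derive_comp v (dF y Uy) dh)).
  symmetry; rewrite deriveE// [X in 'd h _ X]row_sum_delta linear_sum.
  by apply: eq_bigr => i _; rewrite linearZ /= -deriveE.
apply: Ck_sum => // i; apply: CkM => //; last by apply: (IH (fun y =>
  'D_(delta_mx 0 i) h y)); exact: smooth_derive.
by have /(smooth_mxP Uo) := smooth_derive v sF; apply.
Qed.

Lemma smooth_comp p q (h : 'rV[R]_n -> 'M[R]_(p, q)) : open U' ->
  smooth_on U' h -> smooth_on U (fun x => h (F x)).
Proof.
move=> U'o /(smooth_mxP U'o) sh; apply/(smooth_mxP Uo) => i j.
exact: (smooth_comp_scalar (sh i j)).
Qed.

Lemma smooth_schwarz p q (h : V -> 'M[R]_(p, q)) x u v : U x -> smooth_on U h ->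
  'D_v (fun y => 'D_u h y) x = 'D_u (fun y => 'D_v h y) x.
Proof.
move=> Ux sh; have dh y (Uy : U y) := smooth_differentiable sh Uy.
have dDh w := smooth_differentiable (smooth_derive w sh) Ux.
exact: (schwarz_mx Uo Ux dh (dDh u) (dDh v)).
Qed.

End SmoothComp.

(** * Orthonormal frames and contractions *)

Section RowEntries.
Variables (R : realType) (d : nat).
Implicit Types (v w : 'rV[R]_d) (j : 'I_d).

Lemma row_entryD v w j : (v + w) 0 j = v 0 j + w 0 j.
Proof. by rewrite mxE. Qed.

Lemma row_entryN v j : (- v) 0 j = - v 0 j.
Proof. by rewrite mxE. Qed.

Lemma row_entryZ a v j : (a *: v) 0 j = a * v 0 j.
Proof. by rewrite mxE. Qed.

Lemma row_entry0 j : (0 : 'rV[R]_d) 0 j = 0.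
Proof. by rewrite mxE. Qed.

Definition row_entryE := (row_entryD, row_entryN, row_entryZ, row_entry0).

End RowEntries.

(* [ring] modulo linearity, for identities between row vectors *)
Ltac vring := apply/rowP => ?; rewrite !row_entryE; ring.

Section Bilin.
Variables (R : realType) (d : nat).
Implicit Types (g : 'M[R]_d) (v w : 'rV[R]_d).

Lemma bilinDl g u v w : bilin g (u + v) w = bilin g u w + bilin g v w.
Proof. by rewrite /bilin !mulmxDl mxE. Qed.

Lemma bilinDr g u v w : bilin g u (v + w) = bilin g u v + bilin g u w.
Proof. by rewrite /bilin linearD mulmxDr mxE. Qed.

Lemma bilinNl g v w : bilin g (- v) w = - bilin g v w.
Proof. by rewrite /bilin !mulNmx mxE. Qed.

Lemma bilinNr g v w : bilin g v (- w) = - bilin g v w.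
Proof. by rewrite /bilin linearN mulmxN mxE. Qed.

Lemma bilinBl g u v w : bilin g (u - v) w = bilin g u w - bilin g v w.
Proof. by rewrite bilinDl bilinNl. Qed.

Lemma bilinBr g u v w : bilin g u (v - w) = bilin g u v - bilin g u w.
Proof. by rewrite bilinDr bilinNr. Qed.

Lemma bilinZl g (a : R) v w : bilin g (a *: v) w = a * bilin g v w.
Proof. by rewrite /bilin -!scalemxAl mxE. Qed.

Lemma bilinZr g (a : R) v w : bilin g v (a *: w) = a * bilin g v w.
Proof. by rewrite /bilin linearZ /= -scalemxAr mxE. Qed.

Lemma bilin0l g w : bilin g 0 w = 0.
Proof. by rewrite /bilin !mul0mx mxE. Qed.

Lemma bilin0r g w : bilin g w 0 = 0.
Proof. by rewrite /bilin trmx0 mulmx0 mxE. Qed.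

Lemma bilinDm g g' v w : bilin (g + g') v w = bilin g v w + bilin g' v w.
Proof. by rewrite /bilin mulmxDr mulmxDl mxE. Qed.

Lemma bilin_delta g i j : bilin g (delta_mx 0 i) (delta_mx 0 j) = g i j.
Proof. by rewrite /bilin -rowE trmx_delta -colE !mxE. Qed.

Definition posdef g := forall v, v != 0 -> 0 < bilin g v v.

Lemma posdef_ge0 g v : posdef g -> 0 <= bilin g v v.
Proof.
move=> gpos; have [->|/gpos/ltW//] := eqVneq v 0.
by rewrite bilin0l.
Qed.

Lemma posdef_eq0 g v : posdef g -> bilin g v v = 0 -> v = 0.
Proof. by move=> gpos g0; apply/eqP/negP => /negP /gpos; rewrite g0 ltxx. Qed.

Lemma posdef_nondeg g v : posdef g -> (forall w, bilin g v w = 0) -> v = 0.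
Proof. by move=> gpos g0; exact: posdef_eq0 gpos (g0 v). Qed.

Lemma posdef_unitmx g : posdef g -> g \in unitmx.
Proof.
move=> gpos; rewrite -row_free_unit -kermx_eq0; apply/eqP/row_matrixP => i.
rewrite row0; apply: posdef_eq0 gpos _.
by rewrite /bilin -row_mul mulmx_ker row0 mul0mx mxE.
Qed.

Lemma bilin_matrixP g g' : (forall v w, bilin g v w = bilin g' v w) -> g = g'.
Proof. by move=> E; apply/matrixP => i j; rewrite -!bilin_delta. Qed.

Lemma bilin_trmx g v w : bilin g^T v w = bilin g w v.
Proof.
rewrite /bilin; have -> : w *m g *m v^T = (v *m g^T *m w^T)^T.
  by rewrite !trmx_mul !trmxK mulmxA.
by rewrite [RHS]mxE.
Qed.

Lemma bilin_sym_trmx g : (forall v w, bilin g v w = bilin g w v) -> g^T = g.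
Proof. by move=> gs; apply: bilin_matrixP => v w; rewrite bilin_trmx. Qed.

End Bilin.

Section Contraction.
Variables (R : realType) (d : nat) (Z : lmodType R).
Variable b : 'rV[R]_d -> 'rV[R]_d -> Z.
Hypothesis bl : forall w, linear (b^~ w).
Hypothesis br : forall v, linear (b v).

Definition contraction (G : 'M[R]_d) : Z :=
  \sum_i \sum_j G i j *: b (delta_mx 0 i) (delta_mx 0 j).

Lemma contractionD G G' : contraction (G + G') = contraction G + contraction G'.
Proof.
rewrite -big_split; apply: eq_bigr => i _; rewrite -big_split.
by apply: eq_bigr => j _; rewrite mxE scalerDl.
Qed.

Lemma contractionZ a G : contraction (a *: G) = a *: contraction G.
Proof.
rewrite scaler_sumr; apply: eq_bigr => i _; rewrite scaler_sumr.
by apply: eq_bigr => j _; rewrite mxE scalerA.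
Qed.

Lemma bilinear_expand v w :
  b v w = \sum_i \sum_j (v 0 i * w 0 j) *: b (delta_mx 0 i) (delta_mx 0 j).
Proof.
pose Bl u : {linear _ -> _} := HB.pack (b^~ u)
  (GRing.isLinear.Build _ _ _ _ _ (bl u)).
pose Br u : {linear _ -> _} := HB.pack (b u)
  (GRing.isLinear.Build _ _ _ _ _ (br u)).
rewrite [v in LHS]row_sum_delta -[b _ w]/(Bl w _) linear_sum.
apply: eq_bigr => i _; rewrite linearZ /= -[b _ w]/(Br _ w).
rewrite [w in LHS]row_sum_delta linear_sum scaler_sumr.
by apply: eq_bigr => j _; rewrite linearZ scalerA.
Qed.

(** A factorization of the inverse metric as a Gram matrix turns a metric trace into a sum over
    frame vectors. *)
Lemma contraction_gram m (A : 'M[R]_(m, d)) :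
  contraction (A^T *m A) = \sum_k b (row k A) (row k A).
Proof.
rewrite /contraction.
transitivity (\sum_i \sum_j \sum_k
    (A k i * A k j) *: b (delta_mx 0 i) (delta_mx 0 j)).
  apply: eq_bigr => i _; apply: eq_bigr => j _.
  by rewrite mxE scaler_suml; apply: eq_bigr => k _; rewrite mxE.
rewrite (eq_bigr (fun i => \sum_k \sum_j
    (A k i * A k j) *: b (delta_mx 0 i) (delta_mx 0 j))); last first.
  by move=> i _; rewrite exchange_big.
rewrite exchange_big; apply: eq_bigr => k _.
rewrite [RHS]bilinear_expand; apply: eq_bigr => i _; apply: eq_bigr => j _.
by rewrite !mxE.
Qed.

End Contraction.

(** * Adapted orthonormal bases, with [r] distinguished rows [X] *)

Section Frames.
Variables (R : realType) (d r : nat) (g p : 'M[R]_d) (X : 'M[R]_(r, d)).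
Hypothesis gT : g^T = g.
Hypothesis gpos : posdef g.
Hypothesis skew : p *m g = - (g *m p^T).
Hypothesis sqr : forall v : 'rV[R]_d, v *m g *m X^T = 0 -> v *m p *m p = - v.
Hypothesis pX : p *m g *m X^T = 0.
Hypothesis XX : X *m g *m X^T = 1%:M.

Lemma sqr_rows m (A : 'M[R]_(m, d)) : A *m g *m X^T = 0 -> A *m p *m p = - A.
Proof.
move=> AX; apply/row_matrixP => i; rewrite !row_mul sqr ?linearN//.
by rewrite -!row_mul AX row0.
Qed.

Lemma trmx_form m n (A : 'M[R]_(m, d)) (B : 'M[R]_(n, d)) :
  (A *m g *m B^T)^T = B *m g *m A^T.
Proof. by rewrite !trmx_mul trmxK gT mulmxA. Qed.

Lemma skew_form m n (A : 'M[R]_(m, d)) (B : 'M[R]_(n, d)) :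
  A *m g *m (B *m p)^T = - (A *m p *m g *m B^T).
Proof.
rewrite trmx_mul -[A *m p *m g]mulmxA skew mulmxN mulNmx opprK.
by rewrite !mulmxA.
Qed.

Lemma skew_form_p m n (A : 'M[R]_(m, d)) (B : 'M[R]_(n, d)) :
  A *m g *m X^T = 0 -> A *m p *m g *m (B *m p)^T = A *m g *m B^T.
Proof. by move=> AX; rewrite skew_form sqr_rows// !mulNmx opprK. Qed.

Lemma frame_step k : (r + k.*2 < d)%N -> forall A : 'M[R]_(k, d),
  A *m g *m A^T = 1%:M -> A *m g *m (A *m p)^T = 0 -> A *m g *m X^T = 0 ->
  exists u : 'rV[R]_d, [/\ u *m g *m u^T = 1%:M, u *m g *m A^T = 0,
    u *m g *m (A *m p)^T = 0 & u *m g *m X^T = 0].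
Proof.
move=> kd A AA ApA AX.
pose B := col_mx X (col_mx A (A *m p)).
have rk : (\rank (g *m B^T) < d)%N.
  apply: leq_ltn_trans (rank_leq_col _) _; move: kd; by rewrite -addnn.
have /rowV0Pn[v vK v0] : kermx (g *m B^T) != 0.
  by rewrite kermx_eq0 /row_free; apply/negP => /eqP E; move: rk;
    rewrite E ltnn.
have vB : v *m g *m B^T = 0 by rewrite -mulmxA; exact: sub_kermxP vK.
move: vB; rewrite /B !tr_col_mx !mul_mx_row.
move=> /eqP; rewrite !row_mx_eq0 => /andP[/eqP vX /andP[/eqP vA /eqP vpA]].
pose s := Num.sqrt (bilin g v v).
have s0 : s != 0 by rewrite gt_eqF// sqrtr_gt0; exact: gpos.
have ss : s * s = bilin g v v by rewrite -expr2 sqr_sqrtr// posdef_ge0.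
exists (s^-1 *: v); split; rewrite -?scalemxAl ?vA ?vpA ?vX ?scaler0//.
rewrite linearZ /= -scalemxAr scalerA [v *m g *m v^T]mx11_scalar.
rewrite -/(bilin g v v) -ss scale_scalar_mx; congr _%:M.
by field.
Qed.

Lemma exists_frame m : (r + m.*2 = d)%N ->
  exists A : 'M[R]_(m, d),
  [/\ A *m g *m A^T = 1%:M, A *m g *m (A *m p)^T = 0 & A *m g *m X^T = 0].
Proof.
move=> rd; suff H k : (k <= m)%N -> exists A : 'M[R]_(k, d),
    [/\ A *m g *m A^T = 1%:M, A *m g *m (A *m p)^T = 0 & A *m g *m X^T = 0].
  exact: H.
elim: k => [|k IH] km; first by exists 0; split; apply/matrixP => -[].
have [A [AA ApA AX]] := IH (ltnW km).
have [|u [uu uA upA uX]] := frame_step _ AA ApA AX.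
  by rewrite -rd ltn_add2l ltn_double.
have pAu : A *m p *m g *m u^T = 0 by rewrite -[LHS]trmxK trmx_form upA trmx0.
have Au : A *m g *m u^T = 0 by rewrite -[LHS]trmxK trmx_form uA trmx0.
have upu : u *m g *m (u *m p)^T = 0.
  have : u *m g *m (u *m p)^T = - (u *m g *m (u *m p)^T).
    rewrite [in LHS]skew_form; congr (- _).
    rewrite -[LHS]trmxK trmx_form.
    by apply/matrixP => i j; rewrite !ord1 mxE.
  by move=> /eqP; rewrite -addr_eq0 -mulr2n -scaler_nat scaler_eq0 pnatr_eq0 =>
    /eqP.
rewrite -addn1; exists (col_mx A u).
rewrite [_ *m g]mul_col_mx [_ *m p]mul_col_mx !tr_col_mx.
rewrite !mul_col_row mul_col_mx AA Au uA uu ApA upA upu.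
rewrite skew_form pAu oppr0 AX uX; split.
- by rewrite -scalar_mx_block.
- by rewrite block_mx_const.
- by rewrite col_mx_const.
Qed.

(** The matrix of the full frame has [r + (m + m)] rows, a number equal to [d] only by a proved
    equation, so one-sided inverses are exchanged after transport along it. *)
Lemma mulmx1_cast a b (A : 'M[R]_(a, b)) (B : 'M[R]_(b, a)) : a = b ->
  A *m B = 1%:M -> B *m A = 1%:M.
Proof. by move=> e; move: A B; rewrite e => A B; exact: mulmx1C. Qed.

(** The matrix [E] of the full frame satisfies [E g E^T = 1]. Being square, it also satisfies
    [g E^T E = 1], and the blocks of [E^T E] are the three terms. *)
Lemma frame_invmx m (A : 'M[R]_(m, d)) : (r + m.*2 = d)%N ->
  A *m g *m A^T = 1%:M -> A *m g *m (A *m p)^T = 0 -> A *m g *m X^T = 0 ->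
  invmx g = X^T *m X + (A^T *m A + (A *m p)^T *m (A *m p)).
Proof.
move=> rd AA ApA AX; pose E := col_mx X (col_mx A (A *m p)).
have XA : X *m g *m A^T = 0 by rewrite -[LHS]trmxK trmx_form AX trmx0.
have pXA : X *m g *m (A *m p)^T = 0.
  by rewrite -[LHS]trmxK trmx_form -!mulmxA [p *m _]mulmxA pX mulmx0 trmx0.
have ApX : A *m p *m g *m X^T = 0 by rewrite -!mulmxA [p *m _]mulmxA pX mulmx0.
have pAA : A *m p *m g *m A^T = 0 by rewrite -[LHS]trmxK trmx_form ApA trmx0.
have EE : E *m (g *m E^T) = 1%:M.
  rewrite mulmxA /E [_ *m g]mul_col_mx [col_mx A _ *m g]mul_col_mx !tr_col_mx.
  rewrite mul_col_row XX mul_mx_row XA pXA row_mx0 [_ *m X^T]mul_col_mx AX ApX.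
  rewrite col_mx0 mul_col_row AA ApA pAA skew_form_p// AA.
  by rewrite -!scalar_mx_block.
have e : (r + (m + m) = d)%N by rewrite addnn.
have := mulmx1_cast e EE; rewrite -mulmxA => gEE.
have gu := posdef_unitmx gpos.
have : invmx g *m (g *m (E^T *m E)) = invmx g *m 1%:M by rewrite gEE.
rewrite mulKmx// mulmx1 => <-.
by rewrite /E !tr_col_mx !mul_row_col.
Qed.

End Frames.

(** * The Levi-Civita connection *)

(* A sealed copy of the directional derivative: conversion never unfolds it, so
   that terms containing several derivatives can be compared quickly. *)
HB.lock Definition dder (R : realType) (V W : normedModType R) (f : V -> W)
  (x v : V) : W := 'D_v f x.

Lemma dderE (R : realType) (V W : normedModType R) (f : V -> W) x v :
  'D_v f x = dder f x v.
Proof. by rewrite dder.unlock. Qed.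

Section Dder.
Variables (R : realType) (V : normedModType R).

Lemma dder_eq_on (W : normedModType R) (U : set V) (f g : V -> W) x v :
  open U -> U x -> (forall y, U y -> f y = g y) -> dder f x v = dder g x v.
Proof. by move=> Uo Ux fg; rewrite -!dderE;
  exact: (derive_eq_on v Uo Ux fg). Qed.

Lemma dder_cst (W : normedModType R) (k : W) x v : dder (fun _ : V => k) x v =
  0.
Proof. by rewrite -dderE; exact: derive_const. Qed.

Lemma dder_linear (W : normedModType R) (f : V -> W) x :
  differentiable f x -> linear (dder f x).
Proof.
by move=> df a u v; rewrite -!dderE derive_dirD// derive_dirZ.
Qed.

Lemma dder_dirD (W : normedModType R) (f : V -> W) x u v :
  differentiable f x -> dder f x (u + v) = dder f x u + dder f x v.
Proof. by move=> df; rewrite -!dderE derive_dirD. Qed.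

Lemma dder_dirN (W : normedModType R) (f : V -> W) x u :
  differentiable f x -> dder f x (- u) = - dder f x u.
Proof. by move=> df; rewrite -!dderE derive_dirN. Qed.

Lemma dder_dirZ (W : normedModType R) (f : V -> W) x (a : R) u :
  differentiable f x -> dder f x (a *: u) = a *: dder f x u.
Proof. by move=> df; rewrite -!dderE derive_dirZ. Qed.

Lemma dderD (W : normedModType R) (f g : V -> W) x v :
  differentiable f x -> differentiable g x ->
  dder (fun y => f y + g y) x v = dder f x v + dder g x v.
Proof.
move=> df dg; rewrite -!dderE; apply: deriveD; exact: diff_derivable.
Qed.

Lemma dderN (W : normedModType R) (f : V -> W) x v :
  differentiable f x -> dder (fun y => - f y) x v = - dder f x v.
Proof. by move=> df; rewrite -!dderE; apply: deriveN;
  exact: diff_derivable. Qed.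

Lemma dderM (f g : V -> R) x v : differentiable f x -> differentiable g x ->
  dder (fun y => f y * g y) x v = f x * dder g x v + g x * dder f x v.
Proof.
by move=> df dg; rewrite -!dderE; apply: deriveM; exact: diff_derivable.
Qed.

Lemma dder_mulmx m n p (f : V -> 'M[R]_(m, n)) (g : V -> 'M[R]_(n, p)) x v :
  differentiable f x -> differentiable g x ->
  dder (fun y => f y *m g y) x v = dder f x v *m g x + f x *m dder g x v.
Proof. by move=> df dg; rewrite -!dderE derive_mulmx. Qed.

Lemma dder_mulmxl m n p (a : 'M[R]_(m, n)) (g : V -> 'M[R]_(n, p)) x v :
  differentiable g x -> dder (fun y => a *m g y) x v = a *m dder g x v.
Proof.
move=> dg; rewrite (dder_mulmx _ (differentiable_const a x) dg) dder_cst.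
by rewrite mul0mx add0r.
Qed.

Lemma dder_trmx m n (f : V -> 'M[R]_(m, n)) x v : differentiable f x ->
  dder (fun y => (f y)^T) x v = (dder f x v)^T.
Proof. by move=> df; rewrite -!dderE derive_trmx. Qed.

Lemma dder_entry m n (f : V -> 'M[R]_(m, n)) x v i j : differentiable f x ->
  dder (fun y => f y i j) x v = dder f x v i j.
Proof. by move=> df; rewrite -!dderE derive_entry. Qed.

Lemma dder_comp (W Z : normedModType R) (F : V -> W) (h : W -> Z) x v :
  differentiable F x -> differentiable h (F x) ->
  dder (fun y => h (F y)) x v = dder h (F x) (dder F x v).
Proof. by move=> dF dh; rewrite -!(dderE F) -(dderE h) -dderE;
  exact: (derive_comp v dF dh). Qed.

Lemma dder_scale n (a : V -> R) (f : V -> 'rV[R]_n) x v :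
  differentiable a x -> differentiable f x ->
  dder (fun y => a y *: f y) x v = dder a x v *: f x + a x *: dder f x v.
Proof.
move=> da df; have df' j : differentiable (fun y => f y 0 j) x.
  exact: (differentiable_mxP _ _).1 df 0 j.
have daf : differentiable (fun y => a y *: f y) x.
  apply/differentiable_mxP => i j; rewrite ord1.
  have -> : (fun y => (a y *: f y) 0 j) = (fun y => a y * f y 0 j).
    by apply/funext => y; rewrite mxE.
  exact: differentiableM.
apply/rowP => j; rewrite -dder_entry//.
have -> : (fun y => (a y *: f y) 0 j) = (fun y => a y * f y 0 j).
  by apply/funext => y; rewrite mxE.
by rewrite dderM// dder_entry// !mxE addrC [f x 0 j * _]mulrC.
Qed.

Lemma dder_smooth (W : normedModType R) (U : set V) (f : V -> W) v : open U ->
  smooth_on U f -> smooth_on U (fun x => dder f x v).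
Proof.
move=> Uo sf; apply: (smooth_eq Uo _ (smooth_derive v sf)) => y _.
exact: dderE.
Qed.

Lemma dder_schwarz m n (U : set V) (f : V -> 'M[R]_(m, n)) x u v : open U ->
  U x -> smooth_on U f ->
  dder (fun y => dder f y u) x v = dder (fun y => dder f y v) x u.
Proof.
move=> Uo Ux sf.
have E w : (fun y => dder f y w) = (fun y => 'D_w f y).
  by apply/funext => y; rewrite dderE.
by rewrite !E -!dderE; apply: (smooth_schwarz Uo u v Ux sf).
Qed.

Lemma dder_bilin d (g : V -> 'M[R]_d) (X Y : V -> 'rV[R]_d) x u :
  differentiable g x -> differentiable X x -> differentiable Y x ->
  dder (fun y => bilin (g y) (X y) (Y y)) x u =
  bilin (dder g x u) (X x) (Y x) + bilin (g x) (dder X x u) (Y x)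
  + bilin (g x) (X x) (dder Y x u).
Proof.
move=> dg dX dY; have dXg := differentiable_mulmx dX dg.
have dYT := differentiable_trmx dY.
rewrite (dder_entry u 0 0 (differentiable_mulmx dXg dYT)).
rewrite (dder_mulmx _ dXg dYT) (dder_mulmx _ dX dg) (dder_trmx _ dY).
by rewrite mulmxDl mxE [X in X + _]mxE /bilin [X in _ = X + _]addrC.
Qed.

Lemma differentiable_bilin_form d (g : V -> 'M[R]_d) (X Y : V -> 'rV[R]_d) x :
  differentiable g x -> differentiable X x -> differentiable Y x ->
  differentiable (fun y => bilin (g y) (X y) (Y y)) x.
Proof.
move=> dg dX dY; have dXg := differentiable_mulmx dX dg.
exact: (differentiable_mxP _ _).1
  (differentiable_mulmx dXg (differentiable_trmx dY)) 0 0.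
Qed.

End Dder.

Lemma open_cimg (R : realType) (T : topologicalType) d (c : chart R T d) :
  open (cimg c).
Proof. exact: cimg_open. Qed.

HB.lock Definition Gamma (R : realType) (d : nat) (M : riemannian R d)
  (c : chart R M d) (x v w : 'rV[R]_d) : 'rV[R]_d := christoffel c x v w.

Section LeviCivita.
Variables (R : realType) (d : nat) (M : riemannian R d) (c : chart R M d).
Hypothesis Hc : atlas c.
Local Notation V := 'rV[R]_d.
Local Notation g := (metric c).
Implicit Types (x : V) (u v w z : V).

Lemma metric_posdef x : cimg c x -> posdef (g x).
Proof. by move=> Ux v; exact: metric_pos. Qed.

Lemma metric_trmx x : cimg c x -> (g x)^T = g x.
Proof. by move=> Ux; apply: bilin_sym_trmx => v w; exact: Defs.metric_sym. Qed.

Lemma metric_differentiable x : cimg c x -> differentiable (g : V -> 'M[R]_d) x.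
Proof. exact: (smooth_differentiable (metric_smooth Hc)). Qed.

Lemma bilin_eqP x v w : cimg c x ->
  (forall z, bilin (g x) v z = bilin (g x) w z) -> v = w.
Proof.
move=> Ux E; apply/eqP; rewrite -subr_eq0; apply/eqP.
by apply: (posdef_nondeg (metric_posdef Ux)) => z; rewrite bilinBl E subrr.
Qed.

Lemma dder_metric_sym x u v w : cimg c x ->
  bilin (dder g x u) v w = bilin (dder g x u) w v.
Proof.
move=> Ux; rewrite -bilin_trmx -(dder_trmx _ (metric_differentiable Ux)).
congr (bilin _ w v); apply: (dder_eq_on u (open_cimg (c:=c)) Ux).
exact: metric_trmx.
Qed.

Lemma derive_gdot_cst x u v w : cimg c x ->
  'D_u (gdot c (cst v) (cst w)) x = bilin (dder g x u) v w.
Proof.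
move=> Ux; rewrite dderE.
apply: etrans (dder_bilin u (metric_differentiable Ux)
  (differentiable_const v x) (differentiable_const w x)) _.
by rewrite !dder_cst bilin0l bilin0r !addr0.
Qed.

(** Passes from basis vectors to an arbitrary test vector [z] by linearity. Symmetry, metric
    compatibility and linearity of the Christoffel symbols are then all checked by pairing. *)
Lemma koszul x v w z : cimg c x ->
  bilin (g x) (christoffel c x v w) z =
  2^-1 * (bilin (dder g x v) w z + bilin (dder g x w) v z
          - bilin (dder g x z) v w).
Proof.
move=> Ux; have gu := posdef_unitmx (metric_posdef Ux).
have dg := metric_differentiable Ux.
have -> : christoffel c x v w =
    \row_k (2^-1 * (bilin (dder g x v) w (delta_mx 0 k)
      + bilin (dder g x w) v (delta_mx 0 k)
      - bilin (dder g x (delta_mx 0 k)) v w)) *m invmx (g x).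
  congr (_ *m _); apply/rowP => k; rewrite [LHS]mxE [RHS]mxE.
  by congr (_ * (_ + _ - _)); exact: derive_gdot_cst.
have expand N u : bilin N u z = \sum_k z 0 k * bilin N u (delta_mx 0 k).
  rewrite /bilin mxE; apply: eq_bigr => k _.
  by rewrite mulrC trmx_delta -colE [z^T _ _]mxE [col _ _ _ _]mxE.
have expandD : bilin (dder g x z) v w =
    \sum_k z 0 k * bilin (dder g x (delta_mx 0 k)) v w.
  pose L : {linear _ -> _} := HB.pack (dder g x)
    (GRing.isLinear.Build _ _ _ _ _ (dder_linear dg)).
  rewrite -[dder g x z]/(L z) [z in L z]row_sum_delta linear_sum /bilin.
  rewrite mulmx_sumr mulmx_suml summxE; apply: eq_bigr => k _.
  by rewrite linearZ /= -scalemxAr -scalemxAl mxE.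
rewrite expandD (expand _ w) (expand _ v) /bilin mulmxKV//.
rewrite -big_split -sumrB mulr_sumr mxE; apply: eq_bigr => k _.
by rewrite [(\row_k _) _ _]mxE [z^T _ _]mxE -mulrA; congr (_ * _);
  rewrite mulrC mulrBr mulrDr.
Qed.

Lemma GammaE x v w : christoffel c x v w = Gamma c x v w.
Proof. by rewrite Gamma.unlock. Qed.

Lemma Gamma_sym x v w : cimg c x ->
  Gamma c x v w = Gamma c x w v.
Proof.
move=> Ux; apply: (bilin_eqP Ux) => z; rewrite -?GammaE !koszul//.
by rewrite [bilin (dder g x z) v w]dder_metric_sym//; congr (_ * _); ring.
Qed.

Lemma Gamma_metric x u v w : cimg c x ->
  bilin (dder g x u) v w =
  bilin (g x) (Gamma c x u v) w + bilin (g x) v (Gamma c x u w).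
Proof.
move=> Ux; rewrite (Defs.metric_sym Hc Ux v) -?GammaE !koszul//.
by rewrite [bilin (dder g x u) w v]dder_metric_sym//; field.
Qed.

Lemma Gamma_linear x v : cimg c x -> linear (Gamma c x v).
Proof.
move=> Ux a w w'; apply: (bilin_eqP Ux) => z;
  have dg := metric_differentiable Ux.
rewrite bilinDl bilinZl -?GammaE !koszul// dder_dirD// dder_dirZ//.
have bZm b N t t' : bilin (b *: N) t t' = b * bilin N t t'.
  by rewrite /bilin -scalemxAr -scalemxAl mxE.
by rewrite !bilinDl !bilinDr !bilinDm !bilinZl !bilinZr !bZm; field.
Qed.

End LeviCivita.

Definition ev (R : realType) d (a : 'cV[R]_d) (v : 'rV[R]_d) : R :=
  (v *m a) 0 0.

Section Ev.
Variables (R : realType) (d : nat).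
Implicit Types (a b : 'cV[R]_d) (v w : 'rV[R]_d).

Lemma evD a v w : ev a (v + w) = ev a v + ev a w.
Proof. by rewrite /ev mulmxDl mxE. Qed.

Lemma evN a v : ev a (- v) = - ev a v.
Proof. by rewrite /ev mulNmx mxE. Qed.

Lemma evZ a (k : R) v : ev a (k *: v) = k * ev a v.
Proof. by rewrite /ev -scalemxAl mxE. Qed.

Lemma ev0 a : ev a 0 = 0.
Proof. by rewrite /ev mul0mx mxE. Qed.

Lemma ev0m v : ev 0 v = 0.
Proof. by rewrite /ev mulmx0 mxE. Qed.

Lemma evDm a b v : ev (a + b) v = ev a v + ev b v.
Proof. by rewrite /ev mulmxDr mxE. Qed.

Lemma evNm a v : ev (- a) v = - ev a v.
Proof. by rewrite /ev mulmxN mxE. Qed.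

Lemma evZm a (k : R) v : ev (k *: a) v = k * ev a v.
Proof. by rewrite /ev -scalemxAr mxE. Qed.

Lemma differentiable_ev (V : normedModType R) (a : V -> 'cV[R]_d)
    (X : V -> 'rV[R]_d) (x : V) :
  differentiable a x -> differentiable X x ->
  differentiable (fun y => ev (a y) (X y)) x.
Proof.
by move=> da dX; exact: (differentiable_mxP _ _).1 (differentiable_mulmx dX da)
  0 0.
Qed.

Lemma dder_ev (V : normedModType R) (a : V -> 'cV[R]_d) (X : V -> 'rV[R]_d)
    (x u : V) :
  differentiable a x -> differentiable X x ->
  dder (fun y => ev (a y) (X y)) x u =
  ev (a x) (dder X x u) + ev (dder a x u) (X x).
Proof.
move=> da dX; rewrite (dder_entry u 0 0 (differentiable_mulmx dX da)).
by rewrite dder_mulmx// mxE.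
Qed.

End Ev.

Lemma linear_map0 (R : realType) (V W : lmodType R) (f : V -> W) :
  linear f -> f 0 = 0.
Proof. by move=> lf; have := lf (-1) 0 0; rewrite scaler0 addr0 scaleN1r addNr.
  Qed.

(* The values at x of (nabla_v phi) w and nabla_v X as functions of v and w. *)
HB.lock Definition cov_endo (R : realType) (d : nat) (M : riem_endo R d)
    (c : chart R M d) (x v w : 'rV[R]_d) : 'rV[R]_d :=
  w *m dder (endo c) x v + Gamma c x v (w *m endo c x)
  - Gamma c x v w *m endo c x.

HB.lock Definition cov_vec (R : realType) (d : nat) (M : riem_endo R d)
    (c : chart R M d) (X : 'rV[R]_d -> 'rV[R]_d) (x v : 'rV[R]_d) : 'rV[R]_d :=
  dder X x v + Gamma c x v (X x).

Section Endo.
Variables (R : realType) (d : nat) (M : riem_endo R d) (c : chart R M d).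
Hypothesis Hc : atlas c.
Local Notation V := 'rV[R]_d.
Local Notation g := (metric c).
Local Notation p := (endo c).
Implicit Types (x : V) (u v w z : V).

(* S(phi v, v) *)
Definition skew_cov x v : V :=
  cov_endo c x (v *m p x) v - cov_endo c x v (v *m p x).

Lemma endo_differentiable x : cimg c x -> differentiable (p : V -> 'M[R]_d) x.
Proof. exact: (smooth_differentiable (endo_smooth Hc)). Qed.

Lemma nablaE (X Y : V -> V) x : nabla c X Y x = cov_vec c Y x (X x).
Proof. by rewrite /nabla dderE GammaE cov_vec.unlock. Qed.

Lemma nabla_phiE (X Y : V -> V) x : cimg c x -> differentiable Y x ->
  nabla_phi c X Y x = cov_endo c x (X x) (Y x).
Proof.
move=> Ux dY; have dp := endo_differentiable Ux.
rewrite /nabla_phi /phi !nablaE !cov_vec.unlock (dder_mulmx _ dY dp)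
  !cov_endo.unlock.
by rewrite mulmxDl; vring.
Qed.

Lemma phi_cst_differentiable v x : cimg c x ->
  differentiable (phi c (cst v)) x.
Proof.
move=> Ux.
exact: (differentiable_mulmx (differentiable_const v x) (endo_differentiable
  Ux)).
Qed.

Lemma tS_cst v x : cimg c x ->
  tS c (phi c (cst v)) (cst v) x = skew_cov x v.
Proof.
move=> Ux; rewrite /tS (nabla_phiE _ Ux (differentiable_const v x)).
by rewrite (nabla_phiE _ Ux (phi_cst_differentiable v Ux)).
Qed.

Lemma tP_cst v w x : cimg c x -> tP c (cst v) (cst w) x =
  cov_endo c x v w + cov_endo c x (v *m p x) (w *m p x).
Proof.
move=> Ux; rewrite /tP (nabla_phiE _ Ux (differentiable_const w x)).
by rewrite (nabla_phiE _ Ux (phi_cst_differentiable w Ux)).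
Qed.

Lemma Gamma_linearl x w : cimg c x -> linear (Gamma c x ^~ w).
Proof.
move=> Ux a u v; rewrite !(Gamma_sym Hc _ w)//.
exact: (Gamma_linear Hc).
Qed.

Lemma cov_endo_linear x v : cimg c x -> linear (cov_endo c x v).
Proof.
move=> Ux a w w'; rewrite !cov_endo.unlock !mulmxDl -!scalemxAl !Gamma_linear//.
by rewrite mulmxDl -!scalemxAl; vring.
Qed.

Lemma cov_endo_linearl x w : cimg c x -> linear (cov_endo c x ^~ w).
Proof.
move=> Ux a v v'; have dp := endo_differentiable Ux.
rewrite !cov_endo.unlock dder_dirD// dder_dirZ// !Gamma_linearl//.
by rewrite mulmxDr mulmxDl -scalemxAr -!scalemxAl; vring.
Qed.

End Endo.

(** * Almost contact metric and almost Hermitian structures *)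

(* Covers both kinds of structures: for an almost Hermitian one, xi, eta and e
   all vanish. *)
Record compatible (R : realType) d (M : riem_endo R d) (c : chart R M d)
    (xi : 'rV[R]_d -> 'rV[R]_d) (eta : 'rV[R]_d -> 'cV[R]_d) (e : R) : Prop :=
  Compatible {
    xi_sm : smooth_on (cimg c) xi;
    eta_sm : smooth_on (cimg c) eta;
    endo_sqr : forall x v, cimg c x ->
      v *m endo c x *m endo c x = - v + ev (eta x) v *: xi x;
    xi_endo : forall x, cimg c x -> xi x *m endo c x = 0;
    eta_endo : forall x v, cimg c x -> ev (eta x) (v *m endo c x) = 0;
    endo_skew : forall x v w, cimg c x ->
      bilin (metric c x) (v *m endo c x) w =
        - bilin (metric c x) v (w *m endo c x);
    eta_dual : forall x v, cimg c x -> ev (eta x) v =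
      bilin (metric c x) v (xi x);
    xi_norm : forall x, cimg c x -> bilin (metric c x) (xi x) (xi x) = e
  }.

Section Compatible.
Variables (R : realType) (d : nat) (M : riem_endo R d) (c : chart R M d).
Variables (xi : 'rV[R]_d -> 'rV[R]_d) (eta : 'rV[R]_d -> 'cV[R]_d) (e : R).
Hypothesis Hc : atlas c.
Hypothesis S : compatible c xi eta e.
Local Notation V := 'rV[R]_d.
Local Notation g := (metric c).
Local Notation p := (endo c).
Local Notation N := (cov_vec c xi).
Implicit Types (x : V) (u v w z : V).

Section AtPoint.
Variable x : V.
Hypothesis Ux : cimg c x.
Let dg := metric_differentiable Hc Ux.
Let dp := endo_differentiable Hc Ux.
Let dxi : differentiable xi x := smooth_differentiable (xi_sm S) Ux.
Let deta_ : differentiable eta x := smooth_differentiable (eta_sm S) Ux.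
Let oU := open_cimg (c:=c).

(** Since the metric is parallel, differentiating the skewness of phi shows that nabla_u phi is
    skew; the Christoffel terms cancel by [Gamma_metric]. *)
Lemma cov_endo_skew u v w :
  bilin (g x) (cov_endo c x u v) w = - bilin (g x) v (cov_endo c x u w).
Proof.
have dvp (t : V) : differentiable (fun y => t *m p y) x.
  exact: differentiable_mulmx (differentiable_const t x) dp.
have E : dder (fun y => bilin (g y) (v *m p y) w) x u =
    dder (fun y => - bilin (g y) v (w *m p y)) x u.
  by apply: (dder_eq_on u oU Ux) => y Uy; rewrite (endo_skew S).
move: E; rewrite dderN; last first.
  exact: (differentiable_bilin_form dg (differentiable_const v x) (dvp w)).
rewrite (dder_bilin _ dg (dvp v) (differentiable_const w x)).
rewrite (dder_bilin _ dg (differentiable_const v x) (dvp w)).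
rewrite !dder_mulmxl// !dder_cst bilin0l bilin0r !(Gamma_metric Hc _ _ _ Ux).
rewrite !cov_endo.unlock !(bilinBl, bilinBr, bilinDl, bilinDr).
rewrite !(endo_skew S _ _ Ux) -!(endo_skew S v _ Ux).
lra.
Qed.

(** This is (nabla_u eta) v = g(v, nabla_u xi), the derivative of eta = g(., xi), with its
    Christoffel term moved to the right. *)
Lemma ev_dder_eta u v :
  ev (dder eta x u) v = ev (eta x) (Gamma c x u v) + bilin (g x) v (N x u).
Proof.
have E : dder (fun y => ev (eta y) v) x u =
  dder (fun y => bilin (g y) v (xi y)) x u.
  by apply: (dder_eq_on u oU Ux) => y Uy; rewrite (eta_dual S).
move: E; rewrite (dder_ev _ deta_ (differentiable_const v x)).
rewrite (dder_bilin _ dg (differentiable_const v x) dxi) !dder_cst ev0 bilin0l.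
rewrite add0r addr0 (Gamma_metric Hc _ _ _ Ux) => ->.
by rewrite !cov_vec.unlock bilinDr (eta_dual S _ Ux) addrA addrAC.
Qed.

(** The covariant derivative of phi^2 = -1 + eta (x) xi: nabla_u phi anticommutes with phi up to
    terms in xi and nabla_u xi. *)
Lemma cov_endo_endo u v : cov_endo c x u (v *m p x) =
  - cov_endo c x u v *m p x + bilin (g x) v (N x u) *: xi x
  + ev (eta x) v *: N x u.
Proof.
have dvp : differentiable (fun y => v *m p y) x.
  exact: differentiable_mulmx (differentiable_const v x) dp.
have dvpp : differentiable (fun y => v *m p y *m p y) x.
  exact: differentiable_mulmx dvp dp.
have dev : differentiable (fun y => ev (eta y) v) x.
  exact: differentiable_ev deta_ (differentiable_const v x).
have dZ : differentiable (fun y => v *m p y *m p y + v) x.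
  exact: differentiableD dvpp (differentiable_const v x).
have E : dder (fun y => v *m p y *m p y + v) x u =
    dder (fun y => ev (eta y) v *: xi y) x u.
  apply: (dder_eq_on u oU Ux) => y Uy.
  by rewrite (endo_sqr S)// addrAC addNr add0r.
move: E; rewrite (dderD _ dvpp (differentiable_const v x)) dder_cst addr0.
rewrite (dder_mulmx _ dvp dp) dder_mulmxl// (dder_scale _ dev dxi).
rewrite (dder_ev _ deta_ (differentiable_const v x)) dder_cst ev0 add0r.
rewrite ev_dder_eta => E.
have {}E : v *m p x *m dder p x u = (ev (eta x) (Gamma c x u v) +
    bilin (g x) v (N x u)) *: xi x + ev (eta x) v *: dder xi x u
    - v *m dder p x u *m p x by rewrite -E addrAC subrr add0r.
rewrite !cov_endo.unlock E (endo_sqr S _ Ux) [- v + _]addrC.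
rewrite (Gamma_linear Hc u Ux) -[- v]scaleN1r -[-1 *: v]addr0.
rewrite (Gamma_linear Hc u Ux) (linear_map0 (Gamma_linear Hc u Ux)).
rewrite mulNmx mulmxBl mulmxDl (endo_sqr S _ Ux) !cov_vec.unlock; vring.
Qed.

Lemma cov_endo_xi u : cov_endo c x u (xi x) = - N x u *m p x.
Proof.
have E : dder (fun y => xi y *m p y) x u = dder (fun _ : V => (0 : V)) x u.
  by apply: (dder_eq_on u oU Ux) => y Uy; rewrite (xi_endo S).
move: E; rewrite dder_cst (dder_mulmx _ dxi dp) => E.
have {}E : xi x *m dder p x u = - (dder xi x u *m p x).
  by apply/eqP; rewrite -addr_eq0 addrC E.
have G0 : Gamma c x u 0 = 0.
  exact: linear_map0 (Gamma_linear Hc u Ux).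
rewrite !cov_endo.unlock E (xi_endo S Ux) !cov_vec.unlock mulNmx mulmxDl G0;
  vring.
Qed.

Lemma cov_vec_orth u : bilin (g x) (N x u) (xi x) = 0.
Proof.
have E : dder (fun y => bilin (g y) (xi y) (xi y)) x u =
  dder (fun _ : V => e) x u.
  by apply: (dder_eq_on u oU Ux) => y Uy; rewrite (xi_norm S).
move: E; rewrite dder_cst dder_bilin// (Gamma_metric Hc _ _ _ Ux)
  !cov_vec.unlock.
rewrite !bilinDl !(Defs.metric_sym Hc Ux (xi x)); lra.
Qed.

End AtPoint.
End Compatible.

(* 2 d eta(u, v) *)
Definition deta (R : realType) d (eta : 'rV[R]_d ->
  'cV[R]_d) (x u v : 'rV[R]_d) : R :=
  ev (dder eta x u) v - ev (dder eta x v) u.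

(** This is d(d eta) = 0 on constant fields: the second derivatives of eta cancel in pairs by
    Schwarz. *)
Lemma dder_deta_cyclic (R : realType) d (U : set 'rV[R]_d)
    (eta : 'rV[R]_d -> 'cV[R]_d) x u v w :
  open U -> U x -> smooth_on U eta ->
  dder (fun y => deta eta y v w) x u + dder (fun y => deta eta y w u) x v
  + dder (fun y => deta eta y u v) x w = 0.
Proof.
move=> Uo Ux se.
have dde t : differentiable (fun y => dder eta y t) x.
  exact: smooth_differentiable (dder_smooth t Uo se) Ux.
have dev s t : differentiable (fun y => ev (dder eta y s) t) x.
  exact: (differentiable_ev (dde s) (differentiable_const t x)).
have devN s t : differentiable (fun y => - ev (dder eta y s) t) x.
  exact: differentiableN (dev s t).
have E r s t : dder (fun y => deta eta y s t) x r =
    ev (dder (fun y => dder eta y s) x r) t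
    - ev (dder (fun y => dder eta y t) x r) s.
  rewrite (dderD r (dev s t) (devN t s)) dderN//.
  rewrite !(dder_ev _ (dde _) (differentiable_const _ x)) !dder_cst !ev0.
  by rewrite !add0r.
rewrite !E (dder_schwarz w u Uo Ux se) (dder_schwarz u v Uo Ux se).
rewrite (dder_schwarz v w Uo Ux se); ring.
Qed.

(** * The fundamental form and its exterior derivative *)

Section Form.
Variables (R : realType) (d : nat) (M : riem_endo R d) (c : chart R M d).
Hypothesis Hc : atlas c.
Local Notation g := (metric c).
Local Notation p := (endo c).
Implicit Types (x u v w : 'rV[R]_d).

(* Omega(v, w) for fields with constant components *)
Definition fform v w x : R := bilin (g x) v (w *m p x).

Lemma fform_differentiable v w x : cimg c x -> differentiable (fform v w) x.
Proof.
move=> Ux; have dw := phi_cst_differentiable Hc w Ux.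
exact: (differentiable_bilin_form (metric_differentiable Hc Ux)
  (differentiable_const v x) dw).
Qed.

Lemma dder_fform x u v w : cimg c x -> dder (fform v w) x u =
  bilin (g x) (Gamma c x u v) (w *m p x) + bilin (g x) v (cov_endo c x u w)
  + bilin (g x) v (Gamma c x u w *m p x).
Proof.
move=> Ux; have dg := metric_differentiable Hc Ux.
have dp := endo_differentiable Hc Ux; have dw := phi_cst_differentiable Hc w Ux.
apply: etrans (dder_bilin u dg (differentiable_const v x) dw) _.
rewrite dder_cst bilin0l addr0 (Gamma_metric Hc _ _ _ Ux) /phi /cst.
rewrite dder_mulmxl// !cov_endo.unlock !bilinDr bilinNr; ring.
Qed.

(** A nonzero multiple of d Omega, written as the cyclic sum of nabla Omega: the connection is
    torsion free, so the Christoffel terms drop out of d. *)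
Definition Omega_closed_at x := forall u v w,
  bilin (g x) (cov_endo c x u v) w + bilin (g x) (cov_endo c x v w) u
  + bilin (g x) (cov_endo c x w u) v = 0.

Hypothesis skew : forall x v w, cimg c x ->
  bilin (g x) (v *m p x) w = - bilin (g x) v (w *m p x).

Lemma dder_fform_cyclic x u v w : cimg c x ->
  dder (fform v w) x u + dder (fform w u) x v + dder (fform u v) x w =
  bilin (g x) (cov_endo c x u w) v + bilin (g x) (cov_endo c x w v) u
  + bilin (g x) (cov_endo c x v u) w.
Proof.
move=> Ux; rewrite !dder_fform//.
have sk r s t : bilin (g x) r (Gamma c x s t *m p x) =
    - bilin (g x) (Gamma c x s t) (r *m p x).
  by rewrite (Defs.metric_sym Hc Ux) skew.
rewrite !sk (Gamma_sym Hc v u)// (Gamma_sym Hc w u)// (Gamma_sym Hc w v)//.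
rewrite ![bilin (g x) _ (cov_endo _ _ _ _)](Defs.metric_sym Hc Ux); ring.
Qed.

Lemma ext_d2_Omega_closed x : cimg c x ->
  (forall u v w, ext_d2 (@Omega R d M c) (cst u) (cst v) (cst w) x = 0) ->
  Omega_closed_at x.
Proof.
move=> Ux E u v w; have := E u w v; rewrite /ext_d2 !dderE.
have lie0 s t : lie (cst s) (cst t) x = 0.
  by rewrite /lie !dderE !dder_cst subrr.
have O0 X Y : X x = 0 -> Omega c X Y x = 0.
  by move=> X0; rewrite /Omega /gdot X0 bilin0l.
rewrite !O0 ?lie0// !subr0 => /eqP.
rewrite mulf_eq0 invr_eq0 pnatr_eq0 /= => /eqP.
have := dder_fform_cyclic u w v Ux.
rewrite /fform /Omega /gdot /phi /cst => -> <-; ring.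
Qed.

(** As d(d eta) = 0, a form whose first derivatives at [x] are proportional to those of d eta is
    closed at [x]. Only derivatives at [x] are compared, so the proportionality may come from an
    identity valid along a map. *)
Lemma deta_Omega_closed (eta : 'rV[R]_d -> 'cV[R]_d) (k : R) x : cimg c x ->
  smooth_on (cimg c) eta -> k != 0 ->
  (forall u v w, dder (fun y => deta eta y v w) x u =
    k * dder (fform v w) x u) ->
  Omega_closed_at x.
Proof.
move=> Ux se k0 E u v w; apply: (mulfI k0); rewrite mulr0.
rewrite -[RHS](dder_deta_cyclic u w v (open_cimg (c:=c)) Ux se) !E -!mulrDr.
by rewrite dder_fform_cyclic//; ring.
Qed.

End Form.

(** * Vanishing criteria for S(phi v, v) and for nabla_xi xi *)

Section SkewCov.
Variables (R : realType) (d : nat) (M : riem_endo R d) (c : chart R M d).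
Variables (xi : 'rV[R]_d -> 'rV[R]_d) (eta : 'rV[R]_d -> 'cV[R]_d) (e : R).
Hypothesis Hc : atlas c.
Hypothesis S : compatible c xi eta e.
Variable x : 'rV[R]_d.
Hypothesis Ux : cimg c x.
Local Notation V := 'rV[R]_d.
Local Notation g := (metric c x).
Local Notation p := (endo c x).
Local Notation N := (cov_vec c xi x).
Local Notation cov := (cov_endo c x).
Implicit Types (u v w z : V).

Let gsym v w : bilin g v w = bilin g w v := Defs.metric_sym Hc Ux v w.

Lemma deta_cov u v : deta eta x u v = bilin g v (N u) - bilin g u (N v).
Proof.
rewrite /deta !(ev_dder_eta Hc S Ux) (Gamma_sym Hc v u Ux); ring.
Qed.

Lemma deta_xi v : deta eta x (xi x) v = bilin g (N (xi x)) v.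
Proof.
rewrite deta_cov [bilin g (xi x) _]gsym (cov_vec_orth Hc S Ux) subr0.
exact: gsym.
Qed.

Lemma cov_xi_xi0 : N (xi x) *m p = 0 -> N (xi x) = 0.
Proof.
move=> E; have := endo_sqr S (N (xi x)) Ux.
rewrite E mul0mx (eta_dual S _ Ux) (cov_vec_orth Hc S Ux) scale0r addr0.
by move=> /esym/eqP; rewrite oppr_eq0 => /eqP.
Qed.

Lemma bilin_endo_endo u v :
  bilin g (u *m p) (v *m p) = bilin g u v - ev (eta x) u * ev (eta x) v.
Proof.
rewrite (endo_skew S _ _ Ux) (endo_sqr S _ Ux) bilinDr bilinNr bilinZr.
rewrite -(eta_dual S _ Ux); ring.
Qed.

(** With T = nabla_u phi skew and anticommuting with phi up to xi, g(T phi v, v) = g(T v, phi v) = -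
    g(v, T phi v), hence it vanishes. *)
Lemma cov_endo_self u v : ev (eta x) v = 0 -> bilin g (cov u (v *m p)) v = 0.
Proof.
move=> v0; have E : bilin g (cov u (v *m p)) v = - bilin g (cov u (v *m p)) v.
  rewrite [in LHS](cov_endo_endo Hc S Ux) v0 scale0r addr0 bilinDl bilinZl.
  rewrite [bilin g (xi x) v]gsym -(eta_dual S _ Ux) v0 mulr0 addr0.
  rewrite mulNmx bilinNl (endo_skew S _ _ Ux) opprK.
  by rewrite (cov_endo_skew Hc S Ux) [in RHS]gsym.
lra.
Qed.

(** In the closedness identity at (phi v, v, z) the term differentiated along z vanishes by
    [cov_endo_self]; by skewness the other two form g(S(phi v, v), z). *)
Lemma skew_cov_closed v :
  Omega_closed_at c x -> ev (eta x) v = 0 -> skew_cov c x v = 0.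
Proof.
move=> O v0; apply: (bilin_eqP Hc Ux) => z; rewrite bilin0l /skew_cov bilinBl.
have := O (v *m p) v z; rewrite cov_endo_self//.
rewrite [bilin g (cov v z) _](cov_endo_skew Hc S Ux) [bilin g z _]gsym; lra.
Qed.

(** Separates S(phi v, v) into phi P(v, v) and a multiple of xi, by using the derivative of phi^2
    once at v and once at phi v. *)
Lemma skew_covE v : ev (eta x) v = 0 -> skew_cov c x v =
  (cov v v + cov (v *m p) (v *m p)) *m p
  - (bilin g v (N v) + bilin g (v *m p) (N (v *m p))) *: xi x.
Proof.
move=> v0; rewrite /skew_cov (cov_endo_endo Hc S Ux) v0.
have := cov_endo_endo Hc S Ux (v *m p) (v *m p).
rewrite (endo_sqr S _ Ux) v0 (eta_endo S _ Ux) !scale0r !addr0.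
have -> : cov (v *m p) (- v) = - cov (v *m p) v.
  have := cov_endo_linear Hc (v *m p) Ux (-1) v 0.
  rewrite (linear_map0 (cov_endo_linear Hc _ Ux)).
  by rewrite !addr0 !scaleN1r.
move=> /(congr1 -%R); rewrite opprK => ->.
by rewrite mulmxDl !mulNmx; vring.
Qed.

(* The two ways in which the non-integrable classes are handled: either
   P(v,v) is vertical, or (nabla_v phi) v is vertical and Q(phi v,v) = 0. *)
Lemma skew_cov_quasi v : ev (eta x) v = 0 ->
  (cov v v + cov (v *m p) (v *m p)) *m p = 0 ->
  bilin g v (N v) + bilin g (v *m p) (N (v *m p)) = 0 -> skew_cov c x v = 0.
Proof. by move=> v0 E1 E2; rewrite skew_covE// E1 E2 scale0r subr0. Qed.

Lemma skew_cov_nearly v : ev (eta x) v = 0 ->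
  cov v v *m p = 0 -> cov (v *m p) v = - cov v (v *m p) ->
  bilin g v (N v) = 0 -> skew_cov c x v = 0.
Proof.
move=> v0 E1 E2 E3; rewrite /skew_cov E2 (cov_endo_endo Hc S Ux) v0 E3.
by rewrite !mulNmx E1 !scale0r oppr0 !addr0 subr0 oppr0.
Qed.

Lemma bilin_cov_xi v w : ev (eta x) w = 0 ->
  bilin g (cov v (xi x)) (w *m p) = - bilin g (N v) w.
Proof.
move=> w0; rewrite (cov_endo_xi Hc S Ux) mulNmx bilinNl bilin_endo_endo w0.
by rewrite mulr0 subr0.
Qed.

End SkewCov.

Section Contact.
Variables (R : realType) (m : nat) (M : almost_contact R m).
Variable c : chart R M m.*2.+1.
Hypothesis Hc : atlas c.
Local Notation V := 'rV[R]_(m.*2.+1).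

Lemma contact_compatible : compatible c (xi c) (eta c) 1.
Proof.
have sqr x v : cimg c x ->
    v *m endo c x *m endo c x = - v + ev (eta c x) v *: xi c x.
  by move=> Ux; exact: phi_sqr.
have e1 x : cimg c x -> ev (eta c x) (xi c x) = 1 by move=> Ux; exact: eta_xi.
have met x v w : cimg c x -> bilin (metric c x) (v *m endo c x) (w *m endo c x)
  =
    bilin (metric c x) v w - ev (eta c x) v * ev (eta c x) w.
  by move=> Ux; exact: phi_metric.
(* From phi^2 xi = 0, the formula for phi^2 at phi xi gives phi xi = t xi with t = eta(phi xi). Then
   t^2 xi = phi^2 xi = 0, so t = 0. *)
have xi0 x : cimg c x -> xi c x *m endo c x = 0.
  move=> Ux; have E1 : xi c x *m endo c x *m endo c x = 0.
    by rewrite sqr// e1// scale1r addNr.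
  have := sqr x (xi c x *m endo c x) Ux; rewrite E1 mul0mx.
  set t := ev _ _ => /esym/eqP; rewrite addrC subr_eq0 => /eqP E2.
  have := congr1 (ev (eta c x)) E1; rewrite -E2 -scalemxAl -E2 !evZ e1// ev0.
  move=> /eqP; rewrite mulr1 mulf_eq0 orbb => /eqP ->.
  exact: scale0r.
(* phi^3 v is computed as phi^2(phi v) and as phi(phi^2 v); the difference is eta(phi v) xi. *)
have eta0 x v : cimg c x -> ev (eta c x) (v *m endo c x) = 0.
  move=> Ux; have := sqr x (v *m endo c x) Ux.
  rewrite (sqr x v Ux) mulmxDl mulNmx -scalemxAl xi0// scaler0 => /addrI E.
  by have := congr1 (ev (eta c x)) E; rewrite evZ e1// mulr1 ev0.
have dual x v : cimg c x -> ev (eta c x) v = bilin (metric c x) v (xi c x).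
  move=> Ux; have := met x v (xi c x) Ux; rewrite xi0// bilin0r e1// mulr1.
  by move=> /esym/eqP; rewrite subr_eq0 => /eqP.
split => //; last 2 first.
- move=> x v w Ux; have := met x v (w *m endo c x) Ux.
  rewrite eta0// mulr0 subr0 sqr// bilinDr bilinNr bilinZr -dual// eta0//.
  by rewrite mulr0 addr0 => <-; rewrite opprK.
- by move=> x Ux; rewrite -dual// e1.
- exact: xi_smooth.
- exact: eta_smooth.
Qed.

Let S := contact_compatible.

(** The common interface of A1, A4, A6 and B1: the first clause kills the frame terms of the
    tension, the second makes the Reeb field geodesic, which controls B(xi, xi). *)
Definition balanced_at x :=
  (forall v, ev (eta c x) v = 0 -> skew_cov c x v = 0) /\
  cov_vec c (xi c) x (xi c x) = 0.

Lemma smooth_const_field (v : V) : smooth_on (cimg c) (cst v).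
Proof. exact (smooth_cst (open_cimg (c:=c)) v). Qed.

Variable x : V.
Hypothesis Ux : cimg c x.
Local Notation g := (metric c x).
Local Notation p := (endo c x).
Local Notation N := (cov_vec c (xi c) x).

Lemma xi_differentiable : differentiable (xi c) x.
Proof. exact: (smooth_differentiable (xi_sm S) Ux). Qed.

Lemma eta_differentiable : differentiable (eta c) x.
Proof. exact: (smooth_differentiable (eta_sm S) Ux). Qed.

Lemma d_etaE (X Y : V -> V) : differentiable X x -> differentiable Y x ->
  d_eta c X Y x = 2^-1 * deta (eta c) x (X x) (Y x).
Proof.
move=> dX dY; have de := eta_differentiable.
rewrite /d_eta /ext_d1 /eta_ !dderE /lie !dderE.
rewrite -[(_ *m eta c x) 0 0]/(ev (eta c x) _).
rewrite (dder_ev _ de dY) (dder_ev _ de dX) evD evN /deta; congr (_ * _); ring.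
Qed.

Lemma cov_xi_xi0_deta : (forall v, deta (eta c) x (xi c x) v = 0) ->
  N (xi c x) = 0.
Proof.
move=> E; apply: (bilin_eqP Hc Ux) => z.
by rewrite bilin0l -(deta_xi Hc S Ux) E.
Qed.

Lemma deta_xi0 v : N (xi c x) = 0 -> deta (eta c) x (xi c x) v = 0.
Proof. by move=> N0; rewrite (deta_xi Hc S Ux) N0 bilin0l. Qed.

Lemma ev_nijenhuis (X Y : V -> V) : ev (eta c x) (nijenhuis c X Y x) =
  ev (eta c x) (lie (phi c X) (phi c Y) x).
Proof.
rewrite /nijenhuis.
move: (lie (phi c X) (phi c Y) x) (lie X Y) (lie (phi c X) Y) (lie X (phi c Y)).
move=> A B C D.
by rewrite /phi !evD !evN !(eta_endo S _ Ux) !subr0 add0r.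
Qed.

(** Apply eta to the normality identity at (xi, v). The terms in the image of phi disappear, and so
    does [phi xi, phi v], because phi xi is identically zero on the chart. *)
Lemma normal_deta_xi v : is_normal M -> deta (eta c) x (xi c x) v = 0.
Proof.
move=> nM; have := nM c Hc _ (xi_sm S) x Ux _ (smooth_const_field v).
rewrite (d_etaE xi_differentiable (differentiable_const v x)) mulVKf
  ?pnatr_eq0//.
have L : lie (phi c (xi c)) (phi c (cst v)) x = 0.
  rewrite /lie !dderE /phi (xi_endo S Ux).
  rewrite (linear_map0 (dder_linear (phi_cst_differentiable Hc v Ux))) sub0r.
  rewrite (@dder_eq_on _ _ _ (cimg c) _ (fun _ => 0) _ _ (open_cimg (c:=c)) Ux).
    by rewrite dder_cst oppr0.
  by move=> y Uy; exact (xi_endo S Uy).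
move=> /(congr1 (ev (eta c x))); rewrite evD ev_nijenhuis L !ev0 add0r evZ.
by rewrite [ev _ (xi c x)](eta_dual S _ Ux) (xi_norm S Ux) mulr1.
Qed.

Lemma ev_lie_endo v w :
  ev (eta c x) (lie (phi c (cst v)) (phi c (cst w)) x) =
  - deta (eta c) x (v *m p) (w *m p).
Proof.
have de := eta_differentiable.
have K t u : ev (eta c x) (dder (phi c (cst t)) x u) =
  - ev (dder (eta c) x u) (t *m p).
  apply/eqP; rewrite -addr_eq0; apply/eqP.
  rewrite -(dder_ev u de (phi_cst_differentiable Hc t Ux)).
  rewrite (@dder_eq_on _ _ _ (cimg c) _ (fun _ => 0) _ _ (open_cimg (c:=c)) Ux).
    by rewrite dder_cst.
  by move=> y Uy; exact (eta_endo S _ Uy).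
by rewrite /lie !dderE evD evN !K /deta /phi /cst; ring.
Qed.

(** The eta component of normality reads eta([phi v, phi w]) + 2 d eta(v, w) = 0, and
    eta([phi v, phi w]) = - 2 d eta(phi v, phi w) because eta vanishes on the image of phi. *)
Lemma normal_deta_endo v w : is_normal M ->
  deta (eta c) x (v *m p) (w *m p) = deta (eta c) x v w.
Proof.
move=> nM; have := nM c Hc _ (smooth_const_field v) x Ux _ (smooth_const_field
  w).
rewrite (d_etaE (differentiable_const v x) (differentiable_const w x)).
rewrite mulVKf ?pnatr_eq0// => /(congr1 (ev (eta c x))).
rewrite evD ev_nijenhuis ev_lie_endo ev0 evZ.
rewrite [ev _ (xi c x)](eta_dual S _ Ux) (xi_norm S Ux) mulr1 /cst; lra.
Qed.

Lemma tH_cst v : tH c (cst v) x =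
  2^-1 *: (cov_endo c x (xi c x) v - N (v *m p) + N v *m p).
Proof.
have E t : dder (phi c (cst v)) x t = v *m dder (endo c) x t.
  exact (dder_mulmxl v t (endo_differentiable Hc Ux)).
rewrite /tH [phi c (lie _ _) x]/phi /lie !dderE E dder_cst sub0r mulNmx opprK
  /phi.
rewrite !cov_endo.unlock !cov_vec.unlock mulmxDl.
by rewrite (Gamma_sym Hc (v *m p) _ Ux) (Gamma_sym Hc v _ Ux) /cst; vring.
Qed.

Lemma ev_xi : ev (eta c x) (xi c x) = 1.
Proof. by rewrite (eta_dual S _ Ux) (xi_norm S Ux). Qed.

Lemma bilin_xi v : bilin g (xi c x) v = ev (eta c x) v.
Proof. by rewrite (Defs.metric_sym Hc Ux) (eta_dual S _ Ux). Qed.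

Lemma bilin_endo_self v : bilin g v (v *m p) = 0.
Proof.
have := endo_skew S v v Ux; rewrite (Defs.metric_sym Hc Ux); lra.
Qed.

Lemma tP_xi v : tP c (cst v) (cst (xi c x)) x = cov_endo c x v (xi c x).
Proof.
rewrite (tP_cst Hc)// (xi_endo S Ux).
by rewrite (linear_map0 (cov_endo_linear Hc _ Ux)) addr0.
Qed.

Lemma bilin_cov_endo v w : ev (eta c x) v = 0 ->
  bilin g (cov_endo c x w v) (v *m p) = 0.
Proof.
move=> v0; rewrite (cov_endo_skew Hc S Ux) (Defs.metric_sym Hc Ux).
by rewrite (cov_endo_self Hc S Ux _ v0) oppr0.
Qed.

Lemma balanced_closed : Omega_closed_at c x ->
  (forall v, deta (eta c) x (xi c x) v = 0) -> balanced_at x.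
Proof.
move=> O dx; split; last exact: cov_xi_xi0_deta.
by move=> v; exact: (skew_cov_closed Hc S Ux).
Qed.

Lemma Omega_closed_at_of : Omega_closed M -> Omega_closed_at c x.
Proof.
move=> O; apply: (ext_d2_Omega_closed Hc _ Ux) => [y v w Uy|u v w].
  exact (endo_skew S _ _ Uy).
exact (O c Hc _ (smooth_const_field u) x Ux _ (smooth_const_field v) _
  (smooth_const_field w)).
Qed.

Lemma deta_eq_fform alpha v w : d_eta_eq M alpha ->
  deta (eta c) x v w = 2 * alpha * fform c v w x.
Proof.
move=> E; have := E c Hc _ (smooth_const_field v) x Ux _ (smooth_const_field w).
rewrite (d_etaE (differentiable_const v x) (differentiable_const w x)).
rewrite /Omega /gdot /phi /cst -/(fform c v w x) => E'.
by rewrite -mulrA -E' mulVKf// pnatr_eq0.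
Qed.

End Contact.

(** * Contact classes that are balanced *)

Section ContactClasses.
Variables (R : realType) (m : nat) (M : almost_contact R m).
Variable c : chart R M m.*2.+1.
Hypothesis Hc : atlas c.
Variable x : 'rV[R]_(m.*2.+1).
Hypothesis Ux : cimg c x.
Let S := contact_compatible Hc.
Local Notation g := (metric c x).
Local Notation p := (endo c x).
Local Notation N := (cov_vec c (xi c) x).
Local Notation ev := (ev (eta c x)).

Lemma d_eta_eq_balanced alpha : alpha != 0 -> d_eta_eq M alpha ->
  balanced_at c x.
Proof.
move=> a0 E; apply: balanced_closed => // [|v].
  apply: (@deta_Omega_closed _ _ _ _ Hc _ (eta c) (2 * alpha)) => //.
  - by move=> y v w Uy; exact (endo_skew S _ _ Uy).
  - exact (eta_sm S).
  - by rewrite mulf_neq0// pnatr_eq0.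
  move=> u v w.
  have df := fform_differentiable Hc v w Ux.
  rewrite (@dder_eq_on _ _ _ (cimg c) _ (fun y => 2 * alpha * fform c v w y) _ _
    (open_cimg (c:=c)) Ux); last first.
    by move=> y Uy; exact: deta_eq_fform.
  rewrite (dderM _ (differentiable_const (2 * alpha) x) df) dder_cst.
  by rewrite mulr0 addr0.
rewrite (deta_eq_fform Hc Ux _ _ E) /fform bilin_xi// (eta_endo S _ Ux).
by rewrite mulr0.
Qed.

Lemma normal_closed_balanced : is_normal M -> Omega_closed M -> balanced_at c x.
Proof.
move=> nM O; apply: balanced_closed => //; first exact: Omega_closed_at_of.
by move=> v; exact: normal_deta_xi.
Qed.

Lemma almost_cosymplectic_balanced : almost_cosymplectic M -> balanced_at c x.
Proof.
move=> [E O]; apply: balanced_closed => //; first exact: Omega_closed_at_of.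
move=> v; have := E c Hc _ (smooth_const_field _ (xi c x)) x Ux _
  (smooth_const_field _ v).
rewrite (d_etaE Hc Ux (differentiable_const _ x) (differentiable_const v x)).
by move=> /eqP; rewrite mulf_eq0 invr_eq0 pnatr_eq0 => /eqP.
Qed.

Lemma quasi_contact_balanced : quasi_contact M -> balanced_at c x.
Proof.
move=> E; have T v w := E c Hc _ (smooth_const_field _ v) x Ux _
  (smooth_const_field _ w).
have {}T v w : tP c (cst v) (cst w) x = (2 * bilin g v w) *: xi c x -
  ev w *: (v + ev v *: xi c x + 2^-1 *: (cov_endo c x (xi c x) v - N (v *m p)
    + N v *m p)) by rewrite T tH_cst.
split; last first.
  (* At (xi, xi) the right side is - h xi, and h xi = 0 since (nabla_xi phi) xi = - phi(nabla_xi
     xi). What remains is phi(nabla_xi xi) = 0. *)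
  apply: (cov_xi_xi0 Hc S Ux); have := T (xi c x) (xi c x).
  rewrite tP_xi// (xi_norm S Ux) ev_xi// (xi_endo S Ux) (cov_endo_xi Hc S Ux).
  have -> : N 0 = 0.
    rewrite !cov_vec.unlock (linear_map0 (dder_linear (xi_differentiable Hc
      Ux))).
    by rewrite (linear_map0 (Gamma_linearl Hc _ Ux)) addr0.
  move=> F; apply/eqP; rewrite -oppr_eq0 -mulNmx F; apply/eqP.
  by rewrite mulNmx subr0 addNr scaler0; vring.
move=> v v0; apply: (skew_cov_quasi Hc S Ux v0).
  rewrite -(tP_cst Hc)// T v0 scale0r subr0 -scalemxAl (xi_endo S Ux).
  exact: scaler0.
(* The left side becomes - g(nabla_v xi, v). On the right only half the difference of g(nabla_(phi
   v) xi, phi v) and g(nabla_v xi, v) survives, so the sum of these two numbers is zero. *)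
have := congr1 (fun z => bilin g z (v *m p)) (T v (xi c x)).
rewrite tP_xi// (bilin_cov_xi Hc S Ux _ v0) ev_xi// scale1r v0 scale0r addr0.
rewrite !(bilinDl, bilinNl, bilinZl) bilin_xi// (eta_endo S _ Ux).
rewrite bilin_endo_self// bilin_cov_endo// (bilin_endo_endo S Ux) v0.
rewrite [bilin g v (N v)](Defs.metric_sym Hc Ux).
rewrite [bilin g (v *m p) (N _)](Defs.metric_sym Hc Ux); lra.
Qed.

(** The parameter [a] joins two classes: 2 gives quasi-K-Sasakian manifolds, 0 gives
    quasi-K-cosymplectic ones. *)
Lemma quasi_K_sasakian_balanced (a : R) :
  for_fields2 (M := M) (fun c X Y x =>
    tP c X Y x = (a * gdot c X Y x) *: xi c x - (a * eta_ c Y x) *: X x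
      + eta_ c Y x *: nabla c (phi c X) (xi c) x) -> balanced_at c x.
Proof.
move=> E; have T v w := E c Hc _ (smooth_const_field _ v) x Ux _
  (smooth_const_field _ w).
have {}T v w : tP c (cst v) (cst w) x = (a * bilin g v w) *: xi c x
  - (a * ev w) *: v + ev w *: N (v *m p) by rewrite T nablaE.
split; last first.
  apply: (cov_xi_xi0 Hc S Ux); have := T (xi c x) (xi c x).
  rewrite tP_xi// (xi_norm S Ux) ev_xi// (xi_endo S Ux) (cov_endo_xi Hc S Ux).
  have -> : N 0 = 0.
    rewrite !cov_vec.unlock (linear_map0 (dder_linear (xi_differentiable Hc
      Ux))).
    by rewrite (linear_map0 (Gamma_linearl Hc _ Ux)) addr0.
  move=> F; apply/eqP; rewrite -oppr_eq0 -mulNmx F; apply/eqP; vring.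
move=> v v0; apply: (skew_cov_quasi Hc S Ux v0).
  rewrite -(tP_cst Hc)// T v0 mulr0 !scale0r subr0 addr0 -scalemxAl (xi_endo S
    Ux).
  exact: scaler0.
have := congr1 (fun z => bilin g z (v *m p)) (T v (xi c x)).
rewrite tP_xi// (bilin_cov_xi Hc S Ux _ v0) ev_xi// scale1r.
rewrite !(bilinDl, bilinNl, bilinZl) bilin_xi// (eta_endo S _ Ux).
rewrite bilin_endo_self//.
rewrite [bilin g v (N v)](Defs.metric_sym Hc Ux).
rewrite [bilin g (v *m p) (N _)](Defs.metric_sym Hc Ux); lra.
Qed.

(* Covers class A6, and nearly cosymplectic manifolds with a = 0. *)
Lemma nearly_balanced (a : R) : (forall v w,
  cov_endo c x v w + cov_endo c x w v = a *: ((2 * bilin g v w) *: xi c x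
      - ev w *: v - ev v *: w)) -> balanced_at c x.
Proof.
move=> T; split; last first.
  apply: (cov_xi_xi0 Hc S Ux); have := T (xi c x) (xi c x).
  rewrite (xi_norm S Ux) ev_xi// (cov_endo_xi Hc S Ux) mulr1 !scale1r.
  have -> : 2 *: xi c x - xi c x - xi c x = 0 by vring.
  rewrite scaler0 -mulr2n => /eqP; rewrite -scaler_nat scaler_eq0 pnatr_eq0 /=.
  by rewrite mulNmx oppr_eq0 => /eqP.
move=> v v0; apply: (skew_cov_nearly Hc S Ux v0).
- have := congr1 (mulmx^~ p) (T v v); rewrite v0 !scale0r !subr0 /=.
  rewrite -!scalemxAl (xi_endo S Ux) !scaler0 -mulr2n -scaler_nat -scalemxAl.
  by move=> /eqP; rewrite scaler_eq0 pnatr_eq0 => /eqP.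
- apply/eqP; rewrite -addr_eq0 T v0 (eta_endo S _ Ux) (Defs.metric_sym Hc Ux).
  by rewrite bilin_endo_self// mulr0 !scale0r !subr0 scaler0.
have := congr1 (fun z => bilin g z (v *m p)) (T v (xi c x)).
rewrite bilinDl (bilin_cov_xi Hc S Ux _ v0) bilin_cov_endo// v0.
rewrite !(bilinDl, bilinNl, bilinZl) bilin_xi// (eta_endo S _ Ux).
rewrite bilin_endo_self// (Defs.metric_sym Hc Ux (N v)); lra.
Qed.

End ContactClasses.

(** * Holomorphic maps *)

Lemma smooth_subset (R : realType) (V W : normedModType R) (A B : set V)
    (f : V -> W) : (forall y, A y -> B y) -> smooth_on B f -> smooth_on A f.
Proof.
move=> AB sf k; elim: k f sf => [|k IH] f sf; first by move=> x /AB;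
  exact: (sf 0%N).
split=> [x /AB Bx|v]; first exact: smooth_differentiable sf Bx.
by apply: IH; exact: smooth_derive.
Qed.

Lemma dder_schwarz_scalar (R : realType) (V : normedModType R) (U : set V)
    (f : V -> R) x u v : open U -> U x -> smooth_on U f ->
  dder (fun y => dder f y u) x v = dder (fun y => dder f y v) x u.
Proof.
move=> Uo Ux sf.
have E w : (fun y => dder f y w) = (fun y => 'D_w f y).
  by apply/funext => y; rewrite dderE.
rewrite !E -!dderE; apply: (schwarz Uo Ux).
- by move=> y Uy; exact: smooth_differentiable sf Uy.
- exact: smooth_differentiable (smooth_derive u sf) Ux.
- exact: smooth_differentiable (smooth_derive v sf) Ux.
Qed.

Section Jacobian.
Variables (R : realType) (a b : nat) (W : set 'rV[R]_a) (F : 'rV[R]_a ->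
  'rV[R]_b).
Hypothesis Wo : open W.
Hypothesis sF : smooth_on W F.
Implicit Types (x y u v w : 'rV[R]_a).

Definition Jac y : 'M[R]_(a, b) := \matrix_i dder F y (delta_mx 0 i).

Lemma JacE y v : W y -> dder F y v = v *m Jac y.
Proof.
move=> Wy; have dF := smooth_differentiable sF Wy.
pose L : {linear _ -> _} := HB.pack (dder F y)
  (GRing.isLinear.Build _ _ _ _ _ (dder_linear dF)).
rewrite -[dder F y v]/(L v) [v in L v]row_sum_delta linear_sum mulmx_sum_row.
by apply: eq_bigr => i _; rewrite linearZ /= rowK.
Qed.

Lemma Jac_smooth : smooth_on W Jac.
Proof.
apply/(smooth_mxP Wo) => i j.
have /(smooth_mxP Wo) := dder_smooth (delta_mx 0 i) Wo sF => /(_ 0 j).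
by apply: smooth_eq => // y _; rewrite mxE.
Qed.

Lemma dder_along (X : 'rV[R]_a -> 'rV[R]_a) x u : W x -> differentiable X x ->
  dder (fun y => dder F y (X y)) x u =
  dder (fun y => dder F y (X x)) x u + dder F x (dder X x u).
Proof.
move=> Wx dX; have dJ := smooth_differentiable Jac_smooth Wx.
have -> : dder (fun y => dder F y (X y)) x u = dder (fun y => X y *m Jac y) x u.
  by apply: (dder_eq_on u Wo Wx) => y Wy; rewrite JacE.
have -> : dder (fun y => dder F y (X x)) x u = dder (fun y => X x *m Jac y) x u.
  by apply: (dder_eq_on u Wo Wx) => y Wy; rewrite JacE.
by rewrite (dder_mulmx _ dX dJ) dder_mulmxl// (JacE _ Wx) addrC.
Qed.

Lemma dder_along_smooth (X : 'rV[R]_a -> 'rV[R]_a) :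
  smooth_on W X -> smooth_on W (fun y => dder F y (X y)).
Proof.
move=> sX; have := smooth_mulmx Wo sX Jac_smooth.
by apply: smooth_eq => // y Wy; rewrite JacE.
Qed.

End Jacobian.

HB.lock Definition sff (R : realType) (a b : nat) (M : riemannian R a)
    (N : riemannian R b) (c : chart R M a) (c' : chart R N b)
    (F : 'rV[R]_a -> 'rV[R]_b) (x u w : 'rV[R]_a) : 'rV[R]_b :=
  dder (fun y => dder F y w) x u + Gamma c' (F x) (dder F x u) (dder F x w)
  - dder F x (Gamma c x u w).

Section Holomorphic.
Variables (R : realType) (a b : nat) (M : riem_endo R a) (N : riem_endo R b).
Variables (c : chart R M a) (c' : chart R N b).
Hypotheses (Hc : atlas c) (Hc' : atlas c').
Variables (W : set 'rV[R]_a) (F : 'rV[R]_a -> 'rV[R]_b) (s : R).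
Hypothesis Wo : open W.
Hypothesis WU : forall y, W y -> cimg c y.
Hypothesis WU' : forall y, W y -> cimg c' (F y).
Hypothesis sF : smooth_on W F.
Hypothesis s2 : s * s = 1.
Hypothesis hol : forall y v, W y ->
  dder F y (v *m endo c y) = s *: (dder F y v *m endo c' (F y)).
Implicit Types (x y u v w : 'rV[R]_a).

Local Notation B := (sff c c' F).
Local Notation dF := (dder F).

Lemma sff_sym x u w : W x -> B x u w = B x w u.
Proof.
move=> Wx; rewrite !sff.unlock (dder_schwarz u w Wo Wx sF).
by rewrite (Gamma_sym Hc _ _ (WU Wx)) (Gamma_sym Hc' _ _ (WU' Wx)).
Qed.

Lemma sff_linear x u : W x -> linear (B x u).
Proof.
move=> Wx k w w'; rewrite !sff.unlock.
have dFx := smooth_differentiable sF Wx.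
have D2 : dder (fun y => dF y (k *: w + w')) x u =
    k *: dder (fun y => dF y w) x u + dder (fun y => dF y w') x u.
  rewrite (dder_schwarz _ _ Wo Wx sF) dder_linear; last first.
    exact (smooth_differentiable (dder_smooth u Wo sF) Wx).
  by congr (_ *: _ + _); exact (dder_schwarz _ _ Wo Wx sF).
rewrite D2 (dder_linear dFx) (Gamma_linear Hc' _ (WU' Wx)).
rewrite (Gamma_linear Hc _ (WU Wx)) (dder_linear dFx); vring.
Qed.

Lemma sff_linearl x w : W x -> linear (B x ^~ w).
Proof. by move=> Wx k u v; rewrite !(sff_sym _ w Wx); exact: sff_linear. Qed.

(** The covariant derivative along u of f_* phi = s psi f_* at v: Leibniz differentiates f_* into B
    on each side, and phi and psi into their covariant derivatives. *)
Lemma sff_endo x u v : W x ->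
  B x u (v *m endo c x) + dF x (cov_endo c x u v) =
  s *: (B x u v *m endo c' (F x) + cov_endo c' (F x) (dF x u) (dF x v)).
Proof.
move=> Wx; have dFx := smooth_differentiable sF Wx.
have dp := phi_cst_differentiable Hc v (WU Wx).
have dp0 := endo_differentiable Hc (WU Wx).
have dp' := endo_differentiable Hc' (WU' Wx).
have dFv := smooth_differentiable (dder_smooth v Wo sF) Wx.
have dp'F : differentiable (fun y => endo c' (F y)) x.
  exact: (differentiable_comp dFx dp').
have dR : differentiable (fun y => dF y v *m endo c' (F y)) x.
  exact: differentiable_mulmx dFv dp'F.
have E : dder (fun y => dF y (v *m endo c y)) x u =
    dder (fun y => s *: (dF y v *m endo c' (F y))) x u.
  by apply: (dder_eq_on u Wo Wx) => y Wy; exact: hol.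
move: E; rewrite (dder_along Wo sF u Wx dp) (dder_mulmxl v u dp0).
rewrite (dder_scale _ (differentiable_const s x) dR) dder_cst scale0r add0r.
rewrite (dder_mulmx _ dFv dp'F) (dder_comp _ dFx dp') /phi /cst => E.
have {}E : dder (fun y => dF y (v *m endo c x)) x u =
  s *: (dder (fun y => dF y v) x u *m endo c' (F x) +
     dF x v *m dder (endo c') (F x) (dF x u)) - dF x (v *m dder (endo c) x u).
  by rewrite -E addrK.
rewrite !sff.unlock !cov_endo.unlock E !dder_dirD// dder_dirN// !hol//.
have Gs k z : Gamma c' (F x) (dF x u) (k *: z) = k *: Gamma c' (F x) (dF x u) z.
  have L := Gamma_linear Hc' (dF x u) (WU' Wx).
  by have := L k z 0; rewrite (linear_map0 L) !addr0.
rewrite Gs !mulmxDl mulNmx; vring.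
Qed.

(* Differentiate f_* phi = s psi f_* along phi v and along v; the terms
   B(v, phi v) cancel by symmetry of B. *)
Lemma sff_pair x v : W x -> v *m endo c x *m endo c x = - v ->
  B x v v + B x (v *m endo c x) (v *m endo c x) =
  skew_cov c' (F x) (dF x v) - dF x (skew_cov c x v).
Proof.
move=> Wx v2; have dFx := smooth_differentiable sF Wx.
have E1 := sff_endo (v *m endo c x) v Wx.
have := sff_endo v (v *m endo c x) Wx.
rewrite v2 -[- v]scaleN1r -[-1 *: v]addr0 (sff_linear _ Wx).
rewrite (linear_map0 (sff_linear _ Wx)) addr0 scaleN1r => E2.
rewrite [B x (v *m _) v](sff_sym _ _ Wx) in E1.
rewrite !hol// in E1 E2.
set w := dF x v in E1 E2 *.
have l1 := cov_endo_linear Hc' w (WU' Wx).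
have l2 := cov_endo_linearl Hc' w (WU' Wx).
have E3 : cov_endo c' (F x) w (s *: (w *m endo c' (F x))) =
    s *: cov_endo c' (F x) w (w *m endo c' (F x)).
  by have := l1 s (w *m endo c' (F x)) 0; rewrite (linear_map0 l1) !addr0.
have E4 : cov_endo c' (F x) (s *: (w *m endo c' (F x))) w =
    s *: cov_endo c' (F x) (w *m endo c' (F x)) w.
  by have := l2 s (w *m endo c' (F x)) 0; rewrite (linear_map0 l2) !addr0.
rewrite E3 in E2; rewrite E4 in E1; rewrite !scalerDr !scalerA s2 !scale1r in
  E1 E2.
have e1 : B x (v *m endo c x) (v *m endo c x) =
    s *: (B x v (v *m endo c x) *m endo c' (F x))
    + cov_endo c' (F x) (w *m endo c' (F x)) w
    - dF x (cov_endo c x (v *m endo c x) v) by rewrite -E1 addrK.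
have e2 : B x v v = dF x (cov_endo c x v (v *m endo c x))
    - (s *: (B x v (v *m endo c x) *m endo c' (F x))
    + cov_endo c' (F x) w (w *m endo c' (F x))) by rewrite -E2; vring.
rewrite e1 e2 /skew_cov dder_dirD// dder_dirN//; vring.
Qed.

End Holomorphic.

(** * The dilation of a holomorphic map between contact manifolds *)

Section ContactMap.
Variables (R : realType) (m n : nat) (M : almost_contact R m) (N :
  almost_contact R n).
Variables (c : chart R M m.*2.+1) (c' : chart R N n.*2.+1).
Hypotheses (Hc : atlas c) (Hc' : atlas c').
Variables (W : set 'rV[R]_(m.*2.+1)) (F : 'rV[R]_(m.*2.+1) -> 'rV[R]_(n.*2.+1)).
Variable s : R.
Hypothesis Wo : open W.
Hypothesis WU : forall y, W y -> cimg c y.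
Hypothesis WU' : forall y, W y -> cimg c' (F y).
Hypothesis sF : smooth_on W F.
Hypothesis s2 : s * s = 1.
Hypothesis hol : forall y v, W y ->
  dder F y (v *m endo c y) = s *: (dder F y v *m endo c' (F y)).
Let S := contact_compatible Hc.
Let S' := contact_compatible Hc'.
Local Notation dF := (dder F).
Implicit Types (x y u v w : 'rV[R]_(m.*2.+1)).

(* The function k such that f_* xi = k gamma and f^* sigma = k eta. *)
Definition dilation y := ev (eta c' (F y)) (dF y (xi c y)).
Local Notation k := dilation.

Let s0 : s != 0.
Proof. by apply/eqP => s0; move: s2; rewrite s0 mul0r => /esym/eqP;
  rewrite oner_eq0. Qed.

(** Since phi xi = 0, f_* xi lies in the kernel of psi, which is spanned by gamma. *)
Lemma dder_xi y : W y -> dF y (xi c y) = k y *: xi c' (F y).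
Proof.
move=> Wy; have dFy := smooth_differentiable sF Wy.
have := hol (xi c y) Wy; rewrite (xi_endo S (WU Wy)) (linear_map0 (dder_linear
  dFy)).
move=> /esym/eqP; rewrite scaler_eq0 (negbTE s0) => /eqP E.
have := endo_sqr S' (dF y (xi c y)) (WU' Wy); rewrite E mul0mx => /esym/eqP.
by rewrite addrC subr_eq0 => /eqP.
Qed.

(** Split v = - phi^2 v + eta(v) xi: by holomorphy f_* sends the first part into the image of psi,
    where sigma vanishes. *)
Lemma pullback_eta y v : W y -> ev (eta c' (F y)) (dF y v) =
  k y * ev (eta c y) v.
Proof.
move=> Wy; have dFy := smooth_differentiable sF Wy.
have -> : v = - (v *m endo c y *m endo c y) + ev (eta c y) v *: xi c y.
  by rewrite (endo_sqr S _ (WU Wy)); vring.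
rewrite dder_dirD// dder_dirN// dder_dirZ// dder_xi// hol//.
rewrite evD evN !evZ (eta_endo S' _ (WU' Wy)) evD evN evZ (eta_endo S _ (WU
  Wy)).
rewrite (ev_xi Hc (WU Wy)) (ev_xi Hc' (WU' Wy)); ring.
Qed.

Lemma dilation_smooth : smooth_on W k.
Proof.
have sxi : smooth_on W (xi c).
  exact: smooth_subset WU (xi_sm S).
have seta : smooth_on W (fun y => eta c' (F y)).
  exact: (smooth_comp Wo WU' sF (open_cimg (c:=c')) (eta_sm S')).
have := smooth_mulmx Wo (dder_along_smooth Wo sF sxi) seta.
by move=> /(smooth_mxP Wo) /(_ 0 0).
Qed.

Hypothesis etaM : forall y v, W y -> deta (eta c) y (xi c y) v = 0.
Hypothesis etaN : forall y (v : 'rV[R]_(n.*2.+1)),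
  W y -> deta (eta c') (F y) (xi c' (F y)) v = 0.

(** This is f^* d sigma = d(k eta) = dk /\ eta + k d eta, up to the normalization; symmetry of the
    second derivatives of F removes them. *)
Lemma pullback_deta y u v : W y -> deta (eta c') (F y) (dF y u) (dF y v) =
  dder k y u * ev (eta c y) v - dder k y v * ev (eta c y) u
  + k y * deta (eta c) y u v.
Proof.
move=> Wy; have dFy := smooth_differentiable sF Wy.
have dk := smooth_differentiable dilation_smooth Wy.
have de := eta_differentiable Hc (WU Wy).
have de' := eta_differentiable Hc' (WU' Wy).
have de'F : differentiable (fun y => eta c' (F y)) y.
  exact: (differentiable_comp dFy de').
have E t r : ev (eta c' (F y)) (dder (fun y => dF y t) y r)
    + ev (dder (eta c') (F y) (dF y r)) (dF y t) =
    k y * ev (dder (eta c) y r) t + ev (eta c y) t * dder k y r.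
  have dFt := smooth_differentiable (dder_smooth t Wo sF) Wy.
  rewrite -(dder_comp _ dFy de') -(dder_ev _ de'F dFt).
  rewrite (dder_eq_on (g := fun y => k y * ev (eta c y) t) r Wo Wy); last first.
    by move=> z Wz; exact: pullback_eta.
  have det := differentiable_ev de (differentiable_const t y).
  rewrite (dderM r dk det) (dder_ev r de (differentiable_const t y)) dder_cst.
  by rewrite ev0 add0r.
have := E u v; have := E v u; rewrite (dder_schwarz u v Wo Wy sF) /deta; lra.
Qed.

Lemma dilation_vertical y v : W y -> dder k y v =
  dder k y (xi c y) * ev (eta c y) v.
Proof.
move=> Wy; have := pullback_deta (xi c y) v Wy.
rewrite etaM// (ev_xi Hc (WU Wy)) mulr0 addr0 mulr1 dder_xi//.
have -> : deta (eta c') (F y) (k y *: xi c' (F y)) (dF y v) = 0.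
  have H := etaN (dF y v) Wy.
  rewrite /deta evZ dder_dirZ; last exact: (eta_differentiable Hc' (WU' Wy)).
  by rewrite evZm -mulrBr -/(deta _ _ _ _) H mulr0.
lra.
Qed.

(* dk = kappa eta gives 0 = ddk = d kappa /\ eta + kappa d eta; evaluating on
   horizontal vectors avoids differentiating kappa. *)
Lemma dilation_critical x e f v : W x -> ev (eta c x) e = 0 ->
  ev (eta c x) f = 0 ->
  deta (eta c) x e f != 0 -> dder k x v = 0.
Proof.
move=> Wx e0 f0 ef0; set X := xi c x.
have de := eta_differentiable Hc (WU Wx).
have sk := dilation_smooth.
have dDk t := smooth_differentiable (dder_smooth t Wo sk) Wx.
have dev t := differentiable_ev de (differentiable_const t x).
have dk0 t : ev (eta c x) t = 0 -> dder k x t = 0.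
  by move=> t0; rewrite dilation_vertical// t0 mulr0.
have E t r : ev (eta c x) t = 0 -> ev (eta c x) r = 0 ->
    dder (fun y => dder k y t) x r = dder k x X * ev (dder (eta c) x r) t.
  move=> t0 r0.
  have H : dder (fun y => dder k y t * ev (eta c y) X) x r =
      dder (fun y => dder k y X * ev (eta c y) t) x r.
    apply: (dder_eq_on r Wo Wx) => y Wy.
    rewrite (dilation_vertical t Wy) (dilation_vertical X Wy); ring.
  move: H; rewrite (dderM _ (dDk t) (dev X)) (dderM _ (dDk X) (dev t)).
  rewrite !(dder_ev _ de (differentiable_const _ x)) !dder_cst !ev0 !add0r.
  by rewrite t0 mul0r addr0 dk0// mul0r add0r (ev_xi Hc (WU Wx)) mul1r.
have := E e f e0 f0; have := E f e f0 e0.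
have Sk : dder (fun y => dder k y e) x f = dder (fun y => dder k y f) x e.
  exact: (dder_schwarz_scalar e f Wo Wx sk).
rewrite Sk => -> H; have {H} : dder k x X * deta (eta c) x e f = 0.
  by rewrite /deta mulrBr H subrr.
move=> /eqP; rewrite mulf_eq0 (negbTE ef0) orbF => /eqP kX.
by rewrite dilation_vertical// -/X kX mul0r.
Qed.

Hypothesis covN : forall y, W y -> cov_vec c' (xi c') (F y) (xi c' (F y)) = 0.
Hypothesis covM : forall y, W y -> cov_vec c (xi c) y (xi c y) = 0.

(** B(xi, xi) = nabla_xi (k gamma) - f_*(nabla_xi xi), and nabla_xi (k gamma) = xi(k) gamma + k^2
    nabla_gamma gamma; each of these terms vanishes. *)
Lemma sff_xi x : W x -> dder k x (xi c x) = 0 ->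
  sff c c' F x (xi c x) (xi c x) = 0.
Proof.
move=> Wx k0; set X := xi c x; set X' := xi c' (F x).
have dFx := smooth_differentiable sF Wx.
have dxi := xi_differentiable Hc (WU Wx).
have dxi' := xi_differentiable Hc' (WU' Wx).
have dk := smooth_differentiable dilation_smooth Wx.
have dxiF : differentiable (fun y => xi c' (F y)) x.
  exact: (differentiable_comp dFx dxi').
have E : dder (fun y => dF y (xi c y)) x X =
  dder (fun y => k y *: xi c' (F y)) x X.
  by apply: (dder_eq_on X Wo Wx) => y Wy; exact: dder_xi.
move: E; rewrite (dder_along Wo sF X Wx dxi) (dder_scale _ dk dxiF) k0 scale0r.
rewrite add0r (dder_comp _ dFx dxi') dder_xi// -/X -/X' dder_dirZ// => E.
have {}E : dder (fun y => dF y X) x X =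
    k x *: (k x *: dder (xi c') (F x) X') - dF x (dder (xi c) x X).
  by rewrite -E addrK.
have GZ (r : R) z z' : Gamma c' (F x) (r *: z) z' = r *: Gamma c' (F x) z z'.
  have L := Gamma_linearl Hc' z' (WU' Wx).
  by have := L r z 0; rewrite (linear_map0 L) !addr0.
have GZr (r : R) z z' : Gamma c' (F x) z (r *: z') = r *: Gamma c' (F x) z z'.
  by rewrite (Gamma_sym Hc' _ _ (WU' Wx)) GZ (Gamma_sym Hc' z _ (WU' Wx)).
rewrite sff.unlock E dder_xi// -/X' GZ GZr.
have := covN Wx; rewrite cov_vec.unlock -/X' => /eqP;
  rewrite addr_eq0 => /eqP ->.
have := covM Wx; rewrite cov_vec.unlock -/X => /eqP;
  rewrite addr_eq0 => /eqP ->.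
rewrite dder_dirN//; vring.
Qed.

End ContactMap.

Lemma bilin_rows (R : realType) d k l (g : 'M[R]_d) (A : 'M[R]_(k, d))
    (B : 'M[R]_(l, d)) i j :
  bilin g (row i A) (row j B) = (A *m g *m B^T) i j.
Proof.
rewrite /bilin -row_mul [LHS]mxE [RHS]mxE; apply: eq_bigr => k' _.
by rewrite mxE [(row j B)^T _ _]mxE [row j B _ _]mxE [B^T _ _]mxE.
Qed.

(** * Adapted bases of the tangent spaces *)

Section PointFrames.
Variables (R : realType) (d : nat) (M : riem_endo R d) (c : chart R M d).
Variables (xi : 'rV[R]_d -> 'rV[R]_d) (eta : 'rV[R]_d -> 'cV[R]_d) (e : R).
Hypothesis Hc : atlas c.
Hypothesis S : compatible c xi eta e.
Variable x : 'rV[R]_d.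
Hypothesis Ux : cimg c x.
Local Notation g := (metric c x).
Local Notation p := (endo c x).

Lemma compatible_skew_mx : p *m g = - (g *m p^T).
Proof.
apply: bilin_matrixP => v w; have := endo_skew S v w Ux; rewrite /bilin.
by rewrite trmx_mul mulmxN mulNmx !mulmxA => ->; rewrite [RHS]mxE.
Qed.

(* X is the matrix with row xi(x), or the empty matrix in the Hermitian case. *)
Lemma adapted_frame m r (X : 'M[R]_(r, d)) : (r + m.*2 = d)%N ->
  (forall v : 'rV[R]_d, v *m g *m X^T = 0 -> ev (eta x) v = 0) ->
  p *m g *m X^T = 0 -> X *m g *m X^T = 1%:M ->
  exists A : 'M[R]_(m, d),
  [/\ A *m g *m A^T = 1%:M, A *m g *m (A *m p)^T = 0, A *m g *m X^T = 0,
    A *m p *m g *m (A *m p)^T = 1%:M &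
    invmx g = X^T *m X + (A^T *m A + (A *m p)^T *m (A *m p))].
Proof.
move=> rd Xeta pX XX.
have gT := metric_trmx Hc Ux; have gpos := metric_posdef Hc Ux.
have sk := compatible_skew_mx.
have sqr (v : 'rV[R]_d) : v *m g *m X^T = 0 -> v *m p *m p = - v.
  by move=> /Xeta v0; rewrite (endo_sqr S _ Ux) v0 scale0r addr0.
have [A [AA ApA AX]] := exists_frame X gT gpos sk rd.
exists A; split=> //; last exact: (frame_invmx gT gpos sk sqr pX XX rd).
by rewrite (skew_form_p sk sqr).
Qed.

End PointFrames.

Section ContactFrame.
Variables (R : realType) (m : nat) (M : almost_contact R m).
Variable c : chart R M m.*2.+1.
Hypothesis Hc : atlas c.
Variable x : 'rV[R]_(m.*2.+1).
Hypothesis Ux : cimg c x.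
Let S := contact_compatible Hc.
Local Notation g := (metric c x).
Local Notation p := (endo c x).

Lemma contact_frame : exists A : 'M[R]_(m, m.*2.+1),
  [/\ adapted_basis c x (fun i => row i A),
    (forall i, ev (eta c x) (row i A) = 0) &
    invmx g = (xi c x)^T *m xi c x + (A^T *m A + (A *m p)^T *m (A *m p))].
Proof.
have bX v : v *m g *m (xi c x)^T = (ev (eta c x) v)%:M.
  by rewrite [LHS]mx11_scalar (eta_dual S _ Ux).
have X0 v : v *m g *m (xi c x)^T = 0 -> ev (eta c x) v = 0.
  by rewrite bX => /matrixP /(_ 0 0); rewrite !mxE mulr1n.
have pX : p *m g *m (xi c x)^T = 0.
  apply/row_matrixP => i; rewrite row0 !row_mul rowE bX (eta_endo S _ Ux).
  by apply/matrixP => j l; rewrite !mxE mul0rn.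
have XX : xi c x *m g *m (xi c x)^T = 1%:M by rewrite bX ev_xi.
have [A [AA ApA AX pAA gE]] := adapted_frame Hc S Ux (add1n m.*2) X0 pX XX.
have A0 i : ev (eta c x) (row i A) = 0.
  by apply: X0; rewrite -!row_mul AX row0.
exists A; split => //; split.
- move=> i j; rewrite bilin_rows AA -!row_mul bilin_rows pAA.
  by rewrite !mxE.
- by move=> i j; rewrite -row_mul bilin_rows ApA mxE.
- move=> i; rewrite -!(eta_dual S _ Ux) A0 (eta_endo S _ Ux).
  by [].
- exact: (xi_norm S Ux).
Qed.

End ContactFrame.

Section HermitianFrame.
Variables (R : realType) (n : nat) (H : almost_hermitian R n).
Variable c : chart R H n.*2.
Hypothesis Hc : atlas c.

Lemma hermitian_compatible : compatible c (fun=> 0) (fun=> 0) 0.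
Proof.
split => //.
- exact (smooth_cst (open_cimg (c:=c)) 0).
- exact (smooth_cst (open_cimg (c:=c)) 0).
- by move=> x v Ux; rewrite scaler0 addr0; exact: J_sqr.
- by move=> x _; rewrite mul0mx.
- by move=> x v _; rewrite ev0m.
- move=> x v w Ux; have := J_metric Hc Ux v (w *m endo c x).
  by rewrite J_sqr// bilinNr => <-; rewrite opprK.
- by move=> x v _; rewrite ev0m bilin0r.
- by move=> x _; rewrite bilin0r.
Qed.

Let S := hermitian_compatible.
Variable x : 'rV[R]_(n.*2).
Hypothesis Ux : cimg c x.
Local Notation g := (metric c x).
Local Notation p := (endo c x).

Lemma hermitian_frame : exists A : 'M[R]_(n, n.*2),
  hermitian_basis c x (fun i => row i A) /\
  invmx g = A^T *m A + (A *m p)^T *m (A *m p).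
Proof.
have [|||A [AA ApA _ pAA gE]] :=
  @adapted_frame _ _ _ _ _ _ _ Hc S _ Ux n 0 0 (add0n n.*2).
- by move=> v _; rewrite ev0m.
- by rewrite trmx0 mulmx0.
- by rewrite !mul0mx; apply/matrixP => -[].
exists A; split; last by rewrite gE mulmx0 add0r.
split=> i j; last by rewrite -row_mul bilin_rows ApA mxE.
by rewrite bilin_rows AA -!row_mul bilin_rows pAA !mxE.
Qed.

(** With eta = 0 every vector counts as horizontal, so the criteria of the contact case apply; the
    nearly Kaehler condition is polarized first. *)
Lemma class_C1_skew v : class_C1 H -> skew_cov c x v = 0.
Proof.
have sm (w : 'rV[R]_n.*2) : smooth_on (cimg c) (cst w).
  exact (smooth_cst (open_cimg (c:=c)) w).
have v0 : ev (0 : 'cV[R]_n.*2) v = 0 by rewrite ev0m.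
have cN v' w : cov_endo c x v' w = nabla_phi c (cst v') (cst w) x.
  by rewrite (nabla_phiE Hc _ Ux (differentiable_const w x)).
case=> [K|K|K|K].
- by rewrite /skew_cov !cN !(K c Hc _ (sm _) x Ux _ (sm _)) subrr.
- have K0 w : cov_endo c x w w = 0 by rewrite cN; exact: (K c Hc _ (sm w) x Ux).
  apply: (skew_cov_nearly Hc S Ux v0); rewrite ?K0 ?mul0mx//; last first.
    have -> : cov_vec c (fun=> 0) x v = 0.
      rewrite cov_vec.unlock dder_cst.
      by rewrite (linear_map0 (Gamma_linear Hc _ Ux)) addr0.
    exact: bilin0r.
  have l1 w := cov_endo_linear Hc w Ux; have l2 w := cov_endo_linearl Hc w Ux.
  have := K0 (1 *: (v *m p) + v); rewrite l1 !l2.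
  by rewrite !K0 !scale1r add0r addr0 => /eqP; rewrite addrC addr_eq0 => /eqP.
- apply: (skew_cov_closed Hc S Ux _ v0).
  apply: (ext_d2_Omega_closed Hc _ Ux) => [y u w Uy|u w z].
    exact (endo_skew S _ _ Uy).
  exact (K c Hc _ (sm u) x Ux _ (sm w) _ (sm z)).
- by rewrite -(tS_cst Hc)//; exact (K c Hc _ (sm v) x Ux).
Qed.

End HermitianFrame.

Section MapDomain.
Variables (R : realType) (a b : nat) (M : manifold R a) (N : manifold R b).
Variables (f : M -> N) (c : chart R M a) (c' : chart R N b).

Definition map_dom : set 'rV[R]_a := cmap c @` (cdom c `&` f @^-1` cdom c').

Lemma map_dom_open : continuous f -> open map_dom.
Proof.
move=> cf; rewrite openE => y [p [cp c'p] <-]; rewrite /interior.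
have Uy : cimg c (cmap c p) by exists p.
have n1 : nbhs (cmap c p) (cimg c) by exact: open_nbhs_nbhs (conj (open_cimg
  (c:=c)) Uy).
have n2 : nbhs (cmap c p) (fun y => cdom c' (f (cinv c y))).
  have : nbhs (cinv c (cmap c p)) (f @^-1` cdom c').
    rewrite (cmapK cp); apply: (cf p).
    exact: open_nbhs_nbhs (conj (cdom_open c') c'p).
  exact: (cinv_continuous Uy).
apply: filterS2 n1 n2 => z [q cq <-]; rewrite (cmapK cq) => c'q.
by exists q.
Qed.

Lemma map_dom_cimg y : map_dom y -> cimg c y.
Proof. by move=> [p [cp _] <-]; exists p. Qed.

Lemma map_dom_target y : map_dom y -> cimg c' (local_rep f c c' y).
Proof.
by move=> [p [cp c'p] <-]; exists (f p); rewrite // /local_rep /= (cmapK cp).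
Qed.

End MapDomain.

Lemma holomorphic_sign (R : realType) a b (M : riem_endo R a) (N : riem_endo R
  b)
    (f : M -> N) : pm_holomorphic f -> exists2 s : R, s * s = 1 &
  forall c c', atlas c -> atlas c' -> forall y v, map_dom f c c' y ->
    dder (local_rep f c c') y (v *m endo c y) =
    s *: (dder (local_rep f c c') y v *m endo c' (local_rep f c c' y)).
Proof.
move=> [s hol]; exists ((-1) ^+ s); first by case: s {hol};
  rewrite /= ?expr1 ?expr0; ring.
move=> c c' Hc Hc' y v [p [cp c'p] <-]; rewrite -!dderE.
exact: hol.
Qed.

Section Tension.
Variables (R : realType) (a b : nat) (M : riemannian R a) (N : riemannian R b).
Variables (f : M -> N) (c : chart R M a) (c' : chart R N b).

Lemma second_fundamental_formE x v w :
  second_fundamental_form f c c' x v w = sff c c' (local_rep f c c') x v w.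
Proof.
rewrite /second_fundamental_form sff.unlock /nabla.
have -> : (fun y => 'D_w (local_rep f c c') y) =
    (fun y => dder (local_rep f c c') y w).
  by apply/funext => y; rewrite dderE.
by rewrite !dderE !GammaE dder_cst add0r.
Qed.

Lemma tensionE x :
  tension f c c' x = contraction (sff c c' (local_rep f c c') x) (invmx (metric
    c x)).
Proof.
apply: eq_bigr => i _; apply: eq_bigr => j _.
by rewrite second_fundamental_formE.
Qed.

End Tension.

(** * Nearly alpha-contact sources *)

Section A5.
Variables (R : realType) (m : nat) (M : almost_contact R m) (alpha : R).
Hypothesis a0 : alpha != 0.
Hypothesis A5 : for_fields2 (M := M) (fun c X Y x =>
    2 * alpha * Omega c X Y x =
    d_eta c X Y x + d_eta c (phi c X) (phi c Y) x).
Variable c : chart R M m.*2.+1.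
Hypothesis Hc : atlas c.
Variable x : 'rV[R]_(m.*2.+1).
Hypothesis Ux : cimg c x.
Let S := contact_compatible Hc.
Local Notation g := (metric c x).
Local Notation p := (endo c x).
Local Notation evx := (ev (eta c x)).

(** The factor 4 arises because [deta] is twice [d_eta]. *)
Lemma A5_deta v w : 4 * alpha * fform c v w x =
  deta (eta c) x v w + deta (eta c) x (v *m p) (w *m p).
Proof.
have := A5 Hc (smooth_const_field c v) Ux (smooth_const_field c w).
rewrite (d_etaE Hc Ux (differentiable_const v x) (differentiable_const w x)).
rewrite (d_etaE Hc Ux (phi_cst_differentiable Hc v Ux) (phi_cst_differentiable
  Hc w Ux)).
rewrite /Omega /gdot /phi /cst /fform; lra.
Qed.

Lemma deta0r v : deta (eta c) x v 0 = 0.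
Proof.
rewrite /deta ev0 (linear_map0 (dder_linear (eta_differentiable Hc Ux))).
by rewrite ev0m subrr.
Qed.

Lemma detaC v w : deta (eta c) x v w = - deta (eta c) x w v.
Proof. by rewrite /deta opprB. Qed.

(** Put xi in the second slot of the A5 identity: since phi xi = 0, both Omega(v, xi) and d eta(phi
    v, phi xi) vanish. *)
Lemma A5_deta_xi v : deta (eta c) x (xi c x) v = 0.
Proof.
have := A5_deta v (xi c x); rewrite /fform (xi_endo S Ux) bilin0r mulr0 deta0r.
by rewrite addr0 => E; rewrite detaC -E oppr0.
Qed.

Lemma detaNr v w : deta (eta c) x v (- w) = - deta (eta c) x v w.
Proof.
rewrite /deta evN dder_dirN; last exact: (eta_differentiable Hc Ux).
rewrite evNm; ring.
Qed.

(** At (v, phi v) the two terms of the A5 identity coincide because phi^2 v = - v, and Omega(v, phi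
    v) = - |v|^2. *)
Lemma A5_deta_endo v : evx v = 0 ->
  deta (eta c) x v (v *m p) = - (2 * alpha * bilin g v v).
Proof.
move=> v0; have := A5_deta v (v *m p).
have -> : v *m p *m p = - v by rewrite (endo_sqr S _ Ux) v0 scale0r addr0.
rewrite detaNr (detaC (v *m p)) /fform.
have -> : v *m p *m p = - v by rewrite (endo_sqr S _ Ux) v0 scale0r addr0.
by rewrite bilinNr; lra.
Qed.

Lemma A5_cov_xi : cov_vec c (xi c) x (xi c x) = 0.
Proof. by apply: (cov_xi_xi0_deta Hc Ux) => v; exact: A5_deta_xi. Qed.

(** A unit vector e orthogonal to xi exists because 0 < m; then (e, phi e) works. In dimension one
    there is no such vector, A5 is vacuous and k need not be constant. *)
Lemma A5_noncritical : (0 < m)%N -> exists e f : 'rV[R]_m.*2.+1,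
  [/\ evx e = 0, evx f = 0 & deta (eta c) x e f != 0].
Proof.
move=> m0; have [A [[AA _ _ _] A0 _]] := contact_frame Hc Ux.
exists (row (Ordinal m0) A), (row (Ordinal m0) A *m p).
rewrite A0 (eta_endo S _ Ux) A5_deta_endo//; split => //.
have [-> _] := AA (Ordinal m0) (Ordinal m0).
by rewrite eqxx mulr1 oppr_eq0 mulf_neq0// pnatr_eq0.
Qed.

End A5.

Section TensionContact.
Variables (R : realType) (m b : nat) (M : almost_contact R m) (N : riem_endo R
  b).
Variables (f : M -> N) (c : chart R M m.*2.+1) (c' : chart R N b).
Hypotheses (Hc : atlas c) (Hc' : atlas c').
Hypothesis sf : smooth_map f.
Variable s : R.
Hypothesis s2 : s * s = 1.
Local Notation W := (map_dom f c c').
Local Notation F := (local_rep f c c').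
Hypothesis hol : forall y v, W y ->
  dder F y (v *m endo c y) = s *: (dder F y v *m endo c' (F y)).

Lemma local_rep_smooth : smooth_on W F.
Proof. by case: sf => _; apply. Qed.

Lemma smooth_map_dom_open : open W.
Proof. by apply: map_dom_open; case: sf. Qed.

Variable x : 'rV[R]_(m.*2.+1).
Hypothesis Wx : W x.
Let Ux := map_dom_cimg Wx.
Let S := contact_compatible Hc.

Lemma tension_trace (A : 'M[R]_(m, m.*2.+1)) : semi_symplectic M ->
  adapted_basis c x (fun i => row i A) -> (forall i,
    ev (eta c x) (row i A) = 0) ->
  invmx (metric c x) = (xi c x)^T *m xi c x
    + (A^T *m A + (A *m endo c x)^T *m (A *m endo c x)) ->
  tension f c c' x = sff c c' F x (xi c x) (xi c x)
    + \sum_i skew_cov c' (F x) (dder F x (row i A)).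
Proof.
move=> ss Ab A0 gE.
have sF := local_rep_smooth; have Wo := smooth_map_dom_open.
have WU := @map_dom_cimg _ _ _ _ _ f c c';
  have WU' := @map_dom_target _ _ _ _ _ f c c'.
have bl w := sff_linearl Hc Hc' Wo WU WU' sF w Wx.
have br u := sff_linear Hc Hc' Wo WU WU' sF u Wx.
have dF := smooth_differentiable sF Wx.
rewrite tensionE gE !contractionD !(contraction_gram bl br) big_ord1 row_id.
congr (_ + _); rewrite -big_split /=.
have tr0 : \sum_i skew_cov c x (row i A) = 0.
  apply: etrans (ss c Hc x Ux _ Ab); apply: eq_bigr => i _; symmetry.
  exact: tS_cst.
(* Semi-symplecticity enters here: subtracting f_* of the vanishing trace of S^M produces the second
   half of [sff_pair], term by term. *)
rewrite -[RHS]subr0 -[X in _ - X](linear_map0 (dder_linear dF)) -tr0.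
pose L : {linear _ -> _} := HB.pack (dder F x)
  (GRing.isLinear.Build _ _ _ _ _ (dder_linear dF)).
rewrite -[dder F x (\sum_i _)]/(L _) linear_sum -sumrB; apply: eq_bigr => i _.
rewrite row_mul (sff_pair Hc Hc' Wo WU WU' sF s2 hol Wx)//.
by rewrite (endo_sqr S _ Ux) A0 scale0r addr0.
Qed.

Lemma tension_skew : semi_symplectic M ->
  sff c c' F x (xi c x) (xi c x) = 0 ->
  (forall v, ev (eta c x) v = 0 -> skew_cov c' (F x) (dder F x v) = 0) ->
  tension f c c' x = 0.
Proof.
move=> ss s0 sk; have [A [Ab A0 gE]] := contact_frame Hc Ux.
rewrite (tension_trace ss Ab A0 gE) s0 add0r big1// => i _.
exact: sk.
Qed.

End TensionContact.

(** * Targets *)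

Section Classes.
Variables (R : realType) (n : nat) (N : almost_contact R n).
Variable c : chart R N n.*2.+1.
Hypothesis Hc : atlas c.
Variable x : 'rV[R]_(n.*2.+1).
Hypothesis Ux : cimg c x.

Lemma class_A1_balanced : class_A1 N -> balanced_at c x.
Proof.
case=> [[al a0 E]|E|E|[[E _]|[[al a0 E] _]]].
- exact: d_eta_eq_balanced a0 E.
- exact: quasi_contact_balanced.
- exact: (@quasi_K_sasakian_balanced _ _ _ _ Hc _ Ux 2).
- exact: d_eta_eq_balanced (oner_neq0 _) E.
- exact: d_eta_eq_balanced a0 E.
Qed.

Lemma class_A4_balanced : class_A4 N -> balanced_at c x.
Proof. by case=> nN O _; exact: normal_closed_balanced. Qed.

Let cN v w : nabla_phi c (cst v) (cst w) x = cov_endo c x v w.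
Proof. exact: (nabla_phiE Hc _ Ux (differentiable_const w x)). Qed.

Lemma class_A6_balanced : class_A6 N -> balanced_at c x.
Proof.
case=> al a0 E; apply: (nearly_balanced Hc Ux (a := al)) => v w.
have := E c Hc _ (smooth_const_field c v) x Ux _ (smooth_const_field c w).
by rewrite /tQ !cN.
Qed.

Lemma nearly_cosymplectic_balanced : nearly_cosymplectic N -> balanced_at c x.
Proof.
move=> E; apply: (nearly_balanced Hc Ux (a := 0)) => v w; rewrite scale0r.
have K0 u : cov_endo c x u u = 0.
  by rewrite -cN; exact: (E c Hc _ (smooth_const_field c u) x Ux).
have l1 u := cov_endo_linear Hc u Ux; have l2 u := cov_endo_linearl Hc u Ux.
by have := K0 (1 *: v + w); rewrite l1 !l2 !K0 !scale1r add0r addr0 addrC.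
Qed.

Lemma class_B1_balanced : class_B1 N -> balanced_at c x.
Proof.
case=> [[E O _]|E|E|[E|E]].
- exact: almost_cosymplectic_balanced.
- exact: almost_cosymplectic_balanced.
- exact: nearly_cosymplectic_balanced.
- apply: nearly_cosymplectic_balanced => c0 Hc0 X sX y Uy.
  by case: (E c0 Hc0 X sX y Uy).
- apply: (@quasi_K_sasakian_balanced _ _ _ _ Hc _ Ux 0) => c0 Hc0 X sX y Uy Y
  sY.
  by rewrite !mul0r !scale0r subrr add0r; exact: E.
Qed.

End Classes.

Section ContactTarget.
Variables (R : realType) (m n : nat) (M : almost_contact R m) (N :
  almost_contact R n).
Hypothesis m0 : (0 < m)%N.
Variables (f : M -> N) (c : chart R M m.*2.+1) (c' : chart R N n.*2.+1).
Hypotheses (Hc : atlas c) (Hc' : atlas c').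
Hypothesis sf : smooth_map f.
Hypothesis ss : semi_symplectic M.
Variables (alpha s : R).
Hypothesis a0 : alpha != 0.
Hypothesis A5 : for_fields2 (M := M) (fun c X Y x =>
    2 * alpha * Omega c X Y x =
    d_eta c X Y x + d_eta c (phi c X) (phi c Y) x).
Hypothesis s2 : s * s = 1.
Local Notation W := (map_dom f c c').
Local Notation F := (local_rep f c c').
Hypothesis hol : forall y v, W y ->
  dder F y (v *m endo c y) = s *: (dder F y v *m endo c' (F y)).
Hypothesis covN : forall y, cimg c' y -> cov_vec c' (xi c') y (xi c' y) = 0.
Let sF := local_rep_smooth Hc Hc' sf.
Let Wo : open W := smooth_map_dom_open (c:=c) (c':=c') sf.
Let WU : forall y, W y -> cimg c y := @map_dom_cimg _ _ _ _ _ f c c'.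
Let WU' : forall y, W y -> cimg c' (F y) := @map_dom_target _ _ _ _ _ f c c'.
Local Notation k := (dilation c c' F).

Lemma target_etaN y (v : 'rV[R]_(n.*2.+1)) : W y ->
  deta (eta c') (F y) (xi c' (F y)) v = 0.
Proof. by move=> Wy; apply: (deta_xi0 Hc' (WU' Wy)); exact: covN (WU' Wy). Qed.

Lemma source_etaM y v : W y -> deta (eta c) y (xi c y) v = 0.
Proof. by move=> Wy; exact: (A5_deta_xi A5 Hc (WU Wy)). Qed.

Lemma dilation_constant y v : W y -> dder k y v = 0.
Proof.
move=> Wy; have [e [e' [e0 e'0 ee']]] := A5_noncritical a0 A5 Hc (WU Wy) m0.
exact: (dilation_critical Hc Hc' Wo WU WU' sF s2 hol source_etaM target_etaN v
  Wy e0 e'0 ee').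
Qed.

Lemma contact_target_tension x : W x ->
  (forall v, ev (eta c x) v = 0 -> skew_cov c' (F x) (dder F x v) = 0) ->
  tension f c c' x = 0.
Proof.
move=> Wx sk; apply: (tension_skew Hc Hc' sf s2 hol Wx ss) => //.
apply: (sff_xi Hc Hc' Wo WU WU' sF s2 hol) => //.
- by move=> y Wy; exact: covN (WU' Wy).
- by move=> y Wy; exact: (A5_cov_xi A5 Hc (WU Wy)).
- exact: dilation_constant.
Qed.

Lemma balanced_target_tension x : W x ->
  (forall y, cimg c' y -> balanced_at c' y) -> tension f c c' x = 0.
Proof.
move=> Wx bN; apply: contact_target_tension => // v v0.
have [sk _] := bN _ (WU' Wx); apply: sk.
by rewrite (pullback_eta Hc Hc' WU WU' sF s2 hol)// v0 mulr0.
Qed.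

End ContactTarget.

Lemma bilinZm (R : realType) d (k : R) (g : 'M[R]_d) v w :
  bilin (k *: g) v w = k * bilin g v w.
Proof. by rewrite /bilin -scalemxAr -scalemxAl mxE. Qed.

(** * Linear algebra of horizontal weak conformality *)

Section Conformal.
Variables (R : realType) (a b : nat) (g : 'M[R]_a) (h : 'M[R]_b).
Variables (D : 'M[R]_(a, b)) (lam : R).
Hypotheses (gT : g^T = g) (gpos : posdef g) (hpos : posdef h).

Definition orth_ker (v : 'rV[R]_a) := forall w, w *m D = 0 -> bilin g v w = 0.

Hypothesis conf : forall v w, orth_ker v -> orth_ker w ->
  bilin h (v *m D) (w *m D) = lam ^+ 2 * bilin g v w.
Hypothesis onto : 0 < lam -> forall u, exists2 v, orth_ker v & v *m D = u.

Let gu : g \in unitmx := posdef_unitmx gpos.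
(** The metric adjoint of [D], with the index of [u] lowered; its values are horizontal. *)
Let adj (u : 'rV[R]_b) := u *m D^T *m invmx g.

Lemma adj_bilin u w : bilin g (adj u) w = (u *m (w *m D)^T) 0 0.
Proof. by rewrite /bilin /adj mulmxKV// trmx_mul mulmxA. Qed.

Lemma adj_orth_ker u : orth_ker (adj u).
Proof. by move=> w wD; rewrite adj_bilin wD trmx0 mulmx0 mxE. Qed.

Lemma trmx0_rows (E : 'M[R]_(a, b)) : (forall u : 'rV[R]_b,
  u *m E^T = 0) -> E = 0.
Proof.
move=> E0; rewrite -[E]trmxK; apply/eqP; rewrite trmx_eq0; apply/eqP.
by apply/row_matrixP => i; rewrite rowE E0 row0.
Qed.

Lemma adj0 u : adj u = 0 -> u *m D^T = 0.
Proof. by move=> /(congr1 (mulmx^~ g)); rewrite /adj mulmxKV// mul0mx. Qed.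

(** For lam = 0 the horizontal vector [adj u] is mapped to 0. It is thus in the kernel and
    orthogonal to it, hence zero for every u. *)
Lemma conformal0 : lam = 0 -> D = 0.
Proof.
move=> l0; apply: trmx0_rows => u; apply: adj0.
have := conf (adj_orth_ker u) (adj_orth_ker u).
rewrite l0 expr0n mul0r => /(posdef_eq0 hpos) E.
by apply: (posdef_eq0 gpos); exact: (@adj_orth_ker u (adj u) E).
Qed.

(** The image under f_* of the inverse metric of the source. Conformality on the vectors [adj u]
    says K h K = lam^2 K for K = D^T g^-1 D, and K is invertible when lam > 0, so that K h =
    lam^2. *)
Lemma conformal_gram : 0 <= lam -> D^T *m invmx g *m D = lam ^+ 2 *: invmx h.
Proof.
rewrite le_eqVlt => /predU1P[/esym l0|l_gt0].
  by rewrite (conformal0 l0) mulmx0 l0 expr0n scale0r.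
have [K KE] : exists K, D^T *m invmx g *m D = K by eexists.
rewrite KE.
have KT : K^T = K by rewrite -KE !trmx_mul trmxK trmx_inv gT mulmxA.
have adjK (w : 'rV[R]_b) : adj w *m D = w *m K by rewrite /adj -KE !mulmxA.
have KhK : K *m h *m K = lam ^+ 2 *: K.
  apply: bilin_matrixP => u w.
  rewrite bilinZm.
  have -> : bilin K u w = bilin g (adj u) (adj w).
    by rewrite adj_bilin adjK /bilin trmx_mul KT mulmxA.
  rewrite -(conf (adj_orth_ker u) (adj_orth_ker w)) !adjK /bilin.
  by rewrite trmx_mul KT !mulmxA.
(* If u K = 0 then [adj u] has norm zero, so u annihilates the image of [D], which is the whole
   space. *)
have Ku : K \in unitmx.
  rewrite -row_free_unit -kermx_eq0; apply/eqP/row_matrixP => i; rewrite row0.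
  set u := row i _; have uK : u *m K = 0 by rewrite -row_mul mulmx_ker row0.
  have uD : u *m D^T = 0.
    apply: adj0; apply: (posdef_eq0 gpos); rewrite adj_bilin adjK uK.
    by rewrite trmx0 mulmx0 mxE.
  apply/rowP => j; have [v _ vD] := onto l_gt0 (delta_mx 0 j).
  rewrite mxE; have : u *m (delta_mx 0 j)^T = 0 :> 'M[R]_1.
    by rewrite -vD trmx_mul mulmxA uD mul0mx.
  by move=> /matrixP /(_ 0 0); rewrite trmx_delta -colE !mxE.
have : K *m h = (lam ^+ 2)%:M.
  have := congr1 (mulmx^~ (invmx K)) KhK.
  by rewrite mulmxK// -scalemxAl mulmxV// scalemx1.
move=> /(congr1 (mulmx^~ (invmx h))); rewrite mulmxK ?posdef_unitmx// => ->.
by rewrite mul_scalar_mx.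
Qed.

End Conformal.

Section ConformalMap.
Variables (R : realType) (a b : nat) (M : riemannian R a) (N : riemannian R b).
Variables (f : M -> N) (mu : M -> R) (c : chart R M a) (c' : chart R N b).
Hypotheses (Hc : atlas c) (Hc' : atlas c').
Hypothesis sf : smooth_map f.
Hypothesis hwc : at_points f (fun p c c' x =>
      let F := local_rep f c c' in
      (forall v w, horizontal f c c' x v -> horizontal f c c' x w ->
         bilin (metric c' (F x)) ('D_v F x) ('D_w F x) =
         mu p ^+ 2 * bilin (metric c x) v w) /\
      (0 < mu p -> forall u : 'rV[R]_b,
         exists2 v, horizontal f c c' x v & 'D_v F x = u)).
Local Notation W := (map_dom f c c').
Local Notation F := (local_rep f c c').
Variable y : 'rV[R]_a.
Hypothesis Wy : W y.
Local Notation lam := (mu (cinv c y)).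

Let sF : smooth_on W F.
Proof. by case: sf => _; apply. Qed.

Let DE v : 'D_v F y = v *m Jac F y.
Proof. by rewrite dderE (JacE sF). Qed.

Let horE v : orth_ker (metric c y) (Jac F y) v <-> horizontal f c c' y v.
Proof. by split=> hv w w0; apply: hv; rewrite ?DE// -DE. Qed.

Lemma conformal_at :
  (forall v w, orth_ker (metric c y) (Jac F y) v ->
    orth_ker (metric c y) (Jac F y) w ->
    bilin (metric c' (F y)) (v *m Jac F y) (w *m Jac F y) =
    lam ^+ 2 * bilin (metric c y) v w) /\
  (0 < lam -> forall u, exists2 v, orth_ker (metric c y) (Jac F y) v & v *m Jac
    F y = u).
Proof.
have [h1 h2] : (forall v w, horizontal f c c' y v -> horizontal f c c' y w ->
         bilin (metric c' (F y)) ('D_v F y) ('D_w F y) =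
         lam ^+ 2 * bilin (metric c y) v w) /\
      (0 < lam -> forall u : 'rV[R]_b,
         exists2 v, horizontal f c c' y v & 'D_v F y = u).
  move: Wy => [p [cp c'p] <-]; rewrite (cmapK cp); exact: hwc.
split=> [v w /horE hv /horE hw|l0 u]; first by rewrite -!DE h1.
by have [v /horE hv <-] := h2 l0 u; exists v; rewrite // DE.
Qed.

End ConformalMap.

(** * Semi-Sasakian targets *)

Section SemiSasakian.
Variables (R : realType) (m n : nat) (M : almost_contact R m) (N :
  almost_contact R n).
Hypothesis m0 : (0 < m)%N.
Variables (f : M -> N) (c : chart R M m.*2.+1) (c' : chart R N n.*2.+1).
Hypotheses (Hc : atlas c) (Hc' : atlas c').
Hypothesis sf : smooth_map f.
Hypothesis ss : semi_symplectic M.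
Variables (alpha s : R).
Hypothesis a0 : alpha != 0.
Hypothesis A5 : for_fields2 (M := M) (fun c X Y x =>
    2 * alpha * Omega c X Y x =
    d_eta c X Y x + d_eta c (phi c X) (phi c Y) x).
Hypothesis s2 : s * s = 1.
Local Notation W := (map_dom f c c').
Local Notation F := (local_rep f c c').
Hypothesis hol : forall y v, W y ->
  dder F y (v *m endo c y) = s *: (dder F y v *m endo c' (F y)).
Hypothesis nN : is_normal N.
Variable lam : 'rV[R]_(m.*2.+1) -> R.
Hypothesis lam_ge0 : forall y, 0 <= lam y.
Hypothesis conf : forall y, W y ->
  (forall v w, orth_ker (metric c y) (Jac F y) v ->
    orth_ker (metric c y) (Jac F y) w ->
    bilin (metric c' (F y)) (v *m Jac F y) (w *m Jac F y) =
    lam y ^+ 2 * bilin (metric c y) v w) /\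
  (0 < lam y -> forall u, exists2 v, orth_ker (metric c y) (Jac F y) v & v *m
    Jac F y = u).
Let sF := local_rep_smooth Hc Hc' sf.
Let Wo : open W := smooth_map_dom_open (c:=c) (c':=c') sf.
Let WU : forall y, W y -> cimg c y := @map_dom_cimg _ _ _ _ _ f c c'.
Let WU' : forall y, W y -> cimg c' (F y) := @map_dom_target _ _ _ _ _ f c c'.
Local Notation k := (dilation c c' F).
Let S := contact_compatible Hc.
Let S' := contact_compatible Hc'.

Lemma normal_covN y : cimg c' y -> cov_vec c' (xi c') y (xi c' y) = 0.
Proof.
by move=> Uy; apply: (cov_xi_xi0_deta Hc' Uy) => v; exact: normal_deta_xi.
Qed.

Let etaN y (v : 'rV[R]_(n.*2.+1)) : W y -> deta (eta c') (F y) (xi c' (F y)) v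
  = 0.
Proof. by move=> Wy; exact: (normal_deta_xi Hc' (WU' Wy) v nN). Qed.

(** If f_* w = 0, then 0 = sigma(f_* w) = k eta(w), so xi is horizontal where k is nonzero;
    conformality on xi compares k^2 with lam^2. *)
Lemma dilation_conformal y : W y -> k y != 0 ->
  lam y ^+ 2 = k y ^+ 2 /\ 0 < lam y.
Proof.
move=> Wy k0; have [cf _] := conf Wy.
have hx : orth_ker (metric c y) (Jac F y) (xi c y).
  move=> w wD; have := pullback_eta Hc Hc' WU WU' sF s2 hol w Wy.
  rewrite (JacE sF _ Wy) wD ev0 => /esym/eqP.
  by rewrite mulf_eq0 (negbTE k0) /= bilin_xi// => [/eqP//|]; exact: WU.
have := cf _ _ hx hx; rewrite -!(JacE sF _ Wy) (dder_xi Hc Hc' WU WU' sF s2 hol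
  Wy).
rewrite bilinZl bilinZr (xi_norm S' (WU' Wy)) (xi_norm S (WU Wy)) !mulr1 -expr2
  => E.
split=> //; rewrite lt_neqAle lam_ge0 andbT eq_sym.
by move: k0; apply: contraNneq => l0; move: E; rewrite l0 expr0n /= => /eqP;
  rewrite sqrf_eq0.
Qed.

(** Lift Y to a horizontal v, which is also orthogonal to xi, and evaluate f^* d sigma = d(k eta) on
    (v, phi v). The factor k^2 = lam^2 turns |v|^2 into |Y|^2, and s^2 = 1 moves the sign across. *)
Lemma deta_endo_target y (Y : 'rV[R]_(n.*2.+1)) : W y -> k y != 0 ->
  ev (eta c' (F y)) Y = 0 ->
  k y * deta (eta c') (F y) Y (Y *m endo c' (F y)) =
  - (2 * alpha * s * bilin (metric c' (F y)) Y Y).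
Proof.
move=> Wy k0 Y0; have [lk l0] := dilation_conformal Wy k0.
have [cf onto] := conf Wy; have [v hv vY] := onto l0 Y.
have Uy := WU Wy.
have v0 : ev (eta c y) v = 0.
  have := pullback_eta Hc Hc' WU WU' sF s2 hol v Wy.
  rewrite (JacE sF _ Wy) vY Y0 => /esym/eqP.
  by rewrite mulf_eq0 (negbTE k0) => /eqP.
have := pullback_deta Hc Hc' Wo WU WU' sF s2 hol v (v *m endo c y) Wy.
rewrite v0 (eta_endo S _ Uy) !mulr0 subr0 add0r (A5_deta_endo A5 Hc Uy v0)
  hol//.
rewrite (JacE sF _ Wy) vY.
have := cf _ _ hv hv; rewrite vY lk => EY.
have -> : deta (eta c') (F y) Y (s *: (Y *m endo c' (F y))) =
    s * deta (eta c') (F y) Y (Y *m endo c' (F y)).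
  rewrite /deta evZ dder_dirZ; last exact: (eta_differentiable Hc' (WU' Wy)).
  by rewrite evZm mulrBr.
move=> E; rewrite EY.
have -> : k y * deta (eta c') (F y) Y (Y *m endo c' (F y)) =
    s * k y * (s * deta (eta c') (F y) Y (Y *m endo c' (F y))).
  by rewrite mulrACA s2 mul1r.
rewrite E; ring.
Qed.

(* d sigma = const . Omega along f, by polarization, as d sigma is phi-invariant on a
   normal manifold. *)
Lemma deta_target y (Y Z : 'rV[R]_(n.*2.+1)) : W y -> k y != 0 ->
  k y * deta (eta c') (F y) Y Z = 2 * alpha * s * fform c' Y Z (F y).
Proof.
move=> Wy k0; have Uq := WU' Wy; set q := F y in Uq *; set p := endo c' q.
have inv A B : deta (eta c') q (A *m p) (B *m p) = deta (eta c') q A B.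
  exact: (normal_deta_endo Hc' Uq A B nN).
have de := eta_differentiable Hc' Uq.
have lD A B C : deta (eta c') q A (B + C) =
  deta (eta c') q A B + deta (eta c') q A C.
  by rewrite /deta dder_dirD// evD evDm; ring.
have lZ A r B : deta (eta c') q A (r *: B) = r * deta (eta c') q A B.
  by rewrite /deta dder_dirZ// evZ evZm; ring.
have lDl A B C : deta (eta c') q (A + B) C =
  deta (eta c') q A C + deta (eta c') q B C.
  by rewrite /deta dder_dirD// evD evDm; ring.
have lN A B : deta (eta c') q A (- B) = - deta (eta c') q A B.
  by rewrite -scaleN1r lZ mulN1r.
have xr A : deta (eta c') q A (xi c' q) = 0 by rewrite detaC etaN ?oppr0.
have pp A B : deta (eta c') q A (B *m p *m p) = - deta (eta c') q A B.
  by rewrite (endo_sqr S' _ Uq) lD lN lZ xr mulr0 addr0.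
(* By invariance A may be replaced by psi A, which is orthogonal to gamma; the quadratic identity
   thus extends to all vectors, as polarization requires. *)
have quad A : k y * deta (eta c') q A (A *m p) =
    - (2 * alpha * s * bilin (metric c' q) (A *m p) (A *m p)).
  by rewrite -inv deta_endo_target// (eta_endo S' _ Uq).
have symm A B : deta (eta c') q A (B *m p) = deta (eta c') q B (A *m p).
  by rewrite -[LHS]inv pp detaC opprK.
have polar A B : k y * deta (eta c') q A (B *m p) =
    - (2 * alpha * s * bilin (metric c' q) (A *m p) (B *m p)).
  have := quad (A + B); rewrite mulmxDl lD !lDl (symm B A) !bilinDl !bilinDr.
  rewrite (Defs.metric_sym Hc' Uq (B *m p) (A *m p)).
  have := quad A; have := quad B; lra.
have := polar Y (Z *m p); rewrite pp (endo_skew S' _ _ Uq) => E.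
have -> : fform c' Y Z q = - bilin (metric c' q) Y (Z *m p *m p *m p).
  by rewrite (endo_sqr S' _ Uq) (eta_endo S' _ Uq) scale0r addr0 bilinNr opprK.
by move: E; lra.
Qed.

(** Closedness of Omega at f(x) is imported from M: k d sigma = const . Omega holds along f near x,
    k is locally constant, and d(d sigma) = 0. Where lam vanishes, f_* is zero and there is nothing
    to show. *)
Lemma semi_sasakian_tension x : W x -> tension f c c' x = 0.
Proof.
move=> Wx; apply: (contact_target_tension m0 Hc Hc' sf ss a0 A5 s2 hol
  normal_covN Wx).
move=> v v0; have Uq := WU' Wx.
have [l0|l0] := eqVneq (lam x) 0.
  have D0 : Jac F x = 0.
    apply: (conformal0 (metric_posdef Hc (WU Wx)) (metric_posdef Hc' Uq) _ l0).
    by have [] := conf Wx.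
  rewrite (JacE sF _ Wx) D0 mulmx0 /skew_cov mul0mx.
  by rewrite (linear_map0 (cov_endo_linear Hc' _ Uq)) subrr.
have lx : 0 < lam x by rewrite lt_neqAle eq_sym l0 lam_ge0.
have [_ /(_ lx) onto] := conf Wx.
have kx : k x != 0.
  have [w _ wE] := onto (xi c' (F x)).
  have := pullback_eta Hc Hc' WU WU' sF s2 hol w Wx.
  rewrite (JacE sF _ Wx) wE (ev_xi Hc' Uq) => E.
  by apply/eqP => k0; move: E; rewrite k0 mul0r => /eqP; rewrite oner_eq0.
have sk := dilation_smooth Hc Hc' Wo WU WU' sF.
have dk := smooth_differentiable sk Wx.
have dFx := smooth_differentiable sF Wx.
apply: (skew_cov_closed Hc' S' Uq); last first.
  by rewrite (pullback_eta Hc Hc' WU WU' sF s2 hol)// v0 mulr0.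
apply: (@deta_Omega_closed _ _ _ _ Hc' _ (eta c') (2 * alpha * s / k x) _ Uq).
- by move=> z A B Uz; exact (endo_skew S' _ _ Uz).
- exact (eta_sm S').
- have s0 : s != 0.
    by apply/eqP => s0; move: s2; rewrite s0 mul0r => /esym/eqP;
      rewrite oner_eq0.
  by rewrite mulf_neq0 ?invr_eq0// mulf_neq0// mulf_neq0// pnatr_eq0.
(* Derivatives on N along u are derivatives on M along a lift w of u, by the chain rule. *)
move=> u A B; have [w _ <-] := onto u; rewrite -(JacE sF _ Wx).
have df := fform_differentiable Hc' A B Uq.
have dd : differentiable (fun q => deta (eta c') q A B) (F x).
  have dde t : differentiable (fun q => dder (eta c') q t) (F x).
    exact: (smooth_differentiable (dder_smooth t (open_cimg (c:=c')) (eta_sm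
      S')) Uq).
  have d1 := differentiable_ev (dde A) (differentiable_const B (F x)).
  have d2 := differentiable_ev (dde B) (differentiable_const A (F x)).
  exact: (differentiableB d1 d2).
have ddF : differentiable (fun y => deta (eta c') (F y) A B) x.
  exact: (differentiable_comp dFx dd).
have dfF : differentiable (fun y => fform c' A B (F y)) x.
  exact: (differentiable_comp dFx df).
(* The relation between d sigma and Omega is available only where k is nonzero; continuity of k
   makes this an open set, on which it can be differentiated. *)
pose W0 := W `&` [set y | k y != 0].
have W0o : open W0.
  rewrite openE => y [Wy ky]; rewrite /interior.
  have nW : nbhs y W by exact: open_nbhs_nbhs (conj Wo Wy).
  have ck : k @ y --> k y.
    exact: (differentiable_continuous (smooth_differentiable sk Wy)).
  exact: filterI nW (cvgr_neq0 _ ck ky).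
have E : dder (fun y => k y * deta (eta c') (F y) A B) x w =
    dder (fun y => 2 * alpha * s * fform c' A B (F y)) x w.
  by apply: (dder_eq_on w W0o (conj Wx kx)) => y [Wy ky]; exact: deta_target.
move: E; rewrite (dderM _ dk ddF) (dderM _ (differentiable_const _ x) dfF)
  dder_cst.
rewrite (dilation_constant m0 Hc Hc' sf a0 A5 s2 hol normal_covN w Wx).
rewrite !mulr0 !addr0 (dder_comp _ dFx dd) (dder_comp _ dFx df) => E.
by rewrite mulrAC -E [k x * _]mulrC mulfK.
Qed.

End SemiSasakian.

(** * Almost Hermitian targets *)

Section HermitianTarget.
Variables (R : realType) (m n : nat) (M : almost_contact R m) (H :
  almost_hermitian R n).
Variables (f : M -> H) (c : chart R M m.*2.+1) (c' : chart R H n.*2).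
Hypotheses (Hc : atlas c) (Hc' : atlas c').
Hypothesis sf : smooth_map f.
Hypothesis ss : semi_symplectic M.
Variable s : R.
Hypothesis s2 : s * s = 1.
Local Notation W := (map_dom f c c').
Local Notation F := (local_rep f c c').
Hypothesis hol : forall y v, W y ->
  dder F y (v *m endo c y) = s *: (dder F y v *m endo c' (F y)).
Hypothesis covM : forall y, cimg c y -> cov_vec c (xi c) y (xi c y) = 0.
Let sF := local_rep_smooth Hc Hc' sf.
Let Wo : open W := smooth_map_dom_open (c:=c) (c':=c') sf.
Let WU : forall y, W y -> cimg c y := @map_dom_cimg _ _ _ _ _ f c c'.
Let WU' : forall y, W y -> cimg c' (F y) := @map_dom_target _ _ _ _ _ f c c'.
Let S := contact_compatible Hc.
Let S' := hermitian_compatible Hc'.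

(** phi xi = 0 forces J f_* xi = 0, and J is invertible. *)
Lemma hermitian_dder_xi y : W y -> dder F y (xi c y) = 0.
Proof.
move=> Wy; have dFy := smooth_differentiable sF Wy.
have := hol (xi c y) Wy.
rewrite (xi_endo S (WU Wy)) (linear_map0 (dder_linear dFy)).
move=> /(congr1 (fun z => s *: z *m endo c' (F y))).
rewrite scaler0 mul0mx scalerA s2 scale1r (endo_sqr S' _ (WU' Wy)) scaler0
  addr0.
by move=> /esym/eqP; rewrite oppr_eq0 => /eqP.
Qed.

Variable x : 'rV[R]_(m.*2.+1).
Hypothesis Wx : W x.
Let Ux := WU Wx.
Let Uq := WU' Wx.
Let dFx := smooth_differentiable sF Wx.

Lemma hermitian_sff_xi : sff c c' F x (xi c x) (xi c x) = 0.
Proof.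
have dxi := xi_differentiable Hc Ux; set X := xi c x.
have E : dder (fun y => dder F y (xi c y)) x X = dder (fun _ => 0) x X.
  by apply: (dder_eq_on X Wo Wx) => y Wy; exact: hermitian_dder_xi.
move: E; rewrite dder_cst (dder_along Wo sF X Wx dxi) -/X => /eqP.
rewrite addr_eq0 => /eqP E; rewrite sff.unlock E hermitian_dder_xi//.
rewrite (linear_map0 (Gamma_linear Hc' _ Uq)) addr0 -opprD -dder_dirD//.
have := covM Ux; rewrite cov_vec.unlock => ->.
by rewrite (linear_map0 (dder_linear dFx)) oppr0.
Qed.

Lemma class_C1_tension : class_C1 H -> tension f c c' x = 0.
Proof.
move=> C1; apply: (tension_skew Hc Hc' sf s2 hol Wx ss hermitian_sff_xi) => v _.
exact: class_C1_skew.
Qed.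

(** A bilinear map whose diagonal is S(Jv, v); bilinearity is what allows contraction with an
    inverse metric. *)
Let beta (v w : 'rV[R]_(n.*2)) : 'rV[R]_(n.*2) :=
  cov_endo c' (F x) (v *m endo c' (F x)) w - cov_endo c' (F x) v (w *m endo c'
    (F x)).

Let l1 v := cov_endo_linear Hc' v Uq.
Let l2 w := cov_endo_linearl Hc' w Uq.

Let beta_r v : linear (beta v).
Proof.
move=> r w w'; rewrite /beta l1 mulmxDl -scalemxAl l1; vring.
Qed.

Let beta_l w : linear (beta ^~ w).
Proof.
move=> r v v'; rewrite /beta l2 mulmxDl -scalemxAl l2; vring.
Qed.

(** Replacing v by Jv exchanges the two terms of the diagonal, with signs that restore it. Hence e_i
    and J e_i contribute equally to the trace; [r] absorbs the sign of holomorphy. *)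
Let beta_endo v (r : R) : r * r = 1 ->
  beta (r *: (v *m endo c' (F x))) (r *: (v *m endo c' (F x))) = beta v v.
Proof.
move=> r2.
have Zr t u w : beta u (t *: w) = t *: beta u w.
  by have := beta_r u t w 0; rewrite (linear_map0 (beta_r u)) !addr0.
have Zl t u w : beta (t *: u) w = t *: beta u w.
  by have := beta_l w t u 0; rewrite (linear_map0 (beta_l w)) !addr0.
rewrite Zr Zl scalerA r2 scale1r /beta (endo_sqr S' _ Uq) scaler0 addr0.
have N1 u w : cov_endo c' (F x) (- u) w = - cov_endo c' (F x) u w.
  by rewrite -[- u]scaleN1r -[-1 *: u]addr0 l2 (linear_map0 (l2 w)) addr0
    scaleN1r.
have N2 u w : cov_endo c' (F x) u (- w) = - cov_endo c' (F x) u w.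
  by rewrite -[- w]scaleN1r -[-1 *: w]addr0 l1 (linear_map0 (l1 u)) addr0
    scaleN1r.
by rewrite N1 N2; vring.
Qed.

(* Horizontal weak conformality makes the trace over M of the pulled back
   S(J., .) a multiple of its trace over H. *)
Lemma class_C2_tension (lam : R) : class_C2 H -> 0 <= lam ->
  (forall v w, orth_ker (metric c x) (Jac F x) v ->
    orth_ker (metric c x) (Jac F x) w ->
    bilin (metric c' (F x)) (v *m Jac F x) (w *m Jac F x) =
    lam ^+ 2 * bilin (metric c x) v w) ->
  (0 < lam -> forall u, exists2 v, orth_ker (metric c x) (Jac F x) v & v *m Jac
    F x = u) ->
  tension f c c' x = 0.
Proof.
move=> C2 l0 cf onto.
have [A [Ab A0 gE]] := contact_frame Hc Ux.
rewrite (tension_trace Hc Hc' sf s2 hol Wx ss Ab A0 gE) hermitian_sff_xi add0r.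
have K := conformal_gram (metric_trmx Hc Ux) (metric_posdef Hc Ux)
  (metric_posdef Hc' Uq) cf onto l0.
have [E [Eb hE]] := hermitian_frame Hc' Uq.
(* The full metric trace over H is twice the trace in the semi-Kaehler condition. *)
have tE : contraction beta (invmx (metric c' (F x))) = 0.
  rewrite hE contractionD !(contraction_gram beta_l beta_r) -big_split /=.
  rewrite (eq_bigr (fun i => 2 *: skew_cov c' (F x) (row i E))); last first.
    move=> i _; rewrite row_mul -[row i E *m _]scale1r beta_endo ?mulr1//.
    by rewrite scaler_nat mulr2n.
  rewrite -scaler_sumr; have := C2 c' Hc' _ Uq _ Eb; rewrite /herm_trace_S => T.
  rewrite (eq_bigr (fun i => tS c' (phi c' (cst (row i E))) (cst (row i E)) (F
    x))).
    by rewrite T scaler0.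
  by move=> i _; rewrite (tS_cst Hc' _ Uq).
(* Contracting beta with both sides of [K] compares the traces: the right side is lam^2 times zero,
   the left is twice the sum that occurs in the tension. *)
have := congr1 (contraction beta) K; rewrite contractionZ tE scaler0 gE.
set D := Jac F x.
have -> : D^T *m ((xi c x)^T *m xi c x + (A^T *m A + (A *m endo c x)^T *m (A *m
  endo c x))) *m D =
  (xi c x *m D)^T *m (xi c x *m D) + ((A *m D)^T *m (A *m D) +
    (A *m endo c x *m D)^T *m (A *m endo c x *m D)).
  by rewrite !mulmxDr !mulmxDl !(trmx_mul _ D) !mulmxA.
rewrite !contractionD !(contraction_gram beta_l beta_r) big_ord1 row_id.
rewrite -(JacE sF _ Wx) hermitian_dder_xi// (linear_map0 (beta_r 0)) add0r.
rewrite -big_split /=.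
rewrite (eq_bigr (fun i => 2 *: skew_cov c' (F x) (dder F x (row i A))));
  last first.
  move=> i _; rewrite !row_mul -!(JacE sF _ Wx) hol// beta_endo//.
  by rewrite scaler_nat mulr2n.
by rewrite -scaler_sumr => /eqP; rewrite scaler_eq0 pnatr_eq0 => /eqP.
Qed.

End HermitianTarget.

(** * The theorem, by type of target *)

Theorem theorem4p6 (R : realType) (m : nat) (m_gt0 : (0 < m)%N)
    (M : almost_contact R m) (M_A5 : class_A5 M) :
  ((forall (n : nat) (N : almost_contact R n) (f : M -> N),
      smooth_map f -> pm_holomorphic f ->
      [\/ class_A1 N, class_A4 N | class_B1 N] ->
      semi_symplectic M -> harmonic_map f) /\
   (forall (n : nat) (N : almost_hermitian R n) (f : M -> N),
      smooth_map f -> pm_holomorphic f ->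
      class_C1 N ->
      semi_symplectic M -> harmonic_map f)) /\
  ((forall (n : nat) (N : almost_contact R n) (f : M -> N),
      smooth_map f -> pm_holomorphic f ->
      [\/ class_A1 N, class_A4 N, class_A6 N | class_A7 N] ->
      horizontally_weakly_conformal f ->
      semi_symplectic M -> harmonic_morphism f) /\
   (forall (n : nat) (N : almost_hermitian R n) (f : M -> N),
      smooth_map f -> pm_holomorphic f ->
      class_C2 N ->
      horizontally_weakly_conformal f ->
      semi_symplectic M -> harmonic_morphism f)).
Proof.
have [alpha a0 A5] := M_A5.
have balanced n (N : almost_contact R n) (f : M -> N) : smooth_map f ->
    pm_holomorphic f -> semi_symplectic M ->
    (forall (c : chart R N n.*2.+1) y, atlas c -> cimg c y -> balanced_at c y) ->
    harmonic_map f.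
  move=> sf /holomorphic_sign[s s2 hol] ss bN p c c' Hc Hc' cp c'p.
  have Wx : map_dom f c c' (cmap c p) by exists p.
  apply: (balanced_target_tension m_gt0 Hc Hc' sf ss a0 A5 s2) => //.
  - by move=> y v; exact: hol.
  - by move=> y Uy; have [] := bN c' y Hc' Uy.
  - by move=> y Uy; exact: bN.
have covM (c : chart R M m.*2.+1) y : atlas c -> cimg c y ->
    cov_vec c (xi c) y (xi c y) = 0.
  by move=> Hc Uy; exact: (A5_cov_xi A5 Hc Uy).
split; split.
- move=> n N f sf hf cN ss; apply: balanced => // c y Hc Uy.
  case: cN => K.
  + exact: class_A1_balanced.
  + exact: class_A4_balanced.
  + exact: class_B1_balanced.
- move=> n N f sf /holomorphic_sign[s s2 hol] C1 ss p c c' Hc Hc' cp c'p.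
  have Wx : map_dom f c c' (cmap c p) by exists p.
  apply: (class_C1_tension Hc Hc' sf ss s2 _ _ Wx) => //.
  + by move=> y v; exact: hol.
  + by move=> y Uy; exact: covM.
- move=> n N f sf hf cN hw ss; split=> //.
  case: cN => K; [..|].
  + by apply: balanced => // c y Hc Uy; exact: class_A1_balanced.
  + by apply: balanced => // c y Hc Uy; exact: class_A4_balanced.
  + by apply: balanced => // c y Hc Uy; exact: class_A6_balanced.
  have [mu [mu0 hwc]] := hw; have [s s2 hol] := holomorphic_sign hf.
  move=> p c c' Hc Hc' cp c'p.
  have Wx : map_dom f c c' (cmap c p) by exists p.
  (* The conformal factor lives on the points of M and is read in the chart through [cinv c]. *)
  apply: (semi_sasakian_tension m_gt0 Hc Hc' sf ss a0 A5 s2 _ K.1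
    (lam := fun y => mu (cinv c y)) _ _ Wx) => //.
  + by move=> y v; exact: hol.
  + by move=> y Wy; exact: (conformal_at Hc Hc' sf hwc Wy).
- move=> n N f sf hf C2 hw ss; split=> //.
  have [mu [mu0 hwc]] := hw; have [s s2 hol] := holomorphic_sign hf.
  move=> p c c' Hc Hc' cp c'p.
  have Wx : map_dom f c c' (cmap c p) by exists p.
  have [cf onto] := conformal_at Hc Hc' sf hwc Wx.
  apply: (class_C2_tension Hc Hc' sf ss s2 _ _ Wx C2 (mu0 _) cf onto) => //.
  + by move=> y v; exact: hol.
  + by move=> y Uy; exact: covM.
Qed.
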